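(* Let $H$ be a Hopf algebra over a field $k$ with bijective antipode, $C$ a left $H$-module factor coalgebra of $H$, and $A={}^{\mathrm{co}\,C}H$. If $H$ is left coflat over $C$, then: (i) $\mathcal T^C$ and ${}_H\mathcal T^C$ are colocalizing subcategories, respectively, of $\mathcal M^C$ and ${}_H\mathcal M^C$; (ii) there are category equivalences ${}_H\mathcal M^C/{}_H\mathcal T^C\approx\mathcal M_A$ and $\mathcal M^C/\mathcal T^C\approx\mathcal M_A^H$. If $H$ is right coflat over $C$, then: (iii) ${}^C\mathcal T$ and ${}_H^C\mathcal T$ are colocalizing subcategories, respectively, of ${}^C\mathcal M$ and ${}_H^C\mathcal M$; (iv) there are category equivalences ${}_H^C\mathcal M/{}_H^C\mathcal T\approx{}_A\mathcal M$ and ${}^C\mathcal M/{}^C\mathcal T\approx{}_A\mathcal M^H$.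
   Context: $\Delta,\varepsilon$ are the comultiplication and counit of $H$, $\Delta(x)=\sum x_{(1)}\otimes x_{(2)}$. A left $H$-module factor coalgebra of $H$ is a quotient $C=H/I$ where $I$ is both a coideal and a left ideal of $H$; $\pi:H\to C$ is the canonical surjection, $1_C=\pi(1)$, and ${}^{\mathrm{co}\,C}H=\{h\in H\mid(\pi\otimes\mathrm{id})\Delta(h)=1_C\otimes h\}$, a subalgebra $A$ of $H$ with $\Delta(A)\subset A\otimes H$. $H$ is a left and right $C$-comodule via $(\pi\otimes\mathrm{id})\Delta$ and $(\mathrm{id}\otimes\pi)\Delta$; $H$ is left (right) coflat over $C$ if the cotensor product functor $?\,\square_CH$ on right $C$-comodules (respectively $H\,\square_C\,?$ on left $C$-comodules) is exact. $\mathcal M_A$, ${}_A\mathcal M$ are the categories of right and left $A$-modules; $\mathcal M^C$, ${}^C\mathcal M$ the categories of right and left $C$-comodules. Categories of relative Hopf modules: $\mathcal M_A^H$: right $A$-modules $M$ with a right $H$-comodule structure $\rho$ such that $\rho(ma)=\sum m_{(0)}a_{(1)}\otimes m_{(1)}a_{(2)}$; ${}_A\mathcal M^H$: left $A$-modules $M$ with a right $H$-comodule structure $\rho$ such that $\rho(am)=\sum a_{(1)}m_{(0)}\otimes a_{(2)}m_{(1)}$; ${}_H^C\mathcal M$: left $H$-modules $M$ with a left $C$-comodule structure $\lambda$ such that $\lambda(hm)=\sum h_{(1)}m_{(-1)}\otimes h_{(2)}m_{(0)}$; ${}_H\mathcal M^C$: left $H$-modules $M$ with a right $C$-comodule structure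 $\rho$ such that $\rho(hm)=\sum h_{(1)}m_{(0)}\otimes h_{(2)}m_{(1)}$. $\mathcal T^C$ is the full subcategory of $\mathcal M^C$ consisting of right comodules $V$, with structure map $\rho:V\to V\otimes C$, such that for each $v\in V$ there exists an $H$-stable subcoalgebra $R\subset C$ with $R\ne C$ and $\rho(v)\in V\otimes R$. ${}_H\mathcal T^C$ is the full subcategory of ${}_H\mathcal M^C$ consisting of Hopf modules which lie in $\mathcal T^C$ after forgetting the $H$-module structure. ${}^C\mathcal T\subset{}^C\mathcal M$ and ${}_H^C\mathcal T\subset{}_H^C\mathcal M$ are defined similarly with left comodules. A Serre subcategory $\mathcal S$ of an abelian category $\mathcal A$ is a full subcategory such that for each short exact sequence $0\to X'\to X\to X''\to0$ one has $X\in\mathcal S$ if and only if $X',X''\in\mathcal S$; $\mathcal A/\mathcal S$ is the quotient category, and $\mathcal S$ is colocalizing if the canonical functor $\mathcal A\to\mathcal A/\mathcal S$ has a left adjoint. *)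

(* Defs.v *)
From HB Require Import structures.
From mathcomp Require Import all_boot all_algebra generic_quotient.
From mathcomp Require Import boolp.

Set Implicit Arguments.
Unset Strict Implicit.
Unset Printing Implicit Defensive.

Import GRing.Theory.
Local Open Scope ring_scope.
Local Open Scope quotient_scope.

Reserved Notation "V \ox W" (at level 40, left associativity).

(* Tensor products over a field k: V \ox W is the quotient of the formal sums
   of pairs (v, w) by the congruence generated by commutativity, additivity in
   each variable, balancedness over k, and 0 (x) w = 0. *)

Section Tensor.
Variables (k : fieldType) (V W : lmodType k).

Inductive tens_rel : seq (V * W) -> seq (V * W) -> Prop :=
| tens_refl s : tens_rel s s
| tens_sym s t : tens_rel s t -> tens_rel t s
| tens_trans s t u : tens_rel s t -> tens_rel t u -> tens_rel s u
| tens_cat s s' t t' : tens_rel s s' -> tens_rel t t' ->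
    tens_rel (s ++ t) (s' ++ t')
| tens_catC s t : tens_rel (s ++ t) (t ++ s)
| tens_addl v v' w : tens_rel [:: (v + v', w)] [:: (v, w); (v', w)]
| tens_addr v w w' : tens_rel [:: (v, w + w')] [:: (v, w); (v, w')]
| tens_bal a v w : tens_rel [:: (a *: v, w)] [:: (v, a *: w)]
| tens_zero w : tens_rel [:: (0, w)] [::].

Definition tens_relb s t := `[< tens_rel s t >].

Lemma tens_relb_equiv : equiv_class_of tens_relb.
Proof.
split=> [s|s t|t s u].
- by apply/asboolP; apply: tens_refl.
- by apply/asboolP/asboolP; apply: tens_sym.
- by move=> /asboolP st /asboolP tu; apply/asboolP; apply: tens_trans st tu.
Qed.

Canonical tens_equiv := EquivRelPack tens_relb_equiv.
Canonical tens_encModRel := defaultEncModRel tens_relb.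

Definition tensor_type := {eq_quot tens_relb}.

HB.instance Definition _ : EqQuotient _ tens_relb tensor_type := EqQuotient.on tensor_type.
HB.instance Definition _ := Choice.on tensor_type.

Lemma tens_eqP s t : reflect (tens_rel s t) (s == t %[mod tensor_type]).
Proof. by rewrite piE; apply: asboolP. Qed.

Lemma tens_piE s t : tens_rel s t -> \pi_tensor_type s = \pi_tensor_type t.
Proof. by move=> /tens_eqP /eqP. Qed.

Lemma tens_reprE s : tens_rel (repr (\pi_tensor_type s)) s.
Proof. by apply/tens_eqP; rewrite reprK. Qed.

Definition tens_scale_seq a (s : seq (V * W)) := [seq (a *: p.1, p.2) | p <- s].

Lemma tens_scale_seq_rel a s t :
  tens_rel s t -> tens_rel (tens_scale_seq a s) (tens_scale_seq a t).
Proof.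
elim=> {s t} [s|s t _ IH|s t u _ IH1 _ IH2|s s' t t' _ IH1 _ IH2|s t|v v' w|v w w'|b v w|w].
- exact: tens_refl.
- exact: tens_sym.
- exact: tens_trans IH1 IH2.
- by rewrite /tens_scale_seq !map_cat; apply: tens_cat.
- by rewrite /tens_scale_seq !map_cat; apply: tens_catC.
- by rewrite /= scalerDr; apply: tens_addl.
- exact: tens_addr.
- by rewrite /= scalerA mulrC -scalerA; apply: tens_bal.
- by rewrite /= scaler0; apply: tens_zero.
Qed.

Definition tens_zero_elt := \pi_tensor_type [::].
Definition tens_add_op (x y : tensor_type) := \pi_tensor_type (repr x ++ repr y).
Definition tens_scale_op a (x : tensor_type) :=
  \pi_tensor_type (tens_scale_seq a (repr x)).
Definition tens_opp_op (x : tensor_type) := tens_scale_op (-1) x.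

Lemma tens_addE s t :
  tens_add_op (\pi_tensor_type s) (\pi_tensor_type t) = \pi_tensor_type (s ++ t).
Proof. by apply: tens_piE; apply: tens_cat; apply: tens_reprE. Qed.

Lemma tens_scaleE a s :
  tens_scale_op a (\pi_tensor_type s) = \pi_tensor_type (tens_scale_seq a s).
Proof. by apply: tens_piE; apply: tens_scale_seq_rel; apply: tens_reprE. Qed.

Lemma tens_consE p s :
  \pi_tensor_type (p :: s) = tens_add_op (\pi_tensor_type [:: p]) (\pi_tensor_type s).
Proof. by rewrite tens_addE. Qed.

Lemma tens_pi_ind (P : tensor_type -> Prop) :
  (forall s, P (\pi_tensor_type s)) -> forall x, P x.
Proof. by move=> HP x; rewrite -[x]reprK. Qed.

Lemma tens_addA : associative tens_add_op.
Proof.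
by elim/tens_pi_ind=> s; elim/tens_pi_ind=> t; elim/tens_pi_ind=> u;
  rewrite !tens_addE catA.
Qed.

Lemma tens_addC : commutative tens_add_op.
Proof.
by elim/tens_pi_ind=> s; elim/tens_pi_ind=> t;
  rewrite !tens_addE; apply: tens_piE; apply: tens_catC.
Qed.

Lemma tens_add0 : left_id tens_zero_elt tens_add_op.
Proof. by elim/tens_pi_ind=> s; rewrite /tens_zero_elt tens_addE. Qed.

Lemma tens_addN : left_inverse tens_zero_elt tens_opp_op tens_add_op.
Proof.
elim/tens_pi_ind=> s; rewrite /tens_opp_op tens_scaleE tens_addE.
elim: s => [//|[v w] s IH].
rewrite /= -[LHS]/(\pi_tensor_type ([:: (-1 *: v, w)] ++ (tens_scale_seq (-1) s ++ ([:: (v, w)] ++ s)))).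
rewrite -tens_addE -tens_addE -[X in tens_add_op _ (tens_add_op _ X)]tens_addE.
rewrite [tens_add_op (\pi [:: (v, w)]) _]tens_addC [X in tens_add_op _ X]tens_addA.
rewrite [X in tens_add_op _ (tens_add_op X _)]tens_addE IH tens_add0 tens_addE.
rewrite scaleN1r; apply: tens_piE.
have h := tens_addl (- v) v w; rewrite addNr in h.
exact: tens_trans (tens_sym h) (tens_zero _).
Qed.

HB.instance Definition _ :=
  GRing.isZmodule.Build tensor_type tens_addA tens_addC tens_add0 tens_addN.

Lemma tens_scaleA a b x :
  tens_scale_op a (tens_scale_op b x) = tens_scale_op (a * b) x.
Proof.
elim/tens_pi_ind: x => s; rewrite !tens_scaleE /tens_scale_seq -map_comp.
by congr \pi_tensor_type; apply: eq_map => p /=; rewrite scalerA.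
Qed.

Lemma tens_scale1 : left_id 1 tens_scale_op.
Proof.
elim/tens_pi_ind=> s; rewrite tens_scaleE /tens_scale_seq.
by congr \pi_tensor_type; rewrite -[RHS]map_id; apply: eq_map => -[v w] /=; rewrite scale1r.
Qed.

Lemma tens_scaleDr : right_distributive tens_scale_op +%R.
Proof.
move=> a x y; elim/tens_pi_ind: x => s; elim/tens_pi_ind: y => t.
rewrite -[_ + _]/(tens_add_op _ _) -[RHS]/(tens_add_op _ _).
by rewrite tens_addE !tens_scaleE tens_addE /tens_scale_seq map_cat.
Qed.

Lemma tens_scaleDl x : {morph tens_scale_op^~ x : a b / a + b}.
Proof.
move=> a b; elim/tens_pi_ind: x => s /=; rewrite -[RHS]/(tens_add_op _ _).
rewrite !tens_scaleE; elim: s => [|[v w] s IH] /=; first by rewrite tens_addE.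
rewrite [LHS]tens_consE IH scalerDl (tens_piE (tens_addl _ _ _)) [X in tens_add_op X]tens_consE.
rewrite [X in _ = tens_add_op X _]tens_consE [X in _ = tens_add_op _ X]tens_consE.
rewrite -!tens_addA; congr tens_add_op; rewrite !tens_addA; congr tens_add_op.
exact: tens_addC.
Qed.

HB.instance Definition _ := GRing.Zmodule_isLmodule.Build k tensor_type
  tens_scaleA tens_scale1 tens_scaleDr tens_scaleDl.

Definition tensor : lmodType k := tensor_type.

Definition tens (v : V) (w : W) : tensor :=
  \pi_tensor_type [:: (v, w)].

Lemma tens_piD s t : \pi_tensor_type (s ++ t) = \pi_tensor_type s + \pi_tensor_type t.
Proof. by rewrite -tens_addE. Qed.

Lemma tens_pi_sum s : \pi_tensor_type s = \sum_(p <- s) tens p.1 p.2.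
Proof.
elim: s => [|[v w] s IH]; first by rewrite big_nil.
by rewrite big_cons -cat1s tens_piD IH.
Qed.

Lemma tens_sumE (t : tensor) : t = \sum_(p <- repr t) tens p.1 p.2.
Proof. by rewrite -tens_pi_sum reprK. Qed.

Lemma tensDl v v' w : tens (v + v') w = tens v w + tens v' w.
Proof. by rewrite -tens_piD; apply: tens_piE; apply: tens_addl. Qed.

Lemma tensDr v w w' : tens v (w + w') = tens v w + tens v w'.
Proof. by rewrite -tens_piD; apply: tens_piE; apply: tens_addr. Qed.

Lemma tensZl a v w : tens (a *: v) w = a *: tens v w.
Proof. by rewrite -[RHS]/(tens_scale_op _ _) tens_scaleE. Qed.

Lemma tensZr a v w : tens v (a *: w) = a *: tens v w.
Proof. by rewrite -tensZl; apply/esym/tens_piE; apply: tens_bal. Qed.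

Lemma tens0l w : tens 0 w = 0.
Proof. by rewrite -(scale0r 0) tensZl scale0r. Qed.

Lemma tens0r v : tens v 0 = 0.
Proof. by rewrite -(scale0r 0) tensZr scale0r. Qed.

Lemma tens_ind (P : tensor -> Prop) :
  P 0 -> (forall v w t, P t -> P (tens v w + t)) -> forall t, P t.
Proof.
move=> P0 PD t; rewrite (tens_sumE t).
by elim: (repr t) => [|p s IH]; rewrite ?big_nil // big_cons; apply: PD.
Qed.

Definition bilinear_map (U : lmodType k) (f : V -> W -> U) :=
  (forall w, linear (f^~ w)) /\ (forall v, linear (f v)).

Lemma tens_bilinear : bilinear_map tens.
Proof. by split=> [w|v] a x y /=; rewrite ?tensDl ?tensZl ?tensDr ?tensZr. Qed.

(* [tlift f] is the linear map with [tlift f (tens v w) = f v w]. It is computed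
   from a chosen expression of t as a sum of elementary tensors, hence is
   meaningful only for f bilinear (see tliftE). *)
Definition tlift (U : lmodType k) (f : V -> W -> U) (t : tensor) : U :=
  \sum_(p <- repr t) f p.1 p.2.

Section Lift.
Variables (U : lmodType k) (f : V -> W -> U) (bf : bilinear_map f).

Lemma bilinDl v v' w : f (v + v') w = f v w + f v' w.
Proof. by have := bf.1 w 1 v v'; rewrite !scale1r. Qed.

Lemma bilinDr v w w' : f v (w + w') = f v w + f v w'.
Proof. by have := bf.2 v 1 w w'; rewrite !scale1r. Qed.

Lemma bilin0l w : f 0 w = 0.
Proof. by apply: (addrI (f 0 w)); rewrite -bilinDl !addr0. Qed.

Lemma bilin0r v : f v 0 = 0.
Proof. by apply: (addrI (f v 0)); rewrite -bilinDr !addr0. Qed.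

Lemma bilinZl a v w : f (a *: v) w = a *: f v w.
Proof. by have := bf.1 w a v 0; rewrite !addr0 bilin0l addr0. Qed.

Lemma bilinZr a v w : f v (a *: w) = a *: f v w.
Proof. by have := bf.2 v a w 0; rewrite !addr0 bilin0r addr0. Qed.

Lemma tens_rel_sum s t : tens_rel s t ->
  \sum_(p <- s) f p.1 p.2 = \sum_(p <- t) f p.1 p.2.
Proof.
elim=> {s t} [//|//|s t u _ -> _ -> //|s s' t t' _ IH1 _ IH2|s t|v v' w|v w w'|b v w|w].
- by rewrite !big_cat /= IH1 IH2.
- by rewrite !big_cat /= addrC.
- by rewrite !big_cons !big_nil !addr0 bilinDl.
- by rewrite !big_cons !big_nil !addr0 bilinDr.
- by rewrite !big_cons !big_nil !addr0 bilinZl bilinZr.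
- by rewrite !big_cons !big_nil !addr0 bilin0l.
Qed.

Lemma tlift_pi s : tlift f (\pi_tensor_type s) = \sum_(p <- s) f p.1 p.2.
Proof. by apply: tens_rel_sum; apply: tens_reprE. Qed.

Lemma tliftE v w : tlift f (tens v w) = f v w.
Proof. by rewrite tlift_pi big_cons big_nil addr0. Qed.

Lemma tlift_linear : linear (tlift f).
Proof.
move=> a x y; elim/tens_pi_ind: x => s; elim/tens_pi_ind: y => t.
rewrite -[a *: _]/(tens_scale_op _ _) tens_scaleE -tens_piD !tlift_pi big_cat.
rewrite scaler_sumr big_map /=; congr (_ + _).
by apply: eq_bigr => p _; rewrite bilinZl.
Qed.

Lemma tliftD s t : tlift f (s + t) = tlift f s + tlift f t.
Proof. by have := tlift_linear 1 s t; rewrite !scale1r. Qed.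

Lemma tlift0 : tlift f 0 = 0.
Proof. by apply: (addrI (tlift f 0)); rewrite -tliftD !addr0. Qed.

End Lift.

Lemma tens_linear_ext (U : lmodType k) (f g : tensor -> U) :
  linear f -> linear g -> (forall v w, f (tens v w) = g (tens v w)) -> f =1 g.
Proof.
move=> lf lg fg; have D (h : tensor -> U) : linear h -> {morph h : x y / x + y}.
  by move=> lh x y; have := lh 1 x y; rewrite !scale1r.
have Z (h : tensor -> U) : linear h -> h 0 = 0.
  by move=> lh; apply: (addrI (h 0)); rewrite -D // !addr0.
by elim/tens_ind=> [|v w t IH]; rewrite ?Z // !D // fg IH.
Qed.

End Tensor.

Arguments tensor {k} (V W)%_type_scope.
Notation "V \ox W" := (tensor V W) : type_scope.
Notation "v \ox w" := (tens v w) : ring_scope.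

Section TensorMaps.
Variables (k : fieldType).
Implicit Types U V W : lmodType k.

Definition tmap V W V' W' (f : V -> V') (g : W -> W') : V \ox W -> V' \ox W' :=
  tlift (fun v w => f v \ox g w).

Lemma tmap_bilin V W V' W' (f : {linear V -> V'}) (g : {linear W -> W'}) :
  bilinear_map (fun v w => f v \ox g w).
Proof.
by split=> [w|v] a x y; rewrite linearP ?tensDl ?tensZl ?tensDr ?tensZr.
Qed.

Lemma tmapE V W V' W' (f : {linear V -> V'}) (g : {linear W -> W'}) v w :
  tmap f g (v \ox w) = f v \ox g w.
Proof. exact: (tliftE (tmap_bilin f g)). Qed.

Lemma tmap_linear V W V' W' (f : {linear V -> V'}) (g : {linear W -> W'}) :
  linear (tmap f g).
Proof. exact: tlift_linear (tmap_bilin f g). Qed.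

HB.instance Definition _ V W V' W' (f : {linear V -> V'}) (g : {linear W -> W'}) :=
  GRing.isLinear.Build k (tensor V W) (tensor V' W') *:%R (tmap f g) (tmap_linear f g).

Lemma eq_tmap V W V' W' (f f' : V -> V') (g g' : W -> W') :
  f =1 f' -> g =1 g' -> tmap f g =1 tmap f' g'.
Proof. by move=> ff gg t; apply: eq_bigr => p _; rewrite ff gg. Qed.

Lemma tmap_id V W : tmap (@idfun V) (@idfun W) =1 id.
Proof.
elim/tens_ind=> [|v w t IH]; first exact: linear0.
by rewrite linearD /= tmapE IH.
Qed.

Lemma tmap_comp V W V' W' V'' W'' (f : {linear V -> V'}) (g : {linear W -> W'})
    (f' : {linear V' -> V''}) (g' : {linear W' -> W''}) t :
  tmap f' g' (tmap f g t) = tmap (f' \o f) (g' \o g) t.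
Proof.
elim/tens_ind: t => [|v w t IH]; first by rewrite !linear0.
by rewrite !linearD /= IH !tmapE.
Qed.

Definition tassoc U V W : (U \ox V) \ox W -> U \ox (V \ox W) :=
  tlift (fun x w => tlift (fun u v => u \ox (v \ox w)) x).

Lemma tassoc_bilin1 U V W (w : W) :
  bilinear_map (fun (u : U) (v : V) => u \ox (v \ox w)).
Proof.
by split=> [v|u] a x y; rewrite ?tensDl ?tensZl ?tensDr ?tensZr.
Qed.

Arguments tassoc_bilin1 {U V W} w.

Lemma tassoc_bilin U V W :
  bilinear_map (fun (x : tensor U V) (w : W) => tlift (fun u v => u \ox (v \ox w)) x).
Proof.
split=> [w|x] a s t /=; first exact: (tlift_linear (@tassoc_bilin1 U V W w) a s t).
elim/tens_ind: x => [|u v x IH]; first by rewrite !(tlift0 (tassoc_bilin1 _)) scaler0 addr0.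
rewrite !(tliftD (tassoc_bilin1 _)) !(tliftE (tassoc_bilin1 _)) IH.
by rewrite !(tensDr, tensZr) scalerDr addrACA.
Qed.

Lemma tassocE U V W (u : U) (v : V) (w : W) :
  tassoc (u \ox v \ox w) = u \ox (v \ox w).
Proof. by rewrite /tassoc (tliftE (tassoc_bilin _ _ _)) (tliftE (tassoc_bilin1 _)). Qed.

Lemma tassoc_linear U V W : linear (@tassoc U V W).
Proof. exact: tlift_linear (tassoc_bilin U V W). Qed.

HB.instance Definition _ U V W :=
  GRing.isLinear.Build k (tensor (tensor U V) W) (tensor U (tensor V W)) *:%R (@tassoc U V W)
    (@tassoc_linear U V W).

Lemma tens_ind3 U V W (P : (U \ox V) \ox W -> Prop) :
  P 0 -> (forall s t, P s -> P t -> P (s + t)) ->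
  (forall u v w, P (u \ox v \ox w)) -> forall t, P t.
Proof.
move=> P0 PD PE t; elim/tens_ind: t => [//|x w t IH]; apply: (PD) => // {t IH}.
elim/tens_ind: x => [|u v x IHx]; first by rewrite tens0l.
by rewrite tensDl; apply: PD.
Qed.

Lemma tassoc_nat U V W U' V' W' (f : {linear U -> U'}) (g : {linear V -> V'})
    (h : {linear W -> W'}) t :
  tassoc (tmap (tmap f g) h t) = tmap f (tmap g h) (tassoc t).
Proof.
elim/tens_ind3: t => [|s t IHs IHt|u v w]; first by rewrite !linear0.
  by rewrite !linearD /= IHs IHt.
by rewrite (tassocE u v w) !tmapE /= !tmapE tassocE.
Qed.

(* For bilinear f and g, the bilinear map with
   (u (x) u', v (x) v') |-> f u v (x) g u' v'. *)
Definition tmap2 U U' V V' W W' (f : U -> V -> W) (g : U' -> V' -> W')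
    (s : U \ox U') (t : V \ox V') : W \ox W' :=
  tlift (fun u u' => tmap (f u) (g u') t) s.

(* t lies in the image of P (x) Q. *)
Definition tens_in V W (P : {pred V}) (Q : {pred W}) (t : V \ox W) :=
  exists2 s : seq (V * W), all (fun p => (p.1 \in P) && (p.2 \in Q)) s
                         & t = \sum_(p <- s) p.1 \ox p.2.

Lemma tlift_tmap V W V' W' U (f : {linear V -> V'}) (g : {linear W -> W'})
    (h : V' -> W' -> U) (bh : bilinear_map h) t :
  tlift h (tmap f g t) = tlift (fun v w => h (f v) (g w)) t.
Proof.
have bh' : bilinear_map (fun v w => h (f v) (g w)).
  by split=> [w|v] a x y; rewrite linearP ?(bilinDl bh) ?(bilinDr bh)
    ?(bilinZl bh) ?(bilinZr bh).
elim/tens_ind: t => [|v w t IH].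
  by rewrite linear0 (tlift0 bh) (tlift0 bh').
by rewrite linearD /= tmapE (tliftD bh) (tliftD bh') IH (tliftE bh) (tliftE bh').
Qed.

End TensorMaps.

HB.mixin Record Lmodule_isCoalgebra (k : fieldType) C of GRing.Lmodule k C := {
  comul : C -> C \ox C;
  counit : C -> k;
  comul_linear : linear comul;
  counit_scalar : scalar counit;
  comulA : forall x : C, tassoc (tmap comul idfun (comul x)) =
                         tmap idfun comul (comul x);
  counitl : forall x : C, tlift (fun y z => counit y *: z) (comul x) = x;
  counitr : forall x : C, tlift (fun y z => counit z *: y) (comul x) = x
}.

#[short(type="coalgType")]
HB.structure Definition Coalgebra (k : fieldType) :=
  {C of GRing.Lmodule k C & Lmodule_isCoalgebra k C}.

Arguments comul {k s} _.
Arguments counit {k s} _.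

HB.instance Definition _ (k : fieldType) (C : coalgType k) :=
  GRing.isLinear.Build k C (tensor C C) *:%R (@comul k C) comul_linear.
HB.instance Definition _ (k : fieldType) (C : coalgType k) :=
  GRing.isLinear.Build k C k *%R (@counit k C) counit_scalar.

HB.mixin Record isHopfAlgebra (k : fieldType) H of GRing.Algebra k H & Coalgebra k H := {
  antipode : H -> H;
  comulM : forall x y : H, comul (x * y) = tmap2 *%R *%R (comul x) (comul y);
  comul1 : comul (1 : H) = 1 \ox 1;
  counitM : forall x y : H, counit (x * y) = counit x * counit y;
  counit1 : counit (1 : H) = 1;
  antipode_linear : linear antipode;
  antipodel : forall x : H,
    tlift (fun y z => antipode y * z) (comul x) = counit x *: 1;
  antipoder : forall x : H,
    tlift (fun y z => y * antipode z) (comul x) = counit x *: 1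
}.

#[short(type="hopfAlgType")]
HB.structure Definition HopfAlgebra (k : fieldType) :=
  {H of GRing.Algebra k H & Coalgebra k H & isHopfAlgebra k H}.

Arguments antipode {k s} _.

Section FactorCoalgebra.
Variables (k : fieldType) (H : hopfAlgType k).

Record left_ideal_coideal := LeftIdealCoideal {
  lic_pred :> {pred H};
  lic_submod : submod_closed lic_pred;
  lic_mul : forall h x, x \in lic_pred -> h * x \in lic_pred;
  lic_counit : forall x, x \in lic_pred -> counit x = 0;
  lic_comul : forall x, x \in lic_pred -> exists s t,
    [/\ tens_in lic_pred predT s, tens_in predT lic_pred t & comul x = s + t]
}.

Variable I : left_ideal_coideal.

Definition lic_fun (x : H) : bool := x \in lic_pred I.

Lemma lic_zmod : zmod_closed lic_fun.
Proof. exact: GRing.submod_closedB (lic_submod I). Qed.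

Definition lic_closed : zmodClosed H :=
  HB.pack lic_fun (GRing.isZmodClosed.Build H lic_fun lic_zmod).

Definition factor_type := Quotient.quot lic_closed.

HB.instance Definition _ := GRing.Zmodule.on factor_type.
HB.instance Definition _ := EqQuotient.on factor_type.

Definition factor_pi (h : H) : factor_type := \pi_factor_type h.

Lemma factor_piP x y : reflect (factor_pi x = factor_pi y) (x - y \in lic_pred I).
Proof.
rewrite -[x - y \in _]/(x - y \in lic_closed) Quotient.idealrBE.
by apply: (iffP eqP).
Qed.

Lemma factor_ind (P : factor_type -> Prop) :
  (forall h, P (factor_pi h)) -> forall c, P c.
Proof. by move=> HP c; rewrite -[c]reprK; apply: HP. Qed.

Lemma factor_piD x y : factor_pi (x + y) = factor_pi x + factor_pi y.
Proof. by rewrite /factor_pi !piE. Qed.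

(* The map H / I -> T induced by a map f : H -> T that is constant on cosets. *)
Definition factor_lift T (f : H -> T) (c : factor_type) := f (repr c).

Lemma factor_liftE T (f : H -> T) :
  (forall x y, x - y \in lic_pred I -> f x = f y) ->
  forall x, factor_lift f (factor_pi x) = f x.
Proof. by move=> fP x; apply: fP; apply/factor_piP; rewrite /factor_pi reprK. Qed.

Definition factor_scale (a : k) := factor_lift (fun x => factor_pi (a *: x)).

Lemma factor_scaleE a x : factor_scale a (factor_pi x) = factor_pi (a *: x).
Proof.
apply: factor_liftE => {x} x y xy; apply/factor_piP.
rewrite -scalerBr -[a *: _]addr0.
by have [I0 IL] := lic_submod I; apply: IL.
Qed.

Lemma factor_scaleA a b c : factor_scale a (factor_scale b c) = factor_scale (a * b) c.
Proof. by elim/factor_ind: c => x; rewrite !factor_scaleE scalerA. Qed.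
Lemma factor_scale1 : left_id 1 factor_scale.
Proof. by elim/factor_ind=> x; rewrite factor_scaleE scale1r. Qed.
Lemma factor_scaleDr : right_distributive factor_scale +%R.
Proof.
move=> a; elim/factor_ind=> x; elim/factor_ind=> y.
by rewrite -factor_piD !factor_scaleE scalerDr factor_piD.
Qed.
Lemma factor_scaleDl c : {morph factor_scale^~ c : a b / a + b}.
Proof.
by move=> a b; elim/factor_ind: c => x; rewrite !factor_scaleE scalerDl factor_piD.
Qed.

HB.instance Definition _ := GRing.Zmodule_isLmodule.Build k factor_type
  factor_scaleA factor_scale1 factor_scaleDr factor_scaleDl.

Lemma factor_pi_linear : linear factor_pi.
Proof. by move=> a x y; rewrite factor_piD -factor_scaleE. Qed.

HB.instance Definition _ := GRing.isLinear.Build k H factor_type *:%R factor_pi factor_pi_linear.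

Lemma factor_pi0 x : x \in lic_pred I -> factor_pi x = 0.
Proof. by move=> xI; rewrite -(linear0 factor_pi); apply/factor_piP; rewrite subr0. Qed.

Definition factor_comul := factor_lift (fun x => tmap factor_pi factor_pi (comul x)).
Definition factor_counit := factor_lift (fun x => counit x).

Lemma factor_comulE x : factor_comul (factor_pi x) = tmap factor_pi factor_pi (comul x).
Proof.
apply: factor_liftE => {x} x y /lic_comul [s [t [[ls sP sE] [lt tP tE] E]]].
apply/eqP; rewrite -subr_eq0 -!linearB; apply/eqP.
rewrite /= E linearD /= sE tE !linear_sum /= !big1_seq ?addr0 // => p.
  move=> /andP [_ /(allP tP) /andP [_ p2]].
  by rewrite tmapE /= (factor_pi0 p2) tens0r.
move=> /andP [_ /(allP sP) /andP [p1 _]].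
by rewrite tmapE /= (factor_pi0 p1) tens0l.
Qed.

Lemma factor_counitE x : factor_counit (factor_pi x) = counit x.
Proof.
apply: factor_liftE => {x} x y /lic_counit E.
by apply/eqP; rewrite -subr_eq0 -linearB; apply/eqP.
Qed.

Lemma factor_comul_linear : linear factor_comul.
Proof.
move=> a; elim/factor_ind=> x; elim/factor_ind=> y.
by rewrite -linearP !factor_comulE !linearP.
Qed.

Lemma factor_counit_scalar : scalar factor_counit.
Proof.
move=> a; elim/factor_ind=> x; elim/factor_ind=> y.
by rewrite -linearP !factor_counitE linearP.
Qed.

HB.instance Definition _ :=
  GRing.isLinear.Build k factor_type (tensor factor_type factor_type) *:%R factor_comul factor_comul_linear.

HB.instance Definition _ :=
  GRing.isLinear.Build k factor_type k *%R factor_counit factor_counit_scalar.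

Lemma factor_comulA x : tassoc (tmap factor_comul idfun (factor_comul x)) =
  tmap idfun factor_comul (factor_comul x).
Proof.
elim/factor_ind: x => x; rewrite factor_comulE !tmap_comp.
rewrite (eq_tmap (f' := tmap factor_pi factor_pi \o comul) factor_comulE
  (g' := factor_pi \o idfun)) //.
rewrite [RHS](eq_tmap (f' := factor_pi \o idfun) _
  (g' := tmap factor_pi factor_pi \o comul)) //; last exact: factor_comulE.
by rewrite -!tmap_comp tassoc_nat comulA.
Qed.

Lemma counit_bilinl (V : lmodType k) (f : {linear V -> k | *%R}) (W : lmodType k) :
  bilinear_map (fun (y : V) (z : W) => f y *: z).
Proof.
split=> [z|y] a s t; first by rewrite linearP scalerDl scalerA.
by rewrite scalerDr scalerA mulrC -scalerA.
Qed.

Lemma counit_bilinr (V : lmodType k) (f : {linear V -> k | *%R}) (W : lmodType k) :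
  bilinear_map (fun (z : W) (y : V) => f y *: z).
Proof.
split=> [y|z] a s t; first by rewrite scalerDr scalerA mulrC -scalerA.
by rewrite linearP scalerDl scalerA.
Qed.

Lemma factor_counitl x :
  tlift (fun y z => factor_counit y *: z) (factor_comul x) = x.
Proof.
elim/factor_ind: x => x; rewrite factor_comulE tlift_tmap; last exact: counit_bilinl.
rewrite -[in RHS](counitl x) /tlift linear_sum; apply: eq_bigr => p _ /=.
by rewrite factor_counitE linearZ.
Qed.

Lemma factor_counitr x :
  tlift (fun y z => factor_counit z *: y) (factor_comul x) = x.
Proof.
elim/factor_ind: x => x; rewrite factor_comulE tlift_tmap; last exact: counit_bilinr.
rewrite -[in RHS](counitr x) /tlift linear_sum; apply: eq_bigr => p _ /=.
by rewrite factor_counitE linearZ.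
Qed.

HB.instance Definition _ := Lmodule_isCoalgebra.Build k factor_type
  factor_comul_linear factor_counit_scalar factor_comulA factor_counitl factor_counitr.

(* C = H / I *)
Definition factor : coalgType k := factor_type.

Definition factor_act (h : H) := factor_lift (fun x => factor_pi (h * x)).

Lemma factor_actE h x : factor_act h (factor_pi x) = factor_pi (h * x).
Proof.
apply: factor_liftE => {x} x y xy; apply/factor_piP.
by rewrite -mulrBr; apply: lic_mul.
Qed.

Definition one_factor : factor := factor_pi 1.

Lemma factor_act_bilin : bilinear_map factor_act.
Proof.
split=> [c|h] a x y; last first.
  elim/factor_ind: x => x; elim/factor_ind: y => y.
  by rewrite -linearP !factor_actE -linearP mulrDr scalerAr.
by elim/factor_ind: c => c; rewrite !factor_actE -linearP mulrDl scalerAl.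
Qed.

Definition coinv_pred (h : H) : bool :=
  tmap factor_pi idfun (comul h) == one_factor \ox h.

End FactorCoalgebra.

Section Coinvariants.
Variables (k : fieldType) (H : hopfAlgType k) (I : left_ideal_coideal H).
Local Notation C := (factor I).
Local Notation pi := (@factor_pi k H I).
Local Notation P := (@coinv_pred k H I).

Lemma comul_coinvM (x y : H) : y \in P ->
  tmap pi idfun (comul (x * y)) = tmap idfun ( *%R^~ y) (tmap pi idfun (comul x)).
Proof.
move=> /eqP yP; rewrite comulM.
have lmul (a : H) : linear ( *%R a) by move=> b u v; rewrite mulrDr scalerAr.
have lact (a : H) := (factor_act_bilin I).2 a.
pose L (a : H) : {linear H -> H} := HB.pack ( *%R a) (GRing.isLinear.Build k H H *:%R _ (lmul a)).
pose N (a : H) : {linear C -> C} :=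
  HB.pack (factor_act a) (GRing.isLinear.Build k C C *:%R _ (lact a)).
have rmul : linear ( *%R^~ y) by move=> b u v; rewrite mulrDl scalerAl.
pose R : {linear H -> H} := HB.pack ( *%R^~ y) (GRing.isLinear.Build k H H *:%R _ rmul).
rewrite [RHS](tmap_comp pi idfun idfun R) [RHS]/tmap /tmap2 /tlift linear_sum.
apply: eq_bigr => p _; rewrite /= (tmap_comp (L p.1) (L p.2) pi idfun).
have -> : tmap (pi \o L p.1) (idfun \o L p.2) (comul y) =
          tmap (N p.1 \o pi) (L p.2 \o idfun) (comul y).
  by apply: eq_tmap => z //=; rewrite factor_actE.
by rewrite -tmap_comp yP tmapE /= factor_actE mulr1.
Qed.

Lemma coinv_subalg : GRing.subsemialg_closed P.
Proof.
have P0 : 0 \in P by rewrite /in_mem /= /coinv_pred !linear0 tens0r.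
have P1 : 1 \in P by rewrite /in_mem /= /coinv_pred comul1 tmapE.
split=> //; first by split=> // x y /eqP xP /eqP yP; apply/eqP;
  rewrite !linearD /= xP yP tensDr.
  by move=> a x /eqP xP; apply/eqP; rewrite !linearZ /= xP tensZr.
move=> x y /eqP xP yP; apply/eqP; rewrite comul_coinvM // xP.
have lmul : linear ( *%R^~ y) by move=> b u v; rewrite mulrDl scalerAl.
pose L : {linear H -> H} := HB.pack ( *%R^~ y) (GRing.isLinear.Build k H H *:%R _ lmul).
exact: (tmapE idfun L).
Qed.

HB.instance Definition _ := GRing.isSubalgClosed.Build k H P coinv_subalg.

Record coinv_type := Coinv { coinv_val :> H; coinvP : P coinv_val }.

HB.instance Definition _ := [isSub for coinv_val].
HB.instance Definition _ := [Choice of coinv_type by <:].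
HB.instance Definition _ := [SubChoice_isSubAlgebra of coinv_type by <:].

Lemma coinv_val_linear : linear coinv_val.
Proof. by move=> a x y; rewrite -[coinv_val _]/(val _) linearP. Qed.

HB.instance Definition _ := GRing.isLinear.Build k coinv_type H *:%R coinv_val coinv_val_linear.

(* A = {}^{co C} H *)
Definition coinv : algType k := coinv_type.

End Coinvariants.

(* Categories are taken with an explicit equivalence relation on morphisms. *)

Record category := Category {
  ob :> Type;
  hom : ob -> ob -> Type;
  heq : forall X Y, hom X Y -> hom X Y -> Prop;
  idm : forall X, hom X X;
  cmp : forall X Y Z, hom Y Z -> hom X Y -> hom X Z;
  heq_refl : forall X Y (f : hom X Y), heq f f;
  heq_sym : forall X Y (f g : hom X Y), heq f g -> heq g f;
  heq_trans : forall X Y (f g h : hom X Y), heq f g -> heq g h -> heq f h;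
  heq_cmp : forall X Y Z (g g' : hom Y Z) (f f' : hom X Y),
    heq g g' -> heq f f' -> heq (cmp g f) (cmp g' f');
  cmpA : forall X Y Z T (h : hom Z T) (g : hom Y Z) (f : hom X Y),
    heq (cmp h (cmp g f)) (cmp (cmp h g) f);
  cmp_idl : forall X Y (f : hom X Y), heq (cmp (idm Y) f) f;
  cmp_idr : forall X Y (f : hom X Y), heq (cmp f (idm X)) f
}.

Arguments hom {c} X Y.
Arguments heq {c X Y} f g.
Arguments idm {c} X.
Arguments cmp {c X Y Z} g f.

Record functor (A B : category) := Functor {
  fob :> A -> B;
  fmap : forall X Y, hom X Y -> hom (fob X) (fob Y);
  fmap_heq : forall X Y (f g : hom X Y), heq f g -> heq (fmap f) (fmap g);
  fmap_id : forall X, heq (fmap (idm X)) (idm (fob X));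
  fmap_cmp : forall X Y Z (g : hom Y Z) (f : hom X Y),
    heq (fmap (cmp g f)) (cmp (fmap g) (fmap f))
}.

Arguments fmap {A B} _ {X Y} _.

Definition functor_id (A : category) : functor A A.
Proof.
by apply: (@Functor A A id (fun _ _ f => f)) => *; rewrite // ; apply: heq_refl.
Defined.

Definition functor_cmp (A B C : category) (G : functor B C) (F : functor A B) :
  functor A C.
Proof.
apply: (@Functor A C (fun X => G (F X)) (fun _ _ f => fmap G (fmap F f))).
- by move=> X Y f g fg; do 2 apply: fmap_heq.
- by move=> X; apply: heq_trans (fmap_id G _); apply/fmap_heq/fmap_id.
- by move=> X Y Z g f; apply: heq_trans (fmap_cmp G _ _); apply/fmap_heq/fmap_cmp.
Defined.

Record natural_iso (A B : category) (F G : functor A B) := NaturalIso {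
  ni_hom : forall X, hom (F X) (G X);
  ni_inv : forall X, hom (G X) (F X);
  ni_natural : forall X Y (f : hom X Y),
    heq (cmp (ni_hom Y) (fmap F f)) (cmp (fmap G f) (ni_hom X));
  ni_invl : forall X, heq (cmp (ni_inv X) (ni_hom X)) (idm (F X));
  ni_invr : forall X, heq (cmp (ni_hom X) (ni_inv X)) (idm (G X))
}.

Definition cat_equivalent (A B : category) : Prop :=
  exists (F : functor A B) (G : functor B A),
    inhabited (natural_iso (functor_cmp G F) (functor_id A)) /\
    inhabited (natural_iso (functor_cmp F G) (functor_id B)).

(* G is left adjoint to F. *)
Record adjunction (A B : category) (G : functor B A) (F : functor A B) := Adjunction {
  adj_unit : forall X : B, hom X (F (G X));
  adj_counit : forall Y : A, hom (G (F Y)) Y;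
  adj_unit_natural : forall (X X' : B) (f : hom X X'),
    heq (cmp (adj_unit X') f) (cmp (fmap F (fmap G f)) (adj_unit X));
  adj_counit_natural : forall (Y Y' : A) (f : hom Y Y'),
    heq (cmp (adj_counit Y') (fmap G (fmap F f))) (cmp f (adj_counit Y));
  adj_triangle_left : forall X : B,
    heq (cmp (adj_counit (G X)) (fmap G (adj_unit X))) (idm (G X));
  adj_triangle_right : forall Y : A,
    heq (cmp (fmap F (adj_counit Y)) (adj_unit (F Y))) (idm (F Y))
}.

Definition has_left_adjoint (A B : category) (F : functor A B) : Prop :=
  exists G : functor B A, inhabited (adjunction G F).

Section Exactness.
Variable A : category.
Implicit Types X Y Z K : A.

Definition zero_object Z := forall X,
  (exists f : hom Z X, forall g, heq g f) /\ (exists f : hom X Z, forall g, heq g f).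

Definition zero_mor X Y (f : hom X Y) :=
  exists Z (g : hom X Z) (h : hom Z Y), zero_object Z /\ heq f (cmp h g).

Definition is_kernel K X Y (i : hom K X) (f : hom X Y) :=
  zero_mor (cmp f i) /\
  forall T (g : hom T X), zero_mor (cmp f g) ->
    exists2 u : hom T K, heq (cmp i u) g &
      forall u', heq (cmp i u') g -> heq u' u.

Definition is_cokernel X Y K (f : hom X Y) (p : hom Y K) :=
  zero_mor (cmp p f) /\
  forall T (g : hom Y T), zero_mor (cmp g f) ->
    exists2 u : hom K T, heq (cmp u p) g &
      forall u', heq (cmp u' p) g -> heq u' u.

(* 0 -> X' -> X -> X'' -> 0 *)
Definition short_exact X' X X'' (f : hom X' X) (g : hom X X'') :=
  is_kernel f g /\ is_cokernel f g.

Definition serre (S : A -> Prop) :=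
  forall X' X X'' (f : hom X' X) (g : hom X X''), short_exact f g ->
    (S X <-> S X' /\ S X'').

(* f becomes invertible in A / S: its kernel and its cokernel lie in S. *)
Definition serre_iso (S : A -> Prop) X Y (f : hom X Y) :=
  (exists K (i : hom K X), is_kernel i f /\ S K) /\
  (exists K (p : hom Y K), is_cokernel f p /\ S K).

End Exactness.

Definition exact_functor (A B : category) (F : functor A B) :=
  forall X Y Z (f : hom X Y) (g : hom Y Z),
    short_exact f g -> short_exact (fmap F f) (fmap F g).

(* The quotient category A / S, as the category of fractions of A with respect to
   the morphisms with kernel and cokernel in S: it has the objects of A, and its
   morphisms are the formal composites of morphisms of A and of inverses of such
   morphisms, modulo the congruence generated by the relations of A and those
   making the formal inverses two-sided inverses. *)

Section SerreQuotient.
Variables (A : category) (S : A -> Prop).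

Inductive qhom : A -> A -> Type :=
| qmor X Y (f : hom X Y) : qhom X Y
| qinv X Y (f : hom X Y) (fS : serre_iso S f) : qhom Y X
| qcmp X Y Z (g : qhom Y Z) (f : qhom X Y) : qhom X Z.

Inductive qeq : forall X Y, qhom X Y -> qhom X Y -> Prop :=
| qeq_refl X Y (f : qhom X Y) : qeq f f
| qeq_sym X Y (f g : qhom X Y) : qeq f g -> qeq g f
| qeq_trans X Y (f g h : qhom X Y) : qeq f g -> qeq g h -> qeq f h
| qeq_cmp X Y Z (g g' : qhom Y Z) (f f' : qhom X Y) :
    qeq g g' -> qeq f f' -> qeq (qcmp g f) (qcmp g' f')
| qeq_cmpA X Y Z T (h : qhom Z T) (g : qhom Y Z) (f : qhom X Y) :
    qeq (qcmp h (qcmp g f)) (qcmp (qcmp h g) f)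
| qeq_idl X Y (f : qhom X Y) : qeq (qcmp (qmor (idm Y)) f) f
| qeq_idr X Y (f : qhom X Y) : qeq (qcmp f (qmor (idm X))) f
| qeq_mor X Y (f g : hom X Y) : heq f g -> qeq (qmor f) (qmor g)
| qeq_mor_cmp X Y Z (g : hom Y Z) (f : hom X Y) :
    qeq (qmor (cmp g f)) (qcmp (qmor g) (qmor f))
| qeq_invl X Y (f : hom X Y) (fS : serre_iso S f) :
    qeq (qcmp (qinv fS) (qmor f)) (qmor (idm X))
| qeq_invr X Y (f : hom X Y) (fS : serre_iso S f) :
    qeq (qcmp (qmor f) (qinv fS)) (qmor (idm Y)).

Definition serre_quotient : category :=
  @Category A qhom qeq (fun X => qmor (idm X)) qcmp
    qeq_refl qeq_sym qeq_trans qeq_cmp qeq_cmpA qeq_idl qeq_idr.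

Definition quotient_functor : functor A serre_quotient :=
  @Functor A serre_quotient id (fun X Y f => qmor f) qeq_mor
    (fun X => qeq_refl (qmor (idm X))) qeq_mor_cmp.

Definition colocalizing := serre S /\ has_left_adjoint quotient_functor.

End SerreQuotient.

(* The category with objects T, each with an underlying vector space, whose
   morphisms are the linear maps satisfying a property. *)

Section ConcreteCategory.
Variables (k : fieldType) (T : Type) (car : T -> lmodType k).
Variable mor : forall X Y, (car X -> car Y) -> Prop.
Hypothesis mor_id : forall X, mor (fun x : car X => x).
Hypothesis mor_cmp : forall X Y Z (g : {linear car Y -> car Z})
  (f : {linear car X -> car Y}), mor g -> mor f -> mor (fun x => g (f x)).

Record cmor (X Y : T) := Cmor {
  cmor_fun :> {linear car X -> car Y};
  cmorP : mor cmor_fun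
}.

Definition cmor_id X : cmor X X := @Cmor X X idfun (mor_id X).

Definition cmor_cmp X Y Z (g : cmor Y Z) (f : cmor X Y) : cmor X Z :=
  @Cmor X Z (cmor_fun g \o cmor_fun f) (mor_cmp (cmorP g) (cmorP f)).

Definition concrete_category : category.
Proof.
apply: (@Category T cmor (fun X Y f g => cmor_fun f =1 cmor_fun g) cmor_id cmor_cmp) => //.
- by move=> X Y f g fg x; rewrite fg.
- by move=> X Y f g h fg gh x; rewrite fg gh.
- by move=> X Y Z g g' f f' gg ff x; rewrite /= ff gg.
Defined.

End ConcreteCategory.

Definition vect (k : fieldType) : category :=
  @concrete_category k (lmodType k) id (fun _ _ _ => True) (fun _ => I)
    (fun _ _ _ _ _ _ _ => I).

Section ModulesComodules.
Variable k : fieldType.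

Record right_action (A : algType k) (M : lmodType k) (act : M -> A -> M) : Prop := {
  ract_bilin : bilinear_map act;
  ract1 : forall m, act m 1 = m;
  ractM : forall m a b, act m (a * b) = act (act m a) b
}.

Record left_action (A : algType k) (M : lmodType k) (act : A -> M -> M) : Prop := {
  lact_bilin : bilinear_map act;
  lact1 : forall m, act 1 m = m;
  lactM : forall m a b, act (a * b) m = act a (act b m)
}.

Record right_coaction (C : coalgType k) (M : lmodType k) (rho : M -> M \ox C) : Prop := {
  rcoact_linear : linear rho;
  rcoactA : forall m, tassoc (tmap rho idfun (rho m)) = tmap idfun comul (rho m);
  rcoact1 : forall m, tlift (fun n c => counit c *: n) (rho m) = m
}.

Record left_coaction (C : coalgType k) (M : lmodType k) (lam : M -> C \ox M) : Prop := {
  lcoact_linear : linear lam;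
  lcoactA : forall m, tassoc (tmap comul idfun (lam m)) = tmap idfun lam (lam m);
  lcoact1 : forall m, tlift (fun c n => counit c *: n) (lam m) = m
}.

Record rmod (A : algType k) := Rmod {
  rmod_car :> lmodType k;
  ract : rmod_car -> A -> rmod_car;
  rmodP : right_action ract
}.

Record lmod (A : algType k) := Lmod {
  lmod_car :> lmodType k;
  lact : A -> lmod_car -> lmod_car;
  lmodP : left_action lact
}.

Record rcomod (C : coalgType k) := Rcomod {
  rcomod_car :> lmodType k;
  rcoact : rcomod_car -> rcomod_car \ox C;
  rcomodP : right_coaction rcoact
}.

Record lcomod (C : coalgType k) := Lcomod {
  lcomod_car :> lmodType k;
  lcoact : lcomod_car -> C \ox lcomod_car;
  lcomodP : left_coaction lcoact
}.

Definition ract_mor (A : algType k) (M N : lmodType k) (actM : M -> A -> M)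
    (actN : N -> A -> N) (f : M -> N) :=
  forall m a, f (actM m a) = actN (f m) a.

Definition lact_mor (A : algType k) (M N : lmodType k) (actM : A -> M -> M)
    (actN : A -> N -> N) (f : M -> N) :=
  forall a m, f (actM a m) = actN a (f m).

Definition rcoact_mor (C : coalgType k) (M N : lmodType k) (rhoM : M -> M \ox C)
    (rhoN : N -> N \ox C) (f : M -> N) :=
  forall m, rhoN (f m) = tmap f idfun (rhoM m).

Definition lcoact_mor (C : coalgType k) (M N : lmodType k) (lamM : M -> C \ox M)
    (lamN : N -> C \ox N) (f : M -> N) :=
  forall m, lamN (f m) = tmap idfun f (lamM m).

Lemma rcoact_mor_id (C : coalgType k) (M : lmodType k) (rho : M -> M \ox C) :
  rcoact_mor rho rho (fun x => x).
Proof. by move=> m; rewrite -[LHS]tmap_id. Qed.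

Lemma lcoact_mor_id (C : coalgType k) (M : lmodType k) (lam : M -> C \ox M) :
  lcoact_mor lam lam (fun x => x).
Proof. by move=> m; rewrite -[LHS]tmap_id. Qed.

Lemma rcoact_mor_cmp (C : coalgType k) (M N P : lmodType k) (rhoM : M -> M \ox C)
    (rhoN : N -> N \ox C) (rhoP : P -> P \ox C)
    (g : {linear N -> P}) (f : {linear M -> N}) :
  rcoact_mor rhoN rhoP g -> rcoact_mor rhoM rhoN f ->
  rcoact_mor rhoM rhoP (fun x => g (f x)).
Proof. by move=> hg hf m; rewrite hg hf tmap_comp. Qed.

Lemma lcoact_mor_cmp (C : coalgType k) (M N P : lmodType k) (lamM : M -> C \ox M)
    (lamN : N -> C \ox N) (lamP : P -> C \ox P)
    (g : {linear N -> P}) (f : {linear M -> N}) :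
  lcoact_mor lamN lamP g -> lcoact_mor lamM lamN f ->
  lcoact_mor lamM lamP (fun x => g (f x)).
Proof. by move=> hg hf m; rewrite hg hf tmap_comp. Qed.

Definition rmod_cat (A : algType k) : category.
Proof.
apply: (@concrete_category k (rmod A) (@rmod_car A)
  (fun M N f => ract_mor (@ract A M) (@ract A N) f)) => //.
by move=> M N P g f hg hf m a; rewrite hf hg.
Defined.

Definition lmod_cat (A : algType k) : category.
Proof.
apply: (@concrete_category k (lmod A) (@lmod_car A)
  (fun M N f => lact_mor (@lact A M) (@lact A N) f)) => //.
by move=> M N P g f hg hf a m; rewrite hf hg.
Defined.

Definition rcomod_cat (C : coalgType k) : category :=
  @concrete_category k (rcomod C) (@rcomod_car C)
    (fun M N f => rcoact_mor (@rcoact C M) (@rcoact C N) f)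
    (fun M => rcoact_mor_id (@rcoact C M))
    (fun M N P g f => @rcoact_mor_cmp C M N P _ _ _ g f).

Definition lcomod_cat (C : coalgType k) : category :=
  @concrete_category k (lcomod C) (@lcomod_car C)
    (fun M N f => lcoact_mor (@lcoact C M) (@lcoact C N) f)
    (fun M => lcoact_mor_id (@lcoact C M))
    (fun M N P g f => @lcoact_mor_cmp C M N P _ _ _ g f).

End ModulesComodules.

Section Cotensor.
Variables (k : fieldType) (C : coalgType k).

Definition cotensor_pred (M : rcomod C) (N : lcomod C) (t : M \ox N) : bool :=
  tassoc (tmap (@rcoact k C M) idfun t) == tmap idfun (@lcoact k C N) t.

HB.instance Definition _ (M : rcomod C) :=
  GRing.isLinear.Build k M (tensor M C) *:%R (@rcoact k C M) (rcoact_linear (rcomodP M)).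
HB.instance Definition _ (N : lcomod C) :=
  GRing.isLinear.Build k N (tensor C N) *:%R (@lcoact k C N) (lcoact_linear (lcomodP N)).

Section Obj.
Variables (M : rcomod C) (N : lcomod C).

Lemma cotensor_submod : GRing.subsemimod_closed (@cotensor_pred M N).
Proof.
split; first split.
- by rewrite /in_mem /= /cotensor_pred !linear0.
- by move=> x y /eqP xP /eqP yP; apply/eqP; rewrite !linearD /= xP yP.
- by move=> a x /eqP xP; apply/eqP; rewrite !linearZ /= xP.
Qed.

HB.instance Definition _ :=
  GRing.isSubmodClosed.Build k (tensor M N) (@cotensor_pred M N) cotensor_submod.

Record cotensor_type := Cotensor {
  cotensor_val :> M \ox N;
  cotensorP : @cotensor_pred M N cotensor_val
}.

HB.instance Definition _ := [isSub for cotensor_val].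
HB.instance Definition _ := [Choice of cotensor_type by <:].
HB.instance Definition _ := [SubChoice_isSubLmodule of cotensor_type by <:].

Definition cotensor : lmodType k := cotensor_type.

End Obj.

Lemma cotensor_map_subproof (M M' : rcomod_cat C) (N N' : lcomod_cat C)
    (f : hom M M') (g : hom N N') (t : cotensor M N) :
  cotensor_pred (tmap f g t : rcomod_car M' \ox lcomod_car N').
Proof.
apply/eqP; rewrite tmap_comp.
rewrite [X in tassoc X](eq_tmap (f' := tmap f idfun \o @rcoact k C M) (cmorP f)
  (g' := g \o idfun)) //.
rewrite -[X in tassoc X](tmap_comp _ idfun (tmap f idfun) g) tassoc_nat.
rewrite (eqP (cotensorP t)) !tmap_comp.
by apply: eq_tmap => // x /=; rewrite (cmorP g).
Qed.

Definition cotensor_map (M M' : rcomod_cat C) (N N' : lcomod_cat C)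
  (f : hom M M') (g : hom N N') (t : cotensor M N) : cotensor M' N' :=
  Cotensor (cotensor_map_subproof f g t).

Lemma cotensor_map_linear (M M' : rcomod_cat C) (N N' : lcomod_cat C)
    (f : hom M M') (g : hom N N') : linear (cotensor_map f g).
Proof.
by move=> a s t; apply: val_inj; rewrite linearP /= -linearP.
Qed.

HB.instance Definition _ (M M' : rcomod_cat C) (N N' : lcomod_cat C)
    (f : hom M M') (g : hom N N') :=
  GRing.isLinear.Build k (cotensor M N) (cotensor M' N') *:%R (cotensor_map f g)
    (cotensor_map_linear f g).

(* ? \Box_C N *)
Definition cotensor_functor_l (N : lcomod_cat C) : functor (rcomod_cat C) (vect k).
Proof.
apply: (@Functor (rcomod_cat C) (vect k) (fun M => cotensor M N)
  (fun M M' f => @Cmor k (lmodType k) id (fun _ _ _ => True) _ _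
                    (cotensor_map f (idm N)) I)).
- by move=> M M' f g fg t; apply: val_inj; apply: eq_tmap.
- by move=> M t; apply: val_inj; rewrite /= -[RHS]tmap_id.
- move=> M M' M'' g f t; apply: val_inj; rewrite /= tmap_comp.
  exact: eq_tmap.
Defined.

(* M \Box_C ? *)
Definition cotensor_functor_r (M : rcomod_cat C) : functor (lcomod_cat C) (vect k).
Proof.
apply: (@Functor (lcomod_cat C) (vect k) (fun N => cotensor M N)
  (fun N N' g => @Cmor k (lmodType k) id (fun _ _ _ => True) _ _
                    (cotensor_map (idm M) g) I)).
- by move=> N N' f g fg t; apply: val_inj; apply: eq_tmap.
- by move=> N t; apply: val_inj; rewrite /= -[RHS]tmap_id.
- move=> N N' N'' g f t; apply: val_inj; rewrite /= tmap_comp.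
  exact: eq_tmap.
Defined.

Definition left_coflat (N : lcomod_cat C) := exact_functor (cotensor_functor_l N).
Definition right_coflat (M : rcomod_cat C) := exact_functor (cotensor_functor_r M).

End Cotensor.

Section HopfModules.
Variables (k : fieldType) (H : hopfAlgType k) (I : left_ideal_coideal H).
Local Notation C := (factor I).
Local Notation A := (coinv I).
Local Notation pi := (@factor_pi k H I).

Lemma H_left_coaction : left_coaction (tmap pi (@idfun H) \o comul : H -> C \ox H).
Proof.
split; first by move=> a x y; rewrite /= !linearP.
  move=> h /=; rewrite tmap_comp.
  rewrite [X in tassoc X](eq_tmap (f' := tmap pi pi \o comul) (@factor_comulE k H I)
    (g' := idfun \o idfun)) //.
  rewrite -[X in tassoc X](tmap_comp comul idfun (tmap pi pi) idfun) tassoc_nat.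
  by rewrite comulA !tmap_comp; apply: eq_tmap.
move=> h; rewrite /= tlift_tmap; last exact: counit_bilinl.
rewrite -[RHS]counitl; apply: eq_bigr => p _ /=.
by rewrite -[in RHS](factor_counitE I).
Qed.

Lemma H_right_coaction : right_coaction (tmap (@idfun H) pi \o comul : H -> H \ox C).
Proof.
split; first by move=> a x y; rewrite /= !linearP.
  move=> h /=; rewrite tmap_comp.
  rewrite -[X in tassoc X](tmap_comp comul idfun (tmap idfun pi) pi) tassoc_nat.
  rewrite comulA !tmap_comp; apply: eq_tmap => // x /=.
  exact: (esym (@factor_comulE k H I x)).
move=> h; rewrite /= tlift_tmap; last exact: counit_bilinr.
rewrite -[RHS]counitr; apply: eq_bigr => p _ /=.
by rewrite -[in RHS](factor_counitE I).
Qed.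

Definition H_lcomod : lcomod_cat C := Lcomod H_left_coaction.
Definition H_rcomod : rcomod_cat C := Rcomod H_right_coaction.

(* Objects of M_A^H. In the compatibility condition t is Delta(a), viewed in
   A (x) H. *)
Record rmod_rcomod := RmodRcomod {
  rr_car :> lmodType k;
  rr_act : rr_car -> A -> rr_car;
  rr_coact : rr_car -> rr_car \ox H;
  rr_actP : right_action rr_act;
  rr_coactP : right_coaction rr_coact;
  rr_compat : forall m (a : A), exists2 t : A \ox H,
    tmap (@coinv_val k H I) idfun t = comul (a : H) &
    rr_coact (rr_act m a) = tmap2 rr_act *%R (rr_coact m) t
}.

(* Objects of {}_A M^H. *)
Record lmod_rcomod := LmodRcomod {
  lr_car :> lmodType k;
  lr_act : A -> lr_car -> lr_car;
  lr_coact : lr_car -> lr_car \ox H;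
  lr_actP : left_action lr_act;
  lr_coactP : right_coaction lr_coact;
  lr_compat : forall (a : A) m, exists2 t : A \ox H,
    tmap (@coinv_val k H I) idfun t = comul (a : H) &
    lr_coact (lr_act a m) = tmap2 lr_act *%R t (lr_coact m)
}.

(* Objects of {}_H^C M. *)
Record Hmod_lcomod := HmodLcomod {
  Hl_car :> lmodType k;
  Hl_act : H -> Hl_car -> Hl_car;
  Hl_coact : Hl_car -> C \ox Hl_car;
  Hl_actP : left_action Hl_act;
  Hl_coactP : left_coaction Hl_coact;
  Hl_compat : forall h m,
    Hl_coact (Hl_act h m) = tmap2 (@factor_act k H I) Hl_act (comul h) (Hl_coact m)
}.

(* Objects of {}_H M^C. *)
Record Hmod_rcomod := HmodRcomod {
  Hr_car :> lmodType k;
  Hr_act : H -> Hr_car -> Hr_car;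
  Hr_coact : Hr_car -> Hr_car \ox C;
  Hr_actP : left_action Hr_act;
  Hr_coactP : right_coaction Hr_coact;
  Hr_compat : forall h m,
    Hr_coact (Hr_act h m) = tmap2 Hr_act (@factor_act k H I) (comul h) (Hr_coact m)
}.

Definition rmod_rcomod_cat : category.
Proof.
apply: (@concrete_category k rmod_rcomod rr_car (fun M N f =>
  ract_mor (@rr_act M) (@rr_act N) f /\ rcoact_mor (@rr_coact M) (@rr_coact N) f)).
- by move=> M; split=> //; apply: rcoact_mor_id.
- move=> M N P g f [g1 g2] [f1 f2]; split; last exact: rcoact_mor_cmp g2 f2.
  by move=> m a; rewrite f1 g1.
Defined.

Definition lmod_rcomod_cat : category.
Proof.
apply: (@concrete_category k lmod_rcomod lr_car (fun M N f =>
  lact_mor (@lr_act M) (@lr_act N) f /\ rcoact_mor (@lr_coact M) (@lr_coact N) f)).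
- by move=> M; split=> //; apply: rcoact_mor_id.
- move=> M N P g f [g1 g2] [f1 f2]; split; last exact: rcoact_mor_cmp g2 f2.
  by move=> a m; rewrite f1 g1.
Defined.

Definition Hmod_lcomod_cat : category.
Proof.
apply: (@concrete_category k Hmod_lcomod Hl_car (fun M N f =>
  lact_mor (@Hl_act M) (@Hl_act N) f /\ lcoact_mor (@Hl_coact M) (@Hl_coact N) f)).
- by move=> M; split=> //; apply: lcoact_mor_id.
- move=> M N P g f [g1 g2] [f1 f2]; split; last exact: lcoact_mor_cmp g2 f2.
  by move=> a m; rewrite f1 g1.
Defined.

Definition Hmod_rcomod_cat : category.
Proof.
apply: (@concrete_category k Hmod_rcomod Hr_car (fun M N f =>
  lact_mor (@Hr_act M) (@Hr_act N) f /\ rcoact_mor (@Hr_coact M) (@Hr_coact N) f)).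
- by move=> M; split=> //; apply: rcoact_mor_id.
- move=> M N P g f [g1 g2] [f1 f2]; split; last exact: rcoact_mor_cmp g2 f2.
  by move=> a m; rewrite f1 g1.
Defined.

Definition proper_stable_subcoalg (R : {pred C}) :=
  [/\ submod_closed R,
      forall c, c \in R -> tens_in R R (comul c),
      forall h c, c \in R -> factor_act h c \in R
    & exists c : C, c \notin R].

Definition rcomod_T (V : rcomod_cat C) : Prop :=
  forall v : rcomod_car V, exists2 R : {pred C}, proper_stable_subcoalg R &
    tens_in predT R (rcoact v).

Definition lcomod_T (V : lcomod_cat C) : Prop :=
  forall v : lcomod_car V, exists2 R : {pred C}, proper_stable_subcoalg R &
    tens_in R predT (lcoact v).

Definition Hmod_rcomod_T (M : Hmod_rcomod_cat) : Prop :=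
  rcomod_T (Rcomod (@Hr_coactP M)).

Definition Hmod_lcomod_T (M : Hmod_lcomod_cat) : Prop :=
  lcomod_T (Lcomod (@Hl_coactP M)).

End HopfModules.

(* Main.v *)
(* Both equivalences of (ii) come from an adjoint pair whose right adjoint inverts
   exactly the morphisms with torsion kernel and cokernel, so that it identifies
   the category of fractions with its target: for Hopf modules M |-> M^{co C},
   with left adjoint W |-> H (x)_A W (A acting on H through the inverse of the
   antipode), and for comodules V |-> V []_C H, with left adjoint
   M |-> M / M A^+. Coflatness makes both right adjoints exact; that the units are
   isomorphisms is then checked on presentations H (x) A (x) W -> H (x) W and
   M (x) A -> M, where coinvariants and cotensor products are computed explicitly.
   A comodule V is torsion if and only if V []_C H = 0: under coflatness the
   coefficients of the comodules with V []_C H = 0 form the largest proper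
   H-stable subcoalgebra of C. Parts (iii) and (iv) are (i) and (ii) for the
   co-opposite Hopf algebra, whose algebra of coinvariants is anti-isomorphic to A
   by the antipode. *)

From HB Require Import structures.
From Corelib Require Import Setoid Morphisms.
From mathcomp Require Import all_boot all_algebra.
From mathcomp Require Import boolp classical_sets.
Require Import Defs.

Set Implicit Arguments.
Unset Strict Implicit.
Unset Printing Implicit Defensive.

Import GRing.Theory.
Local Open Scope ring_scope.

(** * Linear algebra over a field *)

(** Coinvariants and cotensor products are linked by a twist with the inverse [S'] of the antipode.
    For a Hopf module M, the map m (x) h |-> S' h m sends M []_C H into M^{co C} and m (x) 1 back to
    m, so coinvariants inherit the lifting property that coflatness gives to cotensor products.
    Moreover m (x) h |-> S' h1 m (x) h2 is bijective and sends M []_C H into M^{co C} (x) H, so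
    M^{co C} and M []_C H vanish together. Comodules V are reduced to Hopf modules through H (x) V.
    Injectivity of the units is the delicate point. A relation that kills w is lifted to a
    coinvariant (or cotensor) relation on the presentation, where it reads w (x) 1 = sum of (v b (x)
    a - v (x) b a) over A; applying the action gives w = 0. Morphisms of the quotient category are
    formal words, without common denominators. Functors out of it and naturality are therefore
    checked on generators, and the equivalences follow from adjunctions whose unit is invertible and
    whose counit has torsion kernel and cokernel. *)

Definition linmap (k : fieldType) (V W : lmodType k) (f : V -> W) (lf : linear f) :
    {linear V -> W} :=
  HB.pack f (GRing.isLinear.Build k V W *:%R f lf).

Section LinearMaps.
Variables (k : fieldType) (V W : lmodType k).
Variable f : {linear V -> W}.

Definition kernel_pred (x : V) : bool := f x == 0.

Lemma kernel_submod : GRing.subsemimod_closed kernel_pred.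
Proof.
split; first split.
- by rewrite /in_mem /= /kernel_pred linear0.
- by move=> x y /eqP xP /eqP yP; apply/eqP; rewrite linearD xP yP addr0.
- by move=> a x /eqP xP; apply/eqP; rewrite linearZ /= xP scaler0.
Qed.

HB.instance Definition _ :=
  GRing.isSubmodClosed.Build k V kernel_pred kernel_submod.

Record kernel_type := Kernel { kernel_val :> V; kernelP : kernel_pred kernel_val }.

HB.instance Definition _ := [isSub for kernel_val].
HB.instance Definition _ := [Choice of kernel_type by <:].
HB.instance Definition _ := [SubChoice_isSubLmodule of kernel_type by <:].

Definition kernel : lmodType k := kernel_type.

Lemma kernel_val_linear : linear (kernel_val : kernel -> V).
Proof. by move=> a x y; rewrite -[kernel_val _]/(val _) linearP. Qed.

Definition kernel_incl : {linear kernel -> V} := linmap kernel_val_linear.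

Lemma kernel_incl_inj : injective kernel_incl.
Proof. exact: val_inj. Qed.

Lemma kernel_inclP x : f (kernel_incl x) = 0.
Proof. by case: x => x /= /eqP. Qed.

Lemma kernel_incl_onto x : f x = 0 -> exists y, kernel_incl y = x.
Proof. by move/eqP => fx; exists (Kernel fx). Qed.

Section Lift.
Variables (U : lmodType k) (g : {linear U -> V}) (fg : forall x, f (g x) = 0).

Definition kernel_lift_fun (x : U) : kernel := Kernel (introT eqP (fg x)).

Lemma kernel_lift_linear : linear kernel_lift_fun.
Proof.
move=> a x y; apply: val_inj; rewrite linearP /=.
exact: (linearP g a x y).
Qed.

Definition kernel_lift : {linear U -> kernel} := linmap kernel_lift_linear.

End Lift.

End LinearMaps.

(** * Complements, retractions and sections of vector spaces *)

Section Split.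
Variable k : fieldType.
Implicit Types V W : lmodType k.

Definition subspace V (U : V -> Prop) :=
  U 0 /\ forall a x y, U x -> U y -> U (a *: x + y).

Lemma subspaceZ V (U : V -> Prop) : subspace U -> forall a x, U x -> U (a *: x).
Proof. by move=> [U0 UD] a x Ux; rewrite -[a *: x]addr0; apply: UD. Qed.

Lemma subspaceB V (U : V -> Prop) : subspace U -> forall x y, U x -> U y -> U (x - y).
Proof. by move=> [U0 UD] x y Ux Uy; rewrite addrC -scaleN1r; apply: UD. Qed.

Local Open Scope classical_set_scope.

Lemma subspace_complement V (U : V -> Prop) : subspace U ->
  exists W : V -> Prop, [/\ subspace W, forall x, U x -> W x -> x = 0
    & forall x, exists2 u, U u & W (x - u)].
Proof.
move=> US.
(* [P] does not ask for 0 to belong to [W], so that the empty chain has its union in [P]. Maximality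
   restores 0 afterwards. *)
pose P : set (set V) := [set W | (forall a x y, W x -> W y -> W (a *: x + y)) /\
                  (forall x, U x -> W x -> x = 0)].
have [F FP Ftot|W [[WD WU] Wmax]] := @Zorn_bigcup V P.
  split=> [a x y [X FX Xx] [Y FY Yy]|x Ux [X FX Xx]]; last exact: (FP X FX).2 Xx.
  have [XY|YX] := Ftot X Y FX FY.
    by exists Y => //; apply: (FP Y FY).1 => //; apply: XY.
  by exists X => //; apply: (FP X FX).1 => //; apply: YX.
have W0 : W 0.
  apply: contrapT => NW0; apply: (Wmax (W `|` [set 0])).
    split=> [x Wx|E]; first by left.
    by apply: NW0; apply: E; right.
  split=> [a x y [Wx|->] [Wy|->]|x Ux [/(WU _ Ux) //|->//]].
  - by left; apply: WD.
  - rewrite addr0; left; suff -> : a *: x = (a - 1) *: x + x by apply: WD.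
    by rewrite scalerBl scale1r subrK.
  - by rewrite scaler0 add0r; left.
  - by rewrite scaler0 addr0; right.
have WS : subspace W by split.
exists W; split=> // v; apply: contrapT => Nv.
(* If [v] has no decomposition, the line through [v] is independent of [U + W], and adjoining it to
   [W] contradicts maximality. *)
have NU a x : W x -> U (x + a *: v) -> a = 0.
  move=> Wx Ux; apply/eqP; apply: contrapT => /negP a0; apply: Nv.
  exists (a^-1 *: (x + a *: v)); first exact: subspaceZ US _ _ Ux.
  rewrite scalerDr scalerA mulVf // scale1r opprD addrC subrK -scalerN.
  by apply: (subspaceZ WS); rewrite -scaleN1r; apply: (subspaceZ WS).
pose W' : set V := [set y | exists x a, W x /\ y = x + a *: v].
apply: (Wmax W').
  split=> [x Wx|E]; first by exists x, 0; rewrite scale0r addr0.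
  apply: Nv; exists 0; first exact: US.1.
  by rewrite subr0; apply: E; exists 0, 1; rewrite scale1r add0r.
split=> [a ? ? [x [b [Wx ->]]] [y [c [Wy ->]]]|z Uy [x [a [Wx Ey]]]].
  exists (a *: x + y), (a * b + c); split; first exact: WD.
  by rewrite scalerDr scalerDl scalerA addrACA.
move: Uy; rewrite Ey => Uy; have a0 := NU _ _ Wx Uy.
by move: Uy; rewrite a0 scale0r addr0 => /WU; apply.
Qed.

Lemma subspace_projection V (U : V -> Prop) : subspace U ->
  exists r : {linear V -> V}, (forall x, U (r x)) /\ (forall x, U x -> r x = x).
Proof.
move=> US; have [W [WS WU WV]] := subspace_complement US.
have [x|r rP] := @choice _ _ (fun x y => U y /\ W (x - y)).
  by have [u] := WV x; exists u.
have runiq x u : U u -> W (x - u) -> r x = u.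
  move=> Uu Wu; apply/eqP; rewrite -subr_eq0; apply/eqP.
  apply: WU; first exact: (subspaceB US) (rP x).1 Uu.
  have -> : r x - u = (x - u) - (x - r x) by rewrite opprB [RHS]addrC addrA subrK.
  exact: (subspaceB WS) Wu (rP x).2.
have lr : linear r.
  move=> a x y; apply: runiq.
    by apply: US.2; [apply: (rP x).1 | apply: (rP y).1].
  have := WS.2 a _ _ (rP x).2 (rP y).2.
  by rewrite scalerBr addrACA opprD.
exists (linmap lr); split=> [x|x Ux] /=; first exact: (rP x).1.
by apply: runiq => //; rewrite subrr; apply: WS.1.
Qed.

(** [U] and a complement are both turned into vector spaces with explicit inclusions and
    projections. Exactness statements about tensor products then reduce to applying [tmap] to these
    four maps. *)
Record splitting V (U : V -> Prop) := Splitting {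
  spl_sub : lmodType k;
  spl_quo : lmodType k;
  spl_i : {linear spl_sub -> V};
  spl_r : {linear V -> spl_sub};
  spl_p : {linear V -> spl_quo};
  spl_s : {linear spl_quo -> V};
  spl_ri : cancel spl_i spl_r;
  spl_ps : cancel spl_s spl_p;
  spl_sum : forall x, spl_i (spl_r x) + spl_s (spl_p x) = x;
  spl_iU : forall x, U (spl_i x);
  spl_pU : forall x, spl_p x = 0 <-> U x
}.

Arguments spl_ri {V U} s.
Arguments spl_ps {V U} s.
Arguments spl_sum {V U} s x.
Arguments spl_iU {V U} s x.
Arguments spl_pU {V U} s x.

Lemma splitting_exists V (U : V -> Prop) : subspace U -> inhabited (splitting U).
Proof.
move=> US; have [r [rU rid]] := subspace_projection US.
have le : linear (fun x => x - r x).
  by move=> a x y; rewrite linearP scalerBr opprD addrACA.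
pose e := linmap le.
have er x : e (r x) = 0 by rewrite /= (rid _ (rU x)) subrr.
have re x : r (e x) = 0 by rewrite /= linearB /= (rid _ (rU x)) subrr.
pose K := kernel e; pose Q := kernel r.
apply: inhabits; apply: (@Splitting V U K Q (kernel_incl e) (kernel_lift er)
  (kernel_lift re) (kernel_incl r)).
- move=> x; apply: val_inj => /=; apply: rid; have /= := kernel_inclP x.
  by move/eqP; rewrite subr_eq0 => /eqP ->.
- by move=> x; apply: val_inj; have /= -> := kernel_inclP x; rewrite subr0.
- by move=> x /=; rewrite addrC subrK.
- by move=> x; have /= /eqP := kernel_inclP x; rewrite subr_eq0 => /eqP ->.
- move=> x; split=> [/(congr1 (@kernel_val _ _ _ _)) /eqP|Ux].
    by rewrite /= subr_eq0 => /eqP ->.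
  by apply: val_inj; rewrite /= rid // subrr.
Qed.

Lemma spl_onto V (U : V -> Prop) (S : splitting U) x : U x -> spl_i S (spl_r S x) = x.
Proof. by move/(spl_pU S) => px; rewrite -[RHS](spl_sum S) px linear0 addr0. Qed.

Lemma subspace_ker V W (f : {linear V -> W}) : subspace (fun x => f x = 0).
Proof.
by split=> [|a x y fx fy]; [exact: linear0 | rewrite linearP fx fy scaler0 addr0].
Qed.

Lemma subspace_im V W (f : {linear V -> W}) : subspace (fun y => exists x, f x = y).
Proof.
split=> [|a _ _ [x <-] [y <-]]; first by exists 0; exact: linear0.
by exists (a *: x + y); rewrite linearP.
Qed.

Lemma injective_retraction V W (f : {linear V -> W}) : injective f ->
  exists g : {linear W -> V}, cancel f g.
Proof.
move=> finj; have [S] := splitting_exists (subspace_im f).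
have [y|g gP] := @choice _ _ (fun y x => f x = spl_i S (spl_r S y)).
  exact: (spl_iU S (spl_r S y)).
have lg : linear g.
  by move=> a x y; apply: finj; rewrite linearP !gP !linearP.
exists (linmap lg) => x; apply: finj; rewrite gP spl_onto //.
by exists x.
Qed.

Lemma surjective_section V W (f : {linear V -> W}) : (forall y, exists x, f x = y) ->
  exists g : {linear W -> V}, cancel g f.
Proof.
move=> fsurj; have [S] := splitting_exists (subspace_ker f).
have fs x : f (spl_s S (spl_p S x)) = f x.
  rewrite -{2}(spl_sum S x) linearD.
  by have -> := spl_iU S (spl_r S x); rewrite add0r.
have [g gP] := @choice _ _ (fun y x => f x = y) fsurj.
(* [g] is an arbitrary choice of preimages. Its component in a complement of the kernel depends only
   on [y], hence linearly. *)
have lg : linear (fun y => spl_s S (spl_p S (g y))).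
  move=> a x y; rewrite -!linearP; congr (spl_s _ _); apply/eqP; rewrite -subr_eq0 -linearB; apply/eqP.
  by apply/spl_pU; rewrite linearB linearP !gP subrr.
by exists (linmap lg) => y; rewrite /= fs.
Qed.

(** The class of [v] modulo [U] spans a copy of k; a linear retraction onto that line, composed with
    the projection, is the functional. *)
Lemma functional_vanishing V (U : V -> Prop) v : subspace U -> ~ U v ->
  exists2 f : {scalar V}, f v = 1 & forall u, U u -> f u = 0.
Proof.
move=> US Uv; have [S] := splitting_exists US.
have le : linear (fun a : k^o => a *: spl_p S v).
  by move=> a x y; rewrite scalerDl scalerA.
have einj : injective (linmap le).
  move=> a b /= /eqP; rewrite -subr_eq0 -scalerBl scaler_eq0 subr_eq0.
  by case/orP=> /eqP // /spl_pU.
have [g gP] := injective_retraction einj.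
have lh : scalar (g \o spl_p S) by move=> a x y; rewrite /= !linearP.
exists (HB.pack (g \o spl_p S : V -> k) (GRing.isLinear.Build k V k *%R _ lh)
  : {scalar V}) => [|u Uu] /=.
  by rewrite -{1}[spl_p S v]scale1r; apply: (gP 1).
by move/(spl_pU S): Uu => ->; rewrite linear0.
Qed.

End Split.

Arguments spl_ri {k V U} s.
Arguments spl_ps {k V U} s.
Arguments spl_sum {k V U} s x.
Arguments spl_iU {k V U} s x.
Arguments spl_pU {k V U} s x.

(** * Exactness of the tensor product over a field *)

Section TensorExactness.
Variable k : fieldType.
Implicit Types U V W K : lmodType k.

Lemma tmapD V W V' W' (f : {linear V -> V'}) (g : {linear W -> W'}) s t :
  tmap f g (s + t) = tmap f g s + tmap f g t.
Proof. exact: linearD. Qed.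

Lemma tmapB V W V' W' (f : {linear V -> V'}) (g : {linear W -> W'}) s t :
  tmap f g (s - t) = tmap f g s - tmap f g t.
Proof. exact: linearB. Qed.

Lemma tmap0 V W V' W' (f : {linear V -> V'}) (g : {linear W -> W'}) :
  tmap f g 0 = 0.
Proof. exact: linear0. Qed.

Lemma tmap_cancel V W V' W' (f : {linear V -> V'}) (g : {linear W -> W'})
    (f' : {linear V' -> V}) (g' : {linear W' -> W}) :
  cancel f f' -> cancel g g' -> cancel (tmap f g) (tmap f' g').
Proof.
move=> ff gg t; rewrite tmap_comp -[RHS]tmap_id.
by apply: eq_tmap => x /=; rewrite ?ff ?gg.
Qed.

Lemma tmap_injective V W V' W' (f : {linear V -> V'}) (g : {linear W -> W'}) :
  injective f -> injective g -> injective (tmap f g).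
Proof.
move=> /injective_retraction [f' ff'] /injective_retraction [g' gg'].
exact: can_inj (tmap_cancel ff' gg').
Qed.

Lemma tmap_surjective V W V' W' (f : {linear V -> V'}) (g : {linear W -> W'}) :
  (forall y, exists x, f x = y) -> (forall y, exists x, g x = y) ->
  forall y, exists x, tmap f g x = y.
Proof.
move=> /surjective_section [f' ff'] /surjective_section [g' gg'] y.
by exists (tmap f' g' y); apply: tmap_cancel.
Qed.

Lemma tmap0l V W V' W' (g : {linear W -> W'}) (f : {linear V -> V'}) t :
  (forall x, f x = 0) -> tmap f g t = 0.
Proof.
move=> f0; elim/tens_ind: t => [|v w t IH]; first exact: linear0.
by rewrite linearD /= tmapE f0 tens0l IH addr0.
Qed.

(** On a complement of its kernel [f] is injective, and tensoring keeps it so. An element killed by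
    f (x) id therefore has no component along the complement, and the remaining component lifts
    through [i]. *)
Lemma tmap_kerl V V' W K (f : {linear V -> V'}) (i : {linear K -> V}) :
  (forall x, f x = 0 -> exists y, i y = x) ->
  forall t : V \ox W, tmap f idfun t = 0 -> exists u, tmap i idfun u = t.
Proof.
move=> fi; have [S] := splitting_exists (subspace_ker f).
have fs_inj : injective (f \o spl_s S : {linear _ -> _}).
  move=> x y /= /eqP; rewrite -subr_eq0 -linearB -linearB => /eqP /(spl_pU S).
  by rewrite spl_ps => /eqP; rewrite subr_eq0 => /eqP.
have [y|r' r'P] := @choice _ _ (fun y x => i x = spl_i S (spl_r S y)).
  exact: (fi _ (spl_iU S (spl_r S y))).
(* [r'] merely chooses preimages under [i]; projecting them to a complement of the kernel of [i]
   makes the choice linear. *)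
have [i' i'P] : exists g : {linear spl_sub S -> K}, forall x, i (g x) = spl_i S x.
  have [T] := splitting_exists (subspace_ker i).
  have lg : linear (fun x => spl_s T (spl_p T (r' (spl_i S x)))).
    move=> a x y; rewrite -!linearP; congr (spl_s _ _); apply/eqP; rewrite -subr_eq0 -linearB; apply/eqP.
    by apply/spl_pU; rewrite linearB [X in _ - X]linearP !r'P !spl_ri linearP subrr.
  exists (linmap lg) => x /=.
  have := congr1 i (spl_sum T (r' (spl_i S x))); rewrite linearD r'P spl_ri.
  by have -> := spl_iU T (spl_r T (r' (spl_i S x))); rewrite add0r.
move=> t ft0.
have pt0 : tmap (spl_p S) idfun t = 0.
  apply: (tmap_injective (g := idfun) fs_inj (@inj_id W)); rewrite linear0 tmap_comp -ft0.
  apply: eq_tmap => // x /=; rewrite -{2}(spl_sum S x) linearD.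
  by have -> := spl_iU S (spl_r S x); rewrite add0r.
exists (tmap i' idfun (tmap (spl_r S) idfun t)).
have {2}<- : tmap (spl_i S) idfun (tmap (spl_r S) idfun t) +
    tmap (spl_s S) idfun (tmap (spl_p S) idfun t) = t.
  elim/tens_ind: t {ft0 pt0} => [|v w t IH]; first by rewrite !linear0 addr0.
  by rewrite !linearD /= addrACA IH !tmapE /= -tensDl spl_sum.
rewrite pt0 linear0 addr0 tmap_comp.
by apply: eq_tmap => x /=; rewrite ?i'P.
Qed.

Lemma tens_eq0 V W (v : V) (w : W) : v \ox w = 0 -> w <> 0 -> v = 0.
Proof.
move=> vw0 w0; have [|//|f fw _] := @functional_vanishing k W (fun x => x = 0) w.
  by split=> // a x y -> ->; rewrite scaler0 addr0.
by have := congr1 (tlift (fun v w => f w *: v)) vw0;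
  rewrite (tliftE (counit_bilinr f V)) fw scale1r (tlift0 (counit_bilinr f V)).
Qed.

(** Induction on the number of elementary tensors. If the first vector is a combination of the
    others, its partner [w] is distributed over them and one term disappears. Otherwise a functional
    equal to 1 on it and 0 on the others shows [w = 0]. *)
Lemma tens_functional_sep V W (t : V \ox W) :
  (forall f : {scalar V}, tlift (fun v w => f v *: w) t = 0) -> t = 0.
Proof.
rewrite (tens_sumE t); move: (repr t) => s {t}.
have [n] := ubnP (size s); elim: n s => // n IH [_ _|[v w] s /= sn fs].
  by rewrite big_nil.
pose span (x : V) := exists a : 'I_(size s) -> k, x = \sum_i a i *: (nth (0, 0) s i).1.
have span_sub : subspace span.
  split=> [|a x y [b ->] [c ->]].
    by exists (fun => 0); rewrite big1 // => i _; rewrite scale0r.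
  exists (fun i => a * b i + c i); rewrite scaler_sumr -big_split /=.
  by apply: eq_bigr => i _; rewrite scalerDl scalerA.
have lift_sum (f : {scalar V}) (r : seq (V * W)) : tlift (fun v w => f v *: w)
    (\sum_(p <- r) p.1 \ox p.2) = \sum_(p <- r) f p.1 *: p.2.
  elim: r => [|p r IHr]; first by rewrite !big_nil (tlift0 (counit_bilinl f W)).
  by rewrite !big_cons (tliftD (counit_bilinl f W)) IHr (tliftE (counit_bilinl f W)).
have [[a va]|/(functional_vanishing span_sub) [f fv fspan]] := pselect (span v).
  rewrite big_cons /=; pose s' := [seq ((nth (0, 0) s i).1, (nth (0, 0) s i).2 + a i *: w)
    | i : 'I_(size s) <- enum 'I_(size s)].
  have E (U : lmodType k) (g : V -> W -> U) : bilinear_map g ->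
      g v w + \sum_(p <- s) g p.1 p.2 = \sum_(p <- s') g p.1 p.2.
    move=> bg; rewrite /s' big_map big_enum /= [in LHS](big_nth (0, 0)) big_mkord.
    have -> : g v w = \sum_(i < size s) g (nth (0, 0) s i).1 (a i *: w).
      rewrite va; have lg := bg.1 w.
      rewrite -[LHS]/(linmap lg _) linear_sum; apply: eq_bigr => i _ /=.
      by rewrite (bilinZr bg) (bilinZl bg).
    by rewrite -big_split /=; apply: eq_bigr => i _; rewrite addrC -(bilinDr bg).
  rewrite (E _ _ (tens_bilinear V W)); apply: IH.
    by rewrite size_map size_enum_ord.
  move=> f; rewrite lift_sum -(E _ (fun v w => f v *: w) (counit_bilinl f W)).
  by have := fs f; rewrite lift_sum big_cons.
have w0 : w = 0.
  have := fs f; rewrite lift_sum big_cons /= fv scale1r big_seq big1 ?addr0 // => p ps.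
  rewrite fspan ?scale0r //.
  exists (fun i : 'I_(size s) => (i == index p s :> nat)%:R).
  have ip : (index p s < size s)%N by rewrite index_mem.
  rewrite (bigD1 (Ordinal ip)) //= eqxx scale1r nth_index // big1 ?addr0 // => i.
  by rewrite -val_eqE /= => /negbTE ->; rewrite scale0r.
rewrite big_cons w0 tens0r add0r; apply: IH => // f'.
by have := fs f'; rewrite !lift_sum big_cons /= w0 scaler0 add0r.
Qed.

(** Replaces an existential over presentations of [t] by the vanishing of a linear map. *)
Lemma tens_in_predTP V W (R : {pred W}) (S : splitting (fun x => x \in R)) (t : V \ox W) :
  tens_in predT R t <-> tmap idfun (spl_p S) t = 0.
Proof.
split=> [[s /allP sR ->]|t0].
  rewrite linear_sum big_seq big1 // => p /sR /andP [_ pR].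
  by rewrite /= tmapE (spl_pU S _).2 ?tens0r.
exists [seq (p.1, spl_i S (spl_r S p.2)) | p <- repr t].
  by apply/allP => _ /mapP [p _ ->]; exact: (spl_iU S).
rewrite big_map /= -[LHS]tmap_id.
have E (v : V) (w : W) : v \ox w = v \ox spl_i S (spl_r S w) + tmap idfun (spl_s S) (tmap idfun (spl_p S) (v \ox w)).
  by rewrite !tmapE -tensDr spl_sum.
rewrite tmap_id {1}(tens_sumE t) (eq_bigr _ (fun p _ => E p.1 p.2)) big_split /=.
by rewrite -linear_sum -linear_sum -(tens_sumE t) /= t0 linear0 addr0.
Qed.

Lemma tens_in_functional V W (R : {pred W}) (t : V \ox W) :
  subspace (fun x => x \in R) ->
  (forall f : {scalar V}, tlift (fun v w => f v *: w) t \in R) -> tens_in predT R t.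
Proof.
move=> RS tR; have [S] := splitting_exists RS; apply/(tens_in_predTP S).
apply: tens_functional_sep => f.
rewrite (tlift_tmap _ _ (counit_bilinl f _)) /=.
have pt := (spl_pU S _).2 (tR f); rewrite -[RHS]pt [in RHS]/tlift linear_sum.
by apply: eq_bigr => p _; rewrite linearZ.
Qed.

End TensorExactness.

(** * Calculus of multilinear maps *)

Section Lin.
Variable k : fieldType.
Implicit Types U V W X Y Z : lmodType k.

(** Convertible to [linear f], but a constant of its own on which the tactics below can match. *)
Definition lin V W (f : V -> W) : Prop := forall a x y, f (a *: x + y) = a *: f x + f y.

Definition trilin U V W X (F : U -> V -> W -> X) :=
  [/\ forall v w, lin (fun u => F u v w), forall u w, lin (fun v => F u v w)
    & forall u v, lin (fun w => F u v w)].

Lemma bilin_intro U V W (f : U -> V -> W) :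
  (forall v, lin (fun u => f u v)) -> (forall u, lin (fun v => f u v)) -> bilinear_map f.
Proof. by []. Qed.

Lemma linZ V W (f : V -> W) a x : lin f -> f (a *: x) = a *: f x.
Proof. by move=> lf; rewrite -[f]/(GRing.Linear.sort (linmap lf)) linearZ. Qed.

Lemma linB V W (f : V -> W) x y : lin f -> f (x - y) = f x - f y.
Proof. by move=> lf; rewrite -[f]/(GRing.Linear.sort (linmap lf)) linearB. Qed.

Lemma lin_id V : lin (fun x : V => x). Proof. by []. Qed.

Lemma lin_linear U V W (g : {linear V -> W}) (f : U -> V) :
  lin f -> lin (fun x => g (f x)).
Proof. by move=> lf a x y; rewrite lf linearP. Qed.

Lemma lin_comp U V W (g : V -> W) (f : U -> V) :
  lin g -> lin f -> lin (fun x => g (f x)).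
Proof. by move=> lg lf a x y; rewrite lf lg. Qed.

Lemma lin_tensl U V W (f : U -> V) (w : W) : lin f -> lin (fun x => f x \ox w).
Proof. by move=> lf a x y; rewrite lf tensDl tensZl. Qed.

Lemma lin_tensr U V W (f : U -> V) (w : W) : lin f -> lin (fun x => w \ox f x).
Proof. by move=> lf a x y; rewrite lf tensDr tensZr. Qed.

Lemma lin_add U V (f g : U -> V) : lin f -> lin g -> lin (fun x => f x + g x).
Proof. by move=> lf lg a x y; rewrite lf lg scalerDr addrACA. Qed.

Lemma lin_opp U V (f : U -> V) : lin f -> lin (fun x => - f x).
Proof. by move=> lf a x y; rewrite lf opprD scalerN. Qed.

Lemma lin_scaler U V (f : U -> V) b : lin f -> lin (fun x => b *: f x).
Proof. by move=> lf a x y; rewrite lf scalerDr !scalerA mulrC. Qed.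

Lemma lin_scalel U V W (e : {scalar V}) (f : U -> V) (w : W) :
  lin f -> lin (fun x => e (f x) *: w).
Proof. by move=> lf a x y; rewrite lf linearP scalerDl scalerA. Qed.

Lemma lin_scalar U V (e : {scalar V}) (f : U -> V) :
  lin f -> @lin U k^o (fun x => e (f x)).
Proof. by move=> lf a x y; rewrite lf linearP. Qed.

Lemma lin_mull U (A : algType k) (f : U -> A) c : lin f -> lin (fun x => f x * c).
Proof. by move=> lf a x y; rewrite lf mulrDl scalerAl. Qed.

Lemma lin_mulr U (A : algType k) (f : U -> A) c : lin f -> lin (fun x => c * f x).
Proof. by move=> lf a x y; rewrite lf mulrDr scalerAr. Qed.

Lemma lin_bilinl U V W X (g : V -> W -> X) (f : U -> V) w :
  bilinear_map g -> lin f -> lin (fun x => g (f x) w).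
Proof. by move=> bg lf a x y; rewrite lf (bilinDl bg) (bilinZl bg). Qed.

Lemma lin_bilinr U V W X (g : V -> W -> X) (f : U -> W) v :
  bilinear_map g -> lin f -> lin (fun x => g v (f x)).
Proof. by move=> bg lf a x y; rewrite lf (bilinDr bg) (bilinZr bg). Qed.

Lemma lin_tlift_arg U V W X (g : V -> W -> X) (f : U -> V \ox W) :
  bilinear_map g -> lin f -> lin (fun x => tlift g (f x)).
Proof. by move=> bg lf a x y; rewrite lf; apply: tlift_linear. Qed.

Lemma lin_tlift_fun U V W X (g : U -> V -> W -> X) t :
  (forall v w, lin (fun x => g x v w)) -> lin (fun x => tlift (g x) t).
Proof.
move=> lg a x y; rewrite /tlift scaler_sumr -big_split /=.
by apply: eq_bigr => p _; apply: lg.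
Qed.

Section Tri.
Variables (U V W X Y : lmodType k) (F : V -> W -> X -> Y) (tF : trilin F).

Lemma lin_trilin1 (f : U -> V) w x : lin f -> lin (fun u => F (f u) w x).
Proof. by case: tF => F1 _ _ lf; apply: (lin_comp (g := fun v => F v w x)). Qed.

Lemma lin_trilin2 (f : U -> W) v x : lin f -> lin (fun u => F v (f u) x).
Proof. by case: tF => _ F2 _ lf; apply: (lin_comp (g := fun w => F v w x)). Qed.

Lemma lin_trilin3 (f : U -> X) v w : lin f -> lin (fun u => F v w (f u)).
Proof. by case: tF => _ _ F3 lf; apply: (lin_comp (g := F v w)). Qed.

End Tri.

End Lin.

(** Peels one linear operation off the expression under the binder. Hypotheses of the form [lin],
    [bilinear_map] and [trilin] serve for local operations. Under a [tlift] the variable may occur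
    in the tensor or in the integrand, whence the alternatives for that case. *)
Ltac lin_step :=
  first
  [ apply lin_id
  | match goal with l : lin ?f |- lin (fun x => ?f (@?g x)) => apply (lin_comp (f := g) l) end
  | match goal with l : lin ?f |- lin ?f => exact l end
  | match goal with b : bilinear_map ?g |- lin (fun x => ?g (@?e x) (@?e' x)) =>
      first [apply (lin_bilinl (f := e) _ b) | apply (lin_bilinr (f := e') _ b)] end
  | match goal with t : trilin ?F |- lin (fun x => ?F (@?e1 x) (@?e2 x) (@?e3 x)) =>
      first [apply (lin_trilin1 t (f := e1)) | apply (lin_trilin2 t (f := e2))
            | apply (lin_trilin3 t (f := e3))] end
  | match goal with t : trilin ?F |- lin (?F ?a ?b) => apply (lin_trilin3 t (f := fun x => x)) end
  | match goal with b : bilinear_map ?g |- lin (?g ?a) => exact (b.2 a) end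
  | apply lin_tensl | apply lin_tensr
  | apply lin_mull | apply lin_mulr
  | apply lin_scaler | apply lin_scalel
  | apply lin_add | apply lin_opp
  | lazymatch goal with |- lin (fun x => tlift _ _) =>
      first [apply lin_tlift_arg | apply lin_tlift_fun; intros] end
  | lazymatch goal with |- lin (tlift _) => apply lin_tlift_arg end
  | lazymatch goal with |- lin (fun x => tmap _ _ _) =>
      first [apply: lin_linear | apply lin_tlift_fun; intros] end
  | apply: lin_linear | apply: lin_scalar ].

Ltac lin :=
  intros;
  lazymatch goal with
  | |- bilinear_map _ => first [ assumption | apply bilin_intro; intros; cbv beta; lin ]
  | |- trilin _ => split; intros; cbv beta; lin
  | |- lin _ => lin_step; cbv beta; lin
  | |- linear ?f => change (lin f); lin
  | |- _ => idtac
  end.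

(** * Sweedler sums written as iterated [tlift] *)

Section TensorSums.
Variable k : fieldType.
Implicit Types U V W X Y Z : lmodType k.

Lemma eq_tlift V W U (f g : V -> W -> U) t :
  (forall v w, f v w = g v w) -> tlift f t = tlift g t.
Proof. by move=> fg; apply: eq_bigr => p _; apply: fg. Qed.

Lemma tlift_sub V W U (f g : V -> W -> U) t :
  tlift (fun v w => f v w - g v w) t = tlift f t - tlift g t.
Proof. exact: sumrB. Qed.

Lemma tlift_lin V W U X (g : U -> X) (f : V -> W -> U) t :
  lin g -> g (tlift f t) = tlift (fun v w => g (f v w)) t.
Proof. by move=> lg; rewrite -[g]/(GRing.Linear.sort (linmap lg)) [LHS]linear_sum. Qed.

Lemma tlift_linear_map V W U X (g : {linear U -> X}) (f : V -> W -> U) t :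
  g (tlift f t) = tlift (fun v w => g (f v w)) t.
Proof. by apply: tlift_lin => a x y; apply: linearP. Qed.

Lemma tmap_tlift V W U X (U' X' : lmodType k) (f : {linear U -> X}) (g : {linear U' -> X'})
    (F : V -> W -> U \ox U') t :
  tmap f g (tlift F t) = tlift (fun v w => tmap f g (F v w)) t.
Proof. exact: (tlift_linear_map (tmap f g)). Qed.

Lemma tlift_exchange V W V' W' U (F : V -> W -> V' -> W' -> U) s t :
  tlift (fun a b => tlift (F a b) t) s = tlift (fun c d => tlift (fun a b => F a b c d) s) t.
Proof. exact: exchange_big. Qed.

Lemma tlift_tens V W (t : V \ox W) : tlift (fun v w => v \ox w) t = t.
Proof. exact/esym/tens_sumE. Qed.

Lemma tlift_tlift V W V' W' U (F : V -> W -> U) (G : V' -> W' -> V \ox W) t :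
  bilinear_map F -> tlift F (tlift G t) = tlift (fun v w => tlift F (G v w)) t.
Proof. by move=> bF; apply: (tlift_lin (g := tlift F)); lin. Qed.

Lemma tens_lin_ext V W U (f g : V \ox W -> U) :
  lin f -> lin g -> (forall v w, f (v \ox w) = g (v \ox w)) -> forall t, f t = g t.
Proof. exact: tens_linear_ext. Qed.

Lemma tlift_eq_tmap V W V' W' (f : V -> V') (g : W -> W') t :
  tmap f g t = tlift (fun v w => f v \ox g w) t.
Proof. by []. Qed.

Lemma tlift_tassoc U V W X (F : U -> V -> W -> X) T : trilin F ->
  tlift (fun x w => tlift (fun u v => F u v w) x) T =
  tlift (fun u y => tlift (fun v w => F u v w) y) (tassoc T).
Proof.
case=> F1 F2 F3.
have b1 w : bilinear_map (fun u v => F u v w) by split=> *; [apply: F1 | apply: F2].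
have b2 u : bilinear_map (F u) by split=> *; [apply: F2 | apply: F3].
have b3 : bilinear_map (fun x w => tlift (fun u v => F u v w) x).
  split=> [w|x]; first exact: (tlift_linear (b1 w)).
  by apply: (lin_tlift_fun (g := fun w u v => F u v w)) => u v; apply: F3.
have b4 : bilinear_map (fun u y => tlift (F u) y).
  split=> [y|u]; last exact: (tlift_linear (b2 u)).
  exact: (lin_tlift_fun (g := F)).
elim/tens_ind3: T => [|s t IHs IHt|u v w].
- by rewrite linear0 (tlift0 b3) (tlift0 b4).
- by rewrite linearD /= (tliftD b3) (tliftD b4) IHs IHt.
by rewrite tassocE (tliftE b3) (tliftE (b1 w)) (tliftE b4) (tliftE (b2 u)).
Qed.

(* Every (co)associativity axiom and the cotensor condition have the shape of
   the hypothesis. *)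
Lemma tlift_coassoc U V W X Y Z (d : {linear X -> (U \ox V)%type}) (e : {linear Y -> (V \ox W)%type})
    (s : X \ox W) (s' : U \ox Y) (F : U -> V -> W -> Z) :
  tassoc (tmap d idfun s) = tmap idfun e s' -> trilin F ->
  tlift (fun x w => tlift (fun u v => F u v w) (d x)) s =
  tlift (fun u y => tlift (fun v w => F u v w) (e y)) s'.
Proof.
move=> E tF; have [F1 F2 F3] := tF.
have b1 w : bilinear_map (fun u v => F u v w) by split=> *; [apply: F1 | apply: F2].
have b2 u : bilinear_map (F u) by split=> *; [apply: F2 | apply: F3].
have := tlift_tassoc (tmap d idfun s) tF; rewrite E !tlift_tmap //.
  split=> [y|u]; last exact: (tlift_linear (b2 u)).
  exact: (lin_tlift_fun (g := F)).
split=> [w|x]; first exact: (tlift_linear (b1 w)).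
by apply: (lin_tlift_fun (g := fun w u v => F u v w)) => u v; apply: F3.
Qed.

Lemma tassoc_tlift U V W X (d : X -> U \ox V) (s : X \ox W) : lin d ->
  tassoc (tmap d idfun s) = tlift (fun x w => tlift (fun u v => u \ox (v \ox w)) (d x)) s.
Proof.
move=> ld; rewrite tlift_eq_tmap tlift_linear_map; apply: eq_tlift => x w /=.
rewrite {1}(tens_sumE (d x)).
rewrite -[_ \ox w]/(linmap ((tens_bilinear _ _).1 w) _) !linear_sum /=.
by apply: eq_bigr => p _; apply: tassocE.
Qed.

Lemma tmap_idl_tlift U V W Y (e : Y -> V \ox W) (s : U \ox Y) :
  tmap idfun e s = tlift (fun u y => tlift (fun v w => u \ox (v \ox w)) (e y)) s.
Proof.
rewrite tlift_eq_tmap; apply: eq_tlift => u y /=.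
rewrite {1}(tens_sumE (e y)).
by rewrite -[u \ox _]/(linmap ((tens_bilinear _ _).2 u) _) !linear_sum.
Qed.

Lemma tmap2_tlift U U' V V' W W' (f : U -> V -> W) (g : U' -> V' -> W') s t :
  tmap2 f g s t = tlift (fun u u' => tlift (fun v v' => f u v \ox g u' v') t) s.
Proof. by []. Qed.

Lemma tswap_linear V W : linear (tlift (fun (v : V) (w : W) => w \ox v)).
Proof. by apply: tlift_linear; lin. Qed.

Definition tswap V W : {linear (V \ox W)%type -> (W \ox V)%type} := linmap (@tswap_linear V W).

Lemma tswapE V W (v : V) (w : W) : tswap V W (v \ox w) = w \ox v.
Proof. by rewrite /tswap /= tliftE //; lin. Qed.

Lemma tswapK V W (t : V \ox W) : tswap W V (tswap V W t) = t.
Proof. by move: t; apply: tens_lin_ext; [lin|lin|] => v w; rewrite !tswapE. Qed.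

Lemma tswap_tmap V W (V' W' : lmodType k) (f : {linear V -> V'}) (g : {linear W -> W'}) t :
  tswap V' W' (tmap f g t) = tmap g f (tswap V W t).
Proof.
by move: t; apply: tens_lin_ext; [lin|lin|] => v w; rewrite tmapE !tswapE tmapE.
Qed.

Lemma tlift_tswap V W U (F : W -> V -> U) t : bilinear_map F ->
  tlift F (tswap V W t) = tlift (fun v w => F w v) t.
Proof. by move=> bF; rewrite tlift_tlift //; apply: eq_tlift => v w; rewrite tliftE. Qed.

Lemma tmap_kerr V W (W' K : lmodType k) (f : {linear W -> W'}) (i : {linear K -> W}) :
  (forall x, f x = 0 -> exists y, i y = x) ->
  forall t : V \ox W, tmap idfun f t = 0 -> exists u, tmap idfun i u = t.
Proof.
move=> fi t ft0; have [|u uE] := tmap_kerl fi (t := tswap V W t).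
  by rewrite -tswap_tmap ft0 linear0.
by exists (tswap _ _ u); rewrite -tswap_tmap uE tswapK.
Qed.

End TensorSums.

(** * Antipodes *)

Section Coalgebra.
Variables (k : fieldType) (C : coalgType k).

Lemma comul_coassoc (W : lmodType k) (F : C -> C -> C -> W) h : trilin F ->
  tlift (fun x y => tlift (fun u v => F u v y) (comul x)) (comul h) =
  tlift (fun x y => tlift (fun u v => F x u v) (comul y)) (comul h).
Proof. exact: (tlift_coassoc (d := comul) (e := comul) (comulA h)). Qed.

Lemma tlift_counitl (W : lmodType k) (f : C -> W) h : lin f ->
  tlift (fun x y => counit x *: f y) (comul h) = f h.
Proof.
move=> lf; rewrite -[in RHS](counitl h) (tlift_lin _ _ lf); apply: eq_tlift => x y.
by rewrite -[f]/(GRing.Linear.sort (linmap lf)) linearZ.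
Qed.

Lemma tlift_counitr (W : lmodType k) (f : C -> W) h : lin f ->
  tlift (fun x y => counit y *: f x) (comul h) = f h.
Proof.
move=> lf; rewrite -[in RHS](counitr h) (tlift_lin _ _ lf); apply: eq_tlift => x y.
by rewrite -[f]/(GRing.Linear.sort (linmap lf)) linearZ.
Qed.

End Coalgebra.

Section Hopf.
Variables (k : fieldType) (H : hopfAlgType k).
Local Notation S := (@antipode k H).

HB.instance Definition _ := GRing.isLinear.Build k H H *:%R S (@antipode_linear k H).

Lemma comulM_tlift (W : lmodType k) (f : H -> H -> W) x y : bilinear_map f ->
  tlift f (comul (x * y)) =
  tlift (fun x1 x2 => tlift (fun y1 y2 => f (x1 * y1) (x2 * y2)) (comul y)) (comul x).
Proof.
move=> bf; rewrite comulM tmap2_tlift (tlift_tlift _ _ bf); apply: eq_tlift => x1 x2.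
by rewrite (tlift_tlift _ _ bf); apply: eq_tlift => y1 y2; rewrite tliftE.
Qed.

Lemma tlift_antipodel (W : lmodType k) (f : H -> W) h : lin f ->
  tlift (fun x y => f (S x * y)) (comul h) = counit h *: f 1.
Proof.
move=> lf; rewrite -(tlift_lin (fun x y => S x * y) _ lf) antipodel.
by rewrite -[f]/(GRing.Linear.sort (linmap lf)) linearZ.
Qed.

Lemma tlift_antipoder (W : lmodType k) (f : H -> W) h : lin f ->
  tlift (fun x y => f (x * S y)) (comul h) = counit h *: f 1.
Proof.
move=> lf; rewrite -(tlift_lin (fun x y => x * S y) _ lf) antipoder.
by rewrite -[f]/(GRing.Linear.sort (linmap lf)) linearZ.
Qed.

Lemma antipode1 : S 1 = 1.
Proof.
have := antipodel (1 : H); rewrite comul1 tliftE; last by lin.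
by rewrite counit1 scale1r mulr1.
Qed.

(** Both sides equal the sum of [S (x1 * y1) * x2 * y2 * S y3 * S x3]. Contracting the first factors
    by [E] leaves [S y * S x]; contracting from the middle, first [y2 * S y3] and then [x2 * S x3],
    leaves [S (x * y)]. *)
Lemma antipodeM x y : S (x * y) = S y * S x.
Proof.
have E u v : tlift (fun a b => tlift (fun c d => S (a * c) * (b * d)) (comul v)) (comul u) =
    (counit u * counit v) *: 1.
  by rewrite -counitM -antipodel [RHS]comulM_tlift //; lin.
rewrite -[RHS](@tlift_counitl _ _ _ (fun x => S y * S x)); last by lin.
under eq_tlift => x1 x2.
  rewrite -[S y * _](@tlift_counitl _ _ _ (fun y => S y * S x2)); last by lin.
  rewrite (tlift_lin (g := fun w => counit x1 *: w)); last by lin.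
  under eq_tlift => y1 y2.
    rewrite scalerA -[_ *: (_ * _)]mul1r -scalerAr scalerAl -E.
    rewrite (tlift_lin (g := fun w => w * _)); last by lin.
    under eq_tlift => a b.
      rewrite (tlift_lin (g := fun w => w * _)); last by lin.
      over.
    over.
  rewrite tlift_exchange.
  over.
rewrite comul_coassoc; last by lin.
rewrite -[LHS](tlift_counitr (f := fun x => S (x * y))); last by lin.
apply: eq_tlift => x1 x2; rewrite /= -[RHS]/(tlift _ _).
under [RHS]eq_tlift => d e.
  rewrite comul_coassoc; last by lin.
  under eq_tlift => v y2.
    under eq_tlift => w b.
      rewrite -mulrA (mulrA (d * w)) -(mulrA d).
      over.
    rewrite (tlift_antipoder (f := fun z => S (x1 * v) * (d * z * S e))); last by lin.
    rewrite mulr1.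
    over.
  rewrite (tlift_counitr (f := fun v => S (x1 * v) * (d * S e))); last by lin.
  over.
rewrite (tlift_antipoder (f := fun z => S (x1 * y) * z)); last by lin.
by rewrite mulr1.
Qed.

Lemma counit_antipode x : counit (S x) = counit x.
Proof.
have le : lin (fun x : H => counit x : k^o) by move=> a u v; exact: (@counit_scalar _ H a u v).
have := congr1 (fun z : H => counit z : k^o) (antipodel x).
rewrite (tlift_lin (g := fun z : H => counit z : k^o)) // linearZ /= counit1 mulr1 => <-.
rewrite -[in LHS](counitr x) -[antipode]/(GRing.Linear.sort antipode).
rewrite tlift_linear_map (tlift_lin (g := fun z : H => counit z : k^o)) //.
by apply: (@eq_tlift k H H k^o) => u v; rewrite linearZ /= counitM linearZ mulrC.
Qed.

Lemma comul_antipode (W : lmodType k) (f : H -> H -> W) x : bilinear_map f ->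
  tlift f (comul (S x)) = tlift (fun u v => f (S v) (S u)) (comul x).
Proof.
move=> bf.
(* In the convolution algebra Hom(H, H (x) H), both sides are inverse to the
   comultiplication; m below is the product of H (x) H. *)
pose m := @tmap2 k H H H H H H *%R *%R.
have bm : bilinear_map m.
  split=> [t|s]; first by apply: tlift_linear; lin.
  by apply: (@lin_tlift_fun _ _ _ _ _ (fun t u u' => tlift (fun v v' => u * v \ox (u' * v')) t));
    lin.
pose T x := tlift (fun u v => S v \ox S u) (comul x).
have lT : lin T by rewrite /T; lin.
have mE (u v u' v' : H) : m (u \ox v) (u' \ox v') = (u * u') \ox (v * v').
  by rewrite /m tmap2_tlift tliftE ?tliftE //; lin.
have mA : associative m.
  move=> s t u; move: s; apply: tens_lin_ext; [lin|lin|move=> a b].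
  move: t; apply: tens_lin_ext; [lin|lin|move=> c d].
  move: u; apply: tens_lin_ext; [lin|lin|move=> e g].
  by rewrite !mE !mulrA.
have m1 : left_id (1 \ox 1) m.
  move=> t; move: t; apply: tens_lin_ext; [lin|lin|move=> a b].
  by rewrite mE !mul1r.
have m1' : right_id (1 \ox 1) m.
  move=> t; move: t; apply: tens_lin_ext; [lin|lin|move=> a b].
  by rewrite mE !mulr1.
have E1 y : tlift (fun u v => m (T u) (comul v)) (comul y) = counit y *: (1 \ox 1).
  have F u v : m (T u) (comul v) = tlift (fun a b => tlift (fun c d => S b * c \ox (S a * d))
      (comul v)) (comul u).
    rewrite /m tmap2_tlift /T tlift_tlift; last by lin.
    by apply: eq_tlift => a b; rewrite tliftE; last by lin.
  under eq_tlift do rewrite F.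
  rewrite comul_coassoc; last by lin.
  under eq_tlift => a z.
    rewrite -(@comul_coassoc _ _ _ (fun b c d => S b * c \ox (S a * d))); last by lin.
    under eq_tlift => b d.
      rewrite (tlift_antipodel (f := fun z => z \ox (S a * d))); last by lin.
      over.
    rewrite (tlift_counitl (f := fun z => 1 \ox (S a * z))); last by lin.
    over.
  by rewrite (tlift_antipodel (f := fun z => 1 \ox z)); last by lin.
have E2 y : tlift (fun u v => m (comul u) (comul (S v))) (comul y) = counit y *: (1 \ox 1).
  have F u v : m (comul u) (comul v) = comul (u * v) by rewrite comulM.
  under eq_tlift do rewrite F.
  rewrite (tlift_antipoder (f := comul)); last by lin.
  by rewrite comul1.
have -> : comul (S x) = T x; last by rewrite /T tlift_tlift //; apply: eq_tlift => u v; rewrite tliftE.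
rewrite -[LHS](tlift_counitl (f := fun x => comul (S x))); last by lin.
under eq_tlift => u v.
  rewrite -[comul _]m1 -(bilinZl bm) -E1 (tlift_lin (g := fun z => m z _)); last by lin.
  over.
rewrite comul_coassoc; last by lin.
under eq_tlift => u v.
  under eq_tlift do rewrite -mA.
  rewrite -(tlift_lin (g := fun z => m (T u) z)); last by lin.
  rewrite E2 (bilinZr bm) m1'.
  over.
by rewrite tlift_counitr.
Qed.

Variable S' : H -> H.
Hypotheses (SK : cancel S S') (S'K : cancel S' S).

Lemma inverse_antipode_lin : lin S'.
Proof. by move=> a x y; apply: (can_inj SK); rewrite S'K [RHS](linearP S) /= !S'K. Qed.
Let lS' := inverse_antipode_lin.

Lemma inverse_antipode1 : S' 1 = 1.
Proof. by rewrite -{1}antipode1 SK. Qed.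

Lemma inverse_antipodeM x y : S' (x * y) = S' y * S' x.
Proof. by apply: (can_inj SK); rewrite antipodeM !S'K. Qed.

Lemma counit_inverse_antipode x : counit (S' x) = counit x.
Proof. by rewrite -[in RHS](S'K x) counit_antipode. Qed.

Lemma comul_inverse_antipode (W : lmodType k) (f : H -> H -> W) x : bilinear_map f ->
  tlift f (comul (S' x)) = tlift (fun u v => f (S' v) (S' u)) (comul x).
Proof.
move=> bf; rewrite -{2}(S'K x) comul_antipode; last by lin.
by apply: eq_tlift => u v; rewrite !SK.
Qed.

(** [S'] reverses products, so applying it to the antipode identity gives a cancellation in which
    the two Sweedler factors appear in the opposite order. *)
Lemma tlift_inverse_antipodel (W : lmodType k) (f : H -> W) h : lin f ->
  tlift (fun x y => f (S' y * x)) (comul h) = counit h *: f 1.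
Proof.
move=> lf; have lg : lin (fun z => f (S' z)) by lin.
have E x y : S' y * x = S' (S x * y) by rewrite inverse_antipodeM SK.
under eq_tlift => x y do rewrite E.
by rewrite (tlift_antipodel (f := fun z => f (S' z))) //= inverse_antipode1.
Qed.

Lemma tlift_inverse_antipoder (W : lmodType k) (f : H -> W) h : lin f ->
  tlift (fun x y => f (y * S' x)) (comul h) = counit h *: f 1.
Proof.
move=> lf; have lg : lin (fun z => f (S' z)) by lin.
have E x y : y * S' x = S' (x * S y) by rewrite inverse_antipodeM SK.
under eq_tlift => x y do rewrite E.
by rewrite (tlift_antipoder (f := fun z => f (S' z))) //= inverse_antipode1.
Qed.

End Hopf.

(** * Categories of fractions *)

#[local] Instance heq_equivalence (A : category) X Y : Equivalence (@heq A X Y).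
Proof.
split; [exact: heq_refl | exact: heq_sym | exact: heq_trans].
Qed.

#[local] Instance cmp_proper (A : category) X Y Z :
  Proper (@heq A Y Z ==> @heq A X Y ==> @heq A X Z) cmp.
Proof. by move=> g g' gg f f' ff; apply: heq_cmp. Qed.

#[local] Instance fmap_proper (A B : category) (F : functor A B) X Y :
  Proper (@heq A X Y ==> @heq B (F X) (F Y)) (fmap F).
Proof. by move=> f g fg; apply: fmap_heq. Qed.

Hint Resolve heq_refl : core.

Section Isomorphisms.
Variable A : category.

Definition is_inverse (X Y : A) (f : hom X Y) (g : hom Y X) :=
  heq (cmp g f) (idm X) /\ heq (cmp f g) (idm Y).

Definition is_iso (X Y : A) (f : hom X Y) := exists g, is_inverse f g.

Lemma inverse_unique (X Y : A) (f : hom X Y) g g' :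
  is_inverse f g -> is_inverse f g' -> heq g g'.
Proof.
by move=> [_ fg] [gf _]; rewrite -(cmp_idl g) -gf -cmpA fg cmp_idr.
Qed.

End Isomorphisms.

Lemma fmap_inverse (A B : category) (F : functor A B) (X Y : A) (f : hom X Y) g :
  is_inverse f g -> is_inverse (fmap F f) (fmap F g).
Proof. by move=> [fg gf]; split; rewrite -fmap_cmp ?fg ?gf fmap_id. Qed.

(** * Universal property of the quotient category *)

Section QuotientExtension.
Variables (A B : category) (S : A -> Prop) (G : functor A B).
Hypothesis G_iso : forall X Y (f : hom X Y), serre_iso S f -> is_iso (fmap G f).

(** Defined by recursion on formal words, a formal inverse going to a chosen inverse. Compatibility
    with the congruence is then one check per generating relation, and no normal form of a fraction
    is needed. *)
Fixpoint quotient_ext_mor (X Y : A) (f : qhom S X Y) : hom (G X) (G Y) :=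
  match f with
  | qmor _ _ f => fmap G f
  | qinv _ _ _ fS => sval (cid (G_iso fS))
  | qcmp _ _ _ g f => cmp (quotient_ext_mor g) (quotient_ext_mor f)
  end.

Lemma quotient_ext_heq (X Y : A) (f g : qhom S X Y) :
  qeq f g -> heq (quotient_ext_mor f) (quotient_ext_mor g).
Proof.
elim=> {X Y f g} /=.
- by [].
- by move=> X Y f g _ ->.
- by move=> X Y f g h _ -> _ ->.
- by move=> X Y Z g g' f f' _ -> _ ->.
- by move=> *; apply: cmpA.
- by move=> X Y f; rewrite fmap_id cmp_idl.
- by move=> X Y f; rewrite fmap_id cmp_idr.
- by move=> X Y f g ->.
- by move=> *; apply: fmap_cmp.
- by move=> X Y f fS; rewrite fmap_id; case: (svalP (cid (G_iso fS))).
- by move=> X Y f fS; rewrite fmap_id; case: (svalP (cid (G_iso fS))).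
Qed.

Definition quotient_ext : functor (serre_quotient S) B :=
  @Functor (serre_quotient S) B G quotient_ext_mor quotient_ext_heq
    (fmap_id G) (fun _ _ _ _ _ => heq_refl _).

End QuotientExtension.

(** Commuting squares compose, and a square whose horizontal maps are invertible also commutes with
    the inverses. So the naturality condition propagates from the morphisms of [A] to all formal
    words. *)
Lemma qeq_natural (A B : category) (S : A -> Prop) (F G : functor (serre_quotient S) B)
    (t : forall X : A, hom (F X) (G X)) :
  (forall (X Y : A) (f : hom X Y),
    heq (cmp (t Y) (fmap F (qmor S f))) (cmp (fmap G (qmor S f)) (t X))) ->
  forall (X Y : serre_quotient S) (f : hom X Y),
    heq (cmp (t Y) (fmap F f)) (cmp (fmap G f) (t X)).
Proof.
move=> nat X Y f; elim: f => {X Y} [X Y f|X Y f fS|X Y Z g IHg f IHf]; first exact: nat.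
  have FI : is_inverse (fmap F (qmor S f)) (fmap F (qinv fS)).
    by apply: fmap_inverse; split; [apply: qeq_invl | apply: qeq_invr].
  have GI : is_inverse (fmap G (qmor S f)) (fmap G (qinv fS)).
    by apply: fmap_inverse; split; [apply: qeq_invl | apply: qeq_invr].
  rewrite -[X in heq X _]cmp_idl -GI.1 -cmpA (cmpA _ (t X)) -nat.
  by rewrite -cmpA FI.2 cmp_idr.
rewrite -[qcmp g f]/(@cmp (serre_quotient S) _ _ _ g f) !fmap_cmp.
by rewrite cmpA IHg -cmpA IHf cmpA.
Qed.

Lemma natural_inverse (A' B' : category) (F1 F2 : functor A' B') (t : forall X, hom (F1 X) (F2 X))
    (u : forall X, hom (F2 X) (F1 X)) :
  (forall X, is_inverse (t X) (u X)) ->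
  (forall X Y (f : hom X Y), heq (cmp (t Y) (fmap F1 f)) (cmp (fmap F2 f) (t X))) ->
  forall X Y (f : hom X Y), heq (cmp (u Y) (fmap F2 f)) (cmp (fmap F1 f) (u X)).
Proof.
move=> tu nat X Y f; rewrite -[X in heq X _]cmp_idr -(tu X).2.
by rewrite -cmpA (cmpA (fmap F2 f)) -nat -cmpA (cmpA (u Y)) (tu Y).1 cmp_idl.
Qed.

(** * Adjoint pairs that compute the quotient category *)

Section Localization.
Variables (A B : category) (S : A -> Prop) (G : functor A B) (F : functor B A).
Variable adj : adjunction F G.

(** The second condition says that [F] is fully faithful; the last two say that [G] inverts the
    morphisms inverted in the quotient and that the counits are among these. Together they identify
    [G] with the quotient functor. *)
Definition localization :=
  [/\ serre S, forall Y, is_iso (adj_unit adj Y),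
      forall X Y (f : hom X Y), serre_iso S f -> is_iso (fmap G f)
    & forall X, serre_iso S (adj_counit adj X)].

Hypothesis loc : localization.

Let G_iso : forall X Y (f : hom X Y), serre_iso S f -> is_iso (fmap G f).
Proof. by case: loc. Qed.
Let counit_iso X : serre_iso S (adj_counit adj X). Proof. by case: loc. Qed.
Let Q := quotient_functor S.
Let QG := quotient_ext G_iso.
Let QF : functor B (serre_quotient S) := functor_cmp Q F.

Let Qc X : @hom (serre_quotient S) (QF (QG X)) X := qmor S (adj_counit adj X).
Let Qi X : @hom (serre_quotient S) X (QF (QG X)) := qinv (counit_iso X).

Let Qinverse X : is_inverse (Qc X) (Qi X).
Proof. by split; [apply: qeq_invl | apply: qeq_invr]. Qed.

Let Qcounit_natural (X Y : serre_quotient S) (f : hom X Y) :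
  heq (cmp (Qc Y) (fmap QF (fmap QG f))) (cmp f (Qc X)).
Proof.
move: X Y f; apply: (@qeq_natural A _ S (functor_cmp QF QG) (functor_id _)) => X Y f /=.
apply: (qeq_trans (qeq_sym (qeq_mor_cmp _ _ _))).
apply: (qeq_trans _ (qeq_mor_cmp _ _ _)).
exact/qeq_mor/adj_counit_natural.
Qed.

Lemma localization_equivalent : cat_equivalent (serre_quotient S) B.
Proof.
exists QG, QF; split.
  apply: inhabits.
  apply: (@NaturalIso _ _ (functor_cmp QF QG) (functor_id _) Qc Qi).
  - exact: Qcounit_natural.
  - by move=> X; apply: (Qinverse X).1.
  - by move=> X; apply: (Qinverse X).2.
have [_ uI _ _] := loc.
pose u Y := sval (cid (uI Y)); have uP Y := svalP (cid (uI Y)).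
apply: inhabits.
apply: (@NaturalIso _ _ (functor_cmp QG QF) (functor_id _) u (adj_unit adj)).
- apply: (@natural_inverse _ _ (functor_id _) (functor_cmp QG QF) (adj_unit adj) u) => //.
  by move=> X Y f /=; apply: adj_unit_natural.
- by move=> X; apply: (uP X).2.
- by move=> X; apply: (uP X).1.
Qed.

(** The left adjoint of the quotient functor is [F] after the extension of [G]. Its unit is the
    formal inverse of the counit of [adj], and its counit is the counit of [adj] itself. *)
Lemma localization_colocalizing : colocalizing S.
Proof.
split; first by case: loc.
exists (functor_cmp F QG); apply: inhabits.
apply: (@Adjunction A (serre_quotient S) (functor_cmp F QG) Q Qi (fun X => adj_counit adj X)).
- apply: (@natural_inverse _ _ (functor_cmp QF QG) (functor_id _) Qc Qi Qinverse).
  exact: Qcounit_natural.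
- by move=> X Y f; exact: (adj_counit_natural adj f).
- move=> X /=; case: cid => g gP /=.
  (* The chosen inverse [g] of the image of the counit under [G] must be the unit at [G X]: the
     right triangle makes the unit a one-sided inverse, and its invertibility makes it two-sided. *)
  have [_ /(_ (G X)) [u uP] _ _] := loc.
  have -> : heq g (adj_unit adj (G X)); last exact: adj_triangle_left.
  apply: (inverse_unique gP); split; last exact: adj_triangle_right.
  have E : heq u (fmap G (adj_counit adj X)).
    by rewrite -[u]cmp_idl -(adj_triangle_right adj X) -cmpA uP.2 cmp_idr.
  by rewrite -E uP.2.
by move=> X; apply: (Qinverse X).2.
Qed.

End Localization.

(** * Invariance of kernels, Serre subcategories and their quotients under equivalence *)

Section ZeroMorphisms.
Variable A : category.

Lemma zero_mor_heq (X Y : A) (f g : hom X Y) : heq f g -> zero_mor f -> zero_mor g.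
Proof. by move=> fg [Z [a [b [Z0 E]]]]; exists Z, a, b; split=> //; rewrite -fg. Qed.

Lemma zero_mor_cmpl (X Y Z : A) (g : hom Y Z) (f : hom X Y) : zero_mor f -> zero_mor (cmp g f).
Proof.
by move=> [O [a [b [O0 E]]]]; exists O, a, (cmp g b); split=> //; rewrite E cmpA.
Qed.

Lemma zero_mor_cmpr (X Y Z : A) (g : hom Y Z) (f : hom X Y) : zero_mor g -> zero_mor (cmp g f).
Proof.
by move=> [O [a [b [O0 E]]]]; exists O, (cmp a f), b; split=> //; rewrite E cmpA.
Qed.

End ZeroMorphisms.

(** Compared with [cat_equivalent] this records the triangle identities, which the transport of
    kernels and of left adjoints uses. Both isomorphisms point towards the identity, so exchanging
    [P] and [R] just exchanges the fields. *)
Record adjoint_equivalence (A A' : category) (P : functor A A') (R : functor A' A) :=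
  AdjointEquivalence {
  ae_unit : natural_iso (functor_cmp R P) (functor_id A);
  ae_counit : natural_iso (functor_cmp P R) (functor_id A');
  ae_tri1 : forall X, heq (fmap P (ni_hom ae_unit X)) (ni_hom ae_counit (P X));
  ae_tri2 : forall Y, heq (fmap R (ni_hom ae_counit Y)) (ni_hom ae_unit (R Y))
}.

Definition adjoint_equivalence_sym (A A' : category) (P : functor A A') (R : functor A' A)
    (E : adjoint_equivalence P R) : adjoint_equivalence R P :=
  AdjointEquivalence (ae_tri2 E) (ae_tri1 E).

Section Preservation.
Variables (A A' : category) (P : functor A A') (R : functor A' A).
Variable E : adjoint_equivalence P R.

Let e X : hom (R (P X)) X := ni_hom (ae_unit E) X.
Let e' X : hom X (R (P X)) := ni_inv (ae_unit E) X.
Let t Y : hom (P (R Y)) Y := ni_hom (ae_counit E) Y.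
Let t' Y : hom Y (P (R Y)) := ni_inv (ae_counit E) Y.
Let e'e X : heq (cmp (e' X) (e X)) (idm _) := ni_invl (ae_unit E) X.
Let ee' X : heq (cmp (e X) (e' X)) (idm _) := ni_invr (ae_unit E) X.
Let tt' Y : heq (cmp (t Y) (t' Y)) (idm _) := ni_invr (ae_counit E) Y.
Let e_nat X Y (f : hom X Y) : heq (cmp (e Y) (fmap R (fmap P f))) (cmp f (e X)) :=
  ni_natural (ae_unit E) f.
Let t_nat X Y (f : hom X Y) : heq (cmp (t Y) (fmap P (fmap R f))) (cmp f (t X)) :=
  ni_natural (ae_counit E) f.
Let Pe X : heq (fmap P (e X)) (t (P X)) := ae_tri1 E X.

Let e'_nat X Y (f : hom X Y) : heq (cmp (fmap R (fmap P f)) (e' X)) (cmp (e' Y) f).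
Proof.
by rewrite -[X in heq X _]cmp_idl -e'e -cmpA (cmpA (e Y)) e_nat -cmpA ee' cmp_idr.
Qed.

Lemma equivalence_faithful (X Y : A') (g h : hom X Y) :
  heq (fmap R g) (fmap R h) -> heq g h.
Proof.
move=> gh; rewrite -(cmp_idr g) -(cmp_idr h) -tt' !cmpA -!t_nat.
by rewrite gh.
Qed.

Lemma equivalence_zero_object Z : zero_object Z -> zero_object (P Z).
Proof.
move=> Z0 X; have [[f fP] [g gP]] := Z0 (R X); split.
  exists (cmp (t X) (fmap P f)) => h; apply: equivalence_faithful.
  rewrite -[X in heq X _]cmp_idr -[X in heq _ X]cmp_idr -e'e !cmpA.
  by rewrite (fP (cmp (fmap R h) _)) (fP (cmp (fmap R _) _)).
exists (cmp (fmap P g) (t' X)) => h; apply: equivalence_faithful.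
rewrite -[X in heq X _]cmp_idl -[X in heq _ X]cmp_idl -e'e -!cmpA.
by rewrite (gP (cmp (e Z) (fmap R h))) (gP (cmp (e Z) _)).
Qed.

Lemma equivalence_zero_mor X Y (f : hom X Y) : zero_mor f -> zero_mor (fmap P f).
Proof.
move=> [Z [g [h [Z0 fE]]]]; exists (P Z), (fmap P g), (fmap P h).
by split; [exact: equivalence_zero_object | rewrite fE fmap_cmp].
Qed.

End Preservation.

Section KernelPreservation.
Variables (A A' : category) (P : functor A A') (R : functor A' A).
Variable E : adjoint_equivalence P R.

Let e X : hom (R (P X)) X := ni_hom (ae_unit E) X.
Let e' X : hom X (R (P X)) := ni_inv (ae_unit E) X.
Let t Y : hom (P (R Y)) Y := ni_hom (ae_counit E) Y.
Let t' Y : hom Y (P (R Y)) := ni_inv (ae_counit E) Y.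
Let e'e X : heq (cmp (e' X) (e X)) (idm _) := ni_invl (ae_unit E) X.
Let ee' X : heq (cmp (e X) (e' X)) (idm _) := ni_invr (ae_unit E) X.
Let tt' Y : heq (cmp (t Y) (t' Y)) (idm _) := ni_invr (ae_counit E) Y.
Let e_nat X Y (f : hom X Y) : heq (cmp (e Y) (fmap R (fmap P f))) (cmp f (e X)) :=
  ni_natural (ae_unit E) f.
Let t_nat X Y (f : hom X Y) : heq (cmp (t Y) (fmap P (fmap R f))) (cmp f (t X)) :=
  ni_natural (ae_counit E) f.
Let Pe X : heq (fmap P (e X)) (t (P X)) := ae_tri1 E X.
Let e'_nat X Y (f : hom X Y) : heq (cmp (fmap R (fmap P f)) (e' X)) (cmp (e' Y) f).
Proof.
by rewrite -[X in heq X _]cmp_idl -e'e -cmpA (cmpA (e Y)) e_nat -cmpA ee' cmp_idr.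
Qed.

(** A test morphism into [P X] is carried to [A] by [R] and the unit, factored there through [i],
    and carried back. Uniqueness follows from the faithfulness of [R]. *)
Lemma equivalence_kernel K X Y (i : hom K X) (f : hom X Y) :
  is_kernel i f -> is_kernel (fmap P i) (fmap P f).
Proof.
move=> [fi0 iU]; split.
  by apply: zero_mor_heq (equivalence_zero_mor E fi0); rewrite fmap_cmp.
move=> T g fg0; pose g0 := cmp (e X) (fmap R g).
have fg0' : zero_mor (cmp f g0).
  apply: zero_mor_heq (zero_mor_cmpl (e Y) (equivalence_zero_mor (adjoint_equivalence_sym E) fg0)).
  by rewrite fmap_cmp cmpA e_nat -cmpA.
have [u0 iu0 u0U] := iU _ _ fg0'.
have back u' : heq (cmp (fmap P i) u') g -> heq (cmp (e K) (fmap R u')) u0.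
  move=> iu'; apply: u0U; rewrite cmpA -e_nat -cmpA -fmap_cmp.
  by rewrite iu'.
exists (cmp (fmap P u0) (t' T)).
  rewrite cmpA -fmap_cmp iu0 /g0 fmap_cmp Pe t_nat -cmpA.
  by rewrite tt' cmp_idr.
move=> u' iu'; apply: (equivalence_faithful E).
rewrite -[X in heq X _]cmp_idl -[X in heq _ X]cmp_idl -e'e -!cmpA.
rewrite back // back //.
rewrite cmpA -fmap_cmp iu0 /g0 fmap_cmp Pe t_nat -cmpA.
by rewrite tt' cmp_idr.
Qed.

Lemma equivalence_cokernel X Y K (f : hom X Y) (p : hom Y K) :
  is_cokernel f p -> is_cokernel (fmap P f) (fmap P p).
Proof.
move=> [pf0 pU]; split.
  by apply: zero_mor_heq (equivalence_zero_mor E pf0); rewrite fmap_cmp.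
move=> T g gf0; pose g0 := cmp (fmap R g) (e' Y).
have gf0' : zero_mor (cmp g0 f).
  apply: zero_mor_heq (zero_mor_cmpr (e' X) (equivalence_zero_mor (adjoint_equivalence_sym E) gf0)).
  by rewrite fmap_cmp -cmpA e'_nat cmpA.
have [u0 u0p u0U] := pU _ _ gf0'.
have back u' : heq (cmp u' (fmap P p)) g -> heq (cmp (fmap R u') (e' K)) u0.
  move=> u'p; apply: u0U; rewrite -cmpA -e'_nat cmpA -fmap_cmp.
  by rewrite u'p.
have fwd : heq (cmp (cmp (t T) (fmap P u0)) (fmap P p)) g.
  rewrite -cmpA -fmap_cmp u0p /g0 fmap_cmp cmpA t_nat -cmpA -Pe -fmap_cmp.
  by rewrite ee' fmap_id cmp_idr.
exists (cmp (t T) (fmap P u0)) => // u' u'p; apply: (equivalence_faithful E).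
rewrite -[X in heq X _]cmp_idr -[X in heq _ X]cmp_idr -e'e !cmpA.
by rewrite back // back.
Qed.

End KernelPreservation.

Section SerrePreservation.
Variables (A A' : category) (P : functor A A') (R : functor A' A).
Variable E : adjoint_equivalence P R.
Variables (S : A -> Prop) (S' : A' -> Prop).
Hypothesis SP : forall X, S X <-> S' (P X).

Lemma equivalence_serre : serre S' -> serre S.
Proof.
move=> sS' X' X X'' f g [ker coker]; rewrite !SP.
apply: (sS' _ _ _ (fmap P f) (fmap P g)); split.
  exact: (equivalence_kernel E).
exact: (equivalence_cokernel E).
Qed.

Lemma equivalence_serre_iso X Y (f : hom X Y) : serre_iso S f -> serre_iso S' (fmap P f).
Proof.
move=> [[K [i [ki SK]]] [L [p [cp SL]]]]; split.
  by exists (P K), (fmap P i); split; [exact: (equivalence_kernel E) | apply/SP].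
by exists (P L), (fmap P p); split; [exact: (equivalence_cokernel E) | apply/SP].
Qed.

Lemma quotient_functor_iso X Y (f : hom X Y) :
  serre_iso S f -> is_iso (fmap (functor_cmp (quotient_functor S') P) f).
Proof.
move=> /equivalence_serre_iso fS; exists (qinv fS).
by split; [apply: qeq_invl | apply: qeq_invr].
Qed.

Definition quotient_transport : functor (serre_quotient S) (serre_quotient S') :=
  quotient_ext quotient_functor_iso.

End SerrePreservation.

Section QuotientEquivalence.
Variables (A A' : category) (P : functor A A') (R : functor A' A).
Variable E : adjoint_equivalence P R.
Variables (S : A -> Prop) (S' : A' -> Prop).
Hypotheses (SP : forall X, S X <-> S' (P X)) (SR : forall Y, S' Y <-> S (R Y)).

Let PP := quotient_transport E SP.
Let RR := quotient_transport (adjoint_equivalence_sym E) SR.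

(** The components are recorded in the statement because the isomorphism itself stays opaque. *)
Lemma quotient_unit : exists n : natural_iso (functor_cmp RR PP) (functor_id _),
  forall X, ni_hom n X = qmor S (ni_hom (ae_unit E) X) /\
            ni_inv n X = qmor S (ni_inv (ae_unit E) X).
Proof.
unshelve eexists; first unshelve refine (@NaturalIso _ _ (functor_cmp RR PP) (functor_id _)
  (fun X => qmor S (ni_hom (ae_unit E) X)) (fun X => qmor S (ni_inv (ae_unit E) X)) _ _ _).
- apply: (@qeq_natural A _ S (functor_cmp RR PP) (functor_id _)) => X Y f /=.
  apply: (qeq_trans (qeq_sym (qeq_mor_cmp _ _ _))).
  apply: (qeq_trans _ (qeq_mor_cmp _ _ _)).
  exact/qeq_mor/(ni_natural (ae_unit E)).
- move=> X; apply: (qeq_trans (qeq_sym (qeq_mor_cmp _ _ _))).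
  exact/qeq_mor/(ni_invl (ae_unit E)).
- move=> X; apply: (qeq_trans (qeq_sym (qeq_mor_cmp _ _ _))).
  exact/qeq_mor/(ni_invr (ae_unit E)).
by [].
Qed.

End QuotientEquivalence.

Section QuotientTransport.
Variables (A A' : category) (P : functor A A') (R : functor A' A).
Variable E : adjoint_equivalence P R.
Variables (S : A -> Prop) (S' : A' -> Prop).
Hypotheses (SP : forall X, S X <-> S' (P X)) (SR : forall Y, S' Y <-> S (R Y)).

Let PP := quotient_transport E SP.
Let RR := quotient_transport (adjoint_equivalence_sym E) SR.

Lemma quotient_counit : exists n : natural_iso (functor_cmp PP RR) (functor_id _),
  forall X, ni_hom n X = qmor S' (ni_hom (ae_counit E) X) /\
            ni_inv n X = qmor S' (ni_inv (ae_counit E) X).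
(* Destructing [E] lets its double symmetric reduce to [E], after which the claim is the previous
   lemma for the symmetric equivalence. *)
Proof. by rewrite /PP /RR; case: (E) => *; apply: quotient_unit. Qed.

Lemma quotient_equivalence : cat_equivalent (serre_quotient S) (serre_quotient S').
Proof.
have [n _] := quotient_unit E SP SR; have [m _] := quotient_counit.
by exists PP, RR; split; apply: inhabits.
Qed.

(** The left adjoint is conjugated: [PP], then the given left adjoint [L'], then [R]. Its unit and
    counit are those of [L'] corrected by the unit of the equivalence. *)
Lemma colocalizing_transport : colocalizing S' -> colocalizing S.
Proof.
move=> [sS' [L' [adj']]]; split; first exact: (equivalence_serre E SP).
have [n nP] := quotient_unit E SP SR; have [m mP] := quotient_counit.
pose e X := ni_hom (ae_unit E) X; pose e' X := ni_inv (ae_unit E) X.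
pose t X := ni_hom (ae_counit E) X; pose t' X := ni_inv (ae_counit E) X.
pose qe' X : @hom (serre_quotient S) X (RR (PP X)) := qmor S (e' X).
have qe'_nat (X Y : serre_quotient S) (f : hom X Y) :
    heq (cmp (qe' Y) f) (cmp (fmap RR (fmap PP f)) (qe' X)).
  rewrite /qe' -!(nP _).2.
  apply: (@natural_inverse _ _ (functor_cmp RR PP) (functor_id _) (ni_hom n) (ni_inv n)).
    by move=> Z; split; [apply: ni_invl | apply: ni_invr].
  by move=> *; apply: ni_natural.
pose qt X : @hom (serre_quotient S') (PP (RR X)) X := qmor S' (t X).
have qt_nat (X Y : serre_quotient S') (f : hom X Y) :
    heq (cmp (qt Y) (fmap PP (fmap RR f))) (cmp f (qt X)).
  by rewrite /qt -!(mP _).1; apply: (ni_natural m).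
pose L := functor_cmp R (functor_cmp L' PP).
pose u' := adj_unit adj'; pose c' := adj_counit adj'.
pose u (Y : serre_quotient S) : hom Y (quotient_functor S (L Y)) :=
  cmp (fmap RR (u' (PP Y))) (qe' Y).
pose c X : hom (L (quotient_functor S X)) X := cmp (e X) (fmap R (c' (P X))).
exists L; apply: inhabits; apply: (@Adjunction _ _ L (quotient_functor S) u c).
- move=> X Y f; rewrite /u -cmpA qe'_nat cmpA cmpA; apply: heq_cmp => //.
  apply: heq_trans (heq_sym (fmap_cmp RR _ _)) _.
  apply: (heq_trans _ (fmap_cmp RR
    (fmap (quotient_functor S') (fmap L' (fmap PP f))) (u' (PP X)))).
  exact: fmap_heq (adj_unit_natural adj' _).
- move=> X Y f.
  have N : heq (cmp (fmap R (c' (P Y))) (fmap L (fmap (quotient_functor S) f)))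
      (cmp (fmap R (fmap P f)) (fmap R (c' (P X)))).
    apply: heq_trans (heq_sym (fmap_cmp R _ _)) _; apply: (heq_trans _ (fmap_cmp R _ _)).
    exact: fmap_heq (adj_counit_natural adj' (fmap P f)).
  by rewrite /c -cmpA N cmpA (ni_natural (ae_unit E)) cmpA.
- move=> Y; pose Z := L' (PP Y).
  have G1 : heq (cmp (c (L Y)) (fmap L (u Y)))
      (fmap R (cmp (cmp (t Z) (c' (P (R Z)))) (fmap L' (fmap PP (u Y))))).
    apply: heq_sym; apply: heq_trans (fmap_cmp R _ _) _; apply: heq_cmp => //.
    apply: heq_trans (fmap_cmp R _ _) _; apply: heq_cmp => //.
    exact: (ae_tri2 E Z).
  apply: (heq_trans G1); apply: (heq_trans _ (fmap_id R _)); apply: fmap_heq.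
  have G2 : heq (cmp (qt (PP Y)) (fmap PP (qe' Y))) (idm (PP Y)).
    apply: (qeq_trans (qeq_sym (qeq_mor_cmp _ _ _))); apply: qeq_mor.
    by rewrite /t -(ae_tri1 E) -fmap_cmp (ni_invr (ae_unit E)) fmap_id.
  (* Up to the counit of the equivalence, [PP] turns the new unit back into the old one; this
     reduces the left triangle to that of [adj']. *)
  have G3 : heq (cmp (qt Z) (fmap PP (u Y))) (u' (PP Y)).
    apply: heq_trans (heq_cmp (heq_refl _) (fmap_cmp PP (fmap RR (u' (PP Y))) (qe' Y))) _.
    apply: heq_trans (cmpA _ _ _) _.
    apply: heq_trans (heq_cmp (qt_nat _ _ (u' (PP Y))) (heq_refl _)) _.
    apply: heq_trans (heq_sym (cmpA _ _ _)) _.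
    apply: heq_trans (heq_cmp (heq_refl _) G2) _.
    exact: cmp_idr.
  apply: heq_trans (heq_cmp (heq_sym (adj_counit_natural adj' (t Z))) (heq_refl _)) _.
  apply: heq_trans (heq_sym (cmpA _ _ _)) _.
  apply: heq_trans (heq_cmp (heq_refl _) (heq_sym (fmap_cmp L' (qt Z) (fmap PP (u Y))))) _.
  apply: heq_trans (heq_cmp (heq_refl _) (fmap_heq L' G3)) _.
  exact: (adj_triangle_left adj' (PP Y)).
move=> X.
have G1 : heq (cmp (fmap RR (fmap (quotient_functor S') (c' (P X)))) (fmap RR (u' (P X))))
    (idm (RR (P X))).
  apply: heq_trans (heq_sym (fmap_cmp RR _ _)) _.
  apply: heq_trans (fmap_heq RR (adj_triangle_right adj' (P X))) _.
  exact: (fmap_id RR).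
apply: heq_trans (heq_cmp (fmap_cmp (quotient_functor S) (e X) (fmap R (c' (P X))))
  (heq_refl (u X))) _.
apply: heq_trans (heq_sym (cmpA _ _ _)) _.
apply: heq_trans (heq_cmp (heq_refl _) (cmpA _ _ _)) _.
apply: heq_trans (heq_cmp (heq_refl _) (heq_cmp G1 (heq_refl _))) _.
apply: heq_trans (heq_cmp (heq_refl _) (cmp_idl _)) _.
apply: (qeq_trans (qeq_sym (qeq_mor_cmp _ _ _))); apply: qeq_mor.
exact: (ni_invr (ae_unit E)).
Qed.

End QuotientTransport.

Lemma natural_iso_whisker (A B C : category) (G : functor B A) (F : functor A B)
    (K : functor C B) (J : functor B C) :
  natural_iso (functor_cmp G F) (functor_id A) ->
  natural_iso (functor_cmp K J) (functor_id B) ->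
  natural_iso (functor_cmp (functor_cmp G K) (functor_cmp J F)) (functor_id A).
Proof.
move=> n m.
apply: (@NaturalIso _ _ (functor_cmp (functor_cmp G K) (functor_cmp J F)) (functor_id A)
  (fun X => cmp (ni_hom n X) (fmap G (ni_hom m (F X))))
  (fun X => cmp (fmap G (ni_inv m (F X))) (ni_inv n X))) => [X Y f|X|X].
- have N : heq (cmp (fmap G (ni_hom m (F Y))) (fmap G (fmap K (fmap J (fmap F f)))))
      (cmp (fmap G (fmap F f)) (fmap G (ni_hom m (F X)))).
    apply: heq_trans (heq_sym (fmap_cmp G _ _)) _; apply: (heq_trans _ (fmap_cmp G _ _)).
    exact: fmap_heq (ni_natural m (fmap F f)).
  apply: heq_trans (heq_sym (cmpA _ _ _)) _; apply: heq_trans (heq_cmp (heq_refl _) N) _.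
  apply: heq_trans (cmpA _ _ _) _.
  apply: heq_trans (heq_cmp (ni_natural n f) (heq_refl _)) _.
  exact: heq_sym (cmpA _ _ _).
- apply: heq_trans (heq_sym (cmpA _ _ _)) _.
  apply: heq_trans (heq_cmp (heq_refl _) (cmpA _ _ _)) _.
  apply: heq_trans (heq_cmp (heq_refl _) (heq_cmp (ni_invl n X) (heq_refl _))) _.
  apply: heq_trans (heq_cmp (heq_refl _) (cmp_idl _)) _.
  apply: heq_trans (heq_sym (fmap_cmp G _ _)) _.
  apply: heq_trans (fmap_heq G (ni_invl m (F X))) _; exact: fmap_id.
- apply: heq_trans (heq_sym (cmpA _ _ _)) _.
  apply: heq_trans (heq_cmp (heq_refl _) (cmpA _ _ _)) _.
  apply: heq_trans (heq_cmp (heq_refl _) (heq_cmp (heq_sym (fmap_cmp G _ _)) (heq_refl _))) _.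
  apply: heq_trans (heq_cmp (heq_refl _) (heq_cmp (fmap_heq G (ni_invr m (F X))) (heq_refl _))) _.
  apply: heq_trans (heq_cmp (heq_refl _) (heq_cmp (fmap_id G _) (heq_refl _))) _.
  apply: heq_trans (heq_cmp (heq_refl _) (cmp_idl _)) _.
  exact: (ni_invr n X).
Qed.

Lemma cat_equivalent_trans (A B C : category) :
  cat_equivalent A B -> cat_equivalent B C -> cat_equivalent A C.
Proof.
move=> [F [G [[n] [n']]]] [J [K [[m] [m']]]].
exists (functor_cmp J F), (functor_cmp G K).
by split; apply: inhabits; apply: natural_iso_whisker.
Qed.

Lemma adjoint_equivalence_equivalent (A A' : category) (P : functor A A') (R : functor A' A) :
  adjoint_equivalence P R -> cat_equivalent A A'.
Proof.
by move=> E; exists P, R; split; apply: inhabits; [apply: ae_unit E | apply: ae_counit E].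
Qed.

(** * Exactness in categories of vector spaces with structure *)

Section LinearLifts.
Variable k : fieldType.
Implicit Types V W U : lmodType k.

Lemma lift_injective V W U (i : {linear V -> W}) (g : {linear U -> W}) :
  injective i -> (forall x, exists y, i y = g x) ->
  exists u : {linear U -> V}, forall x, i (u x) = g x.
Proof.
move=> iinj ig; have [u uP] := choice ig.
have lu : linear u by move=> a x y; apply: iinj; rewrite linearP !uP linearP.
by exists (linmap lu).
Qed.

Lemma lift_surjective V W U (p : {linear V -> W}) (g : {linear V -> U}) :
  (forall y, exists x, p x = y) -> (forall x, p x = 0 -> g x = 0) ->
  exists u : {linear W -> U}, forall x, u (p x) = g x.
Proof.
move=> psurj pg; have [s ps] := surjective_section psurj.
exists (g \o s : {linear W -> U}) => x /=; apply/eqP; rewrite -subr_eq0 -linearB; apply/eqP.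
by apply: pg; rewrite linearB ps subrr.
Qed.

End LinearLifts.

Section Concrete.
Variables (k : fieldType) (T : Type) (car : T -> lmodType k).
Variable mor : forall X Y, (car X -> car Y) -> Prop.
Hypothesis mor_id : forall X, mor (fun x : car X => x).
Hypothesis mor_cmp : forall X Y Z (g : {linear car Y -> car Z})
  (f : {linear car X -> car Y}), mor g -> mor f -> mor (fun x => g (f x)).
Local Notation CC := (concrete_category mor_id mor_cmp).

Definition is_image_kernel X Y K (i : {linear car K -> car X}) (f : {linear car X -> car Y}) :=
  forall x, f x = 0 <-> exists y, i y = x.

(** What is required for categorical kernels and cokernels to be those of the underlying vector
    spaces. The last two fields say that a linear factorization of a morphism through an injective
    or a surjective morphism is again a morphism. *)
Record abelian_concrete : Prop := AbelianConcrete {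
  ab_mor0 : forall X Y, mor (fun _ : car X => 0 : car Y);
  ab_zero : exists Z, forall x : car Z, x = 0;
  ab_kernel : forall X Y (f : cmor mor X Y), exists K (i : cmor mor K X),
    injective i /\ is_image_kernel i f;
  ab_cokernel : forall X Y (f : cmor mor X Y), exists Q (p : cmor mor Y Q),
    (forall y, exists x, p x = y) /\ is_image_kernel f p;
  ab_lift_inj : forall K X Z (i : cmor mor K X) (u : {linear car Z -> car K}),
    injective i -> mor (fun x => i (u x)) -> mor u;
  ab_lift_surj : forall X Q Z (p : cmor mor X Q) (u : {linear car Q -> car Z}),
    (forall y, exists x, p x = y) -> mor (fun x => u (p x)) -> mor u
}.

Hypothesis ab : abelian_concrete.

Let zero_lin X Y : {linear car X -> car Y} := linmap (fun a x y =>
  esym (etrans (addr0 (a *: (0 : car Y))) (scaler0 (car Y) a)) : (fun _ : car X => 0 : car Y) _ = _).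

Let zero_cmor X Y : cmor mor X Y := @Cmor k T car mor X Y (zero_lin X Y) (ab_mor0 ab X Y).

Lemma trivial_zero_object (Z : CC) : (forall x : car Z, x = 0) -> zero_object Z.
Proof.
move=> Z0 X; split.
  by exists (zero_cmor Z X) => g x /=; rewrite (Z0 x) !linear0.
by exists (zero_cmor X Z) => g x /=; exact: Z0.
Qed.

Lemma zero_object_trivial (Z : CC) : zero_object Z -> forall x : car Z, x = 0.
Proof.
move=> /(_ Z) [[f fP] _] x.
exact: etrans (fP (idm Z) x) (esym (fP (zero_cmor Z Z) x)).
Qed.

Lemma zero_morP (X Y : CC) (f : hom X Y) : zero_mor f <-> forall x, f x = 0.
Proof.
split=> [[Z [g [h [Z0 E]]]] x|f0].
  by have /= -> := E x; rewrite (zero_object_trivial Z0 (g x)) linear0.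
have [Z Z0] := ab_zero ab.
exists Z, (zero_cmor X Z), (zero_cmor Z Y); split; first exact: trivial_zero_object.
by move=> x; rewrite f0.
Qed.

(** The set-theoretic kernel has the universal property ([honest]). An arbitrary kernel is compared
    with it through the two induced morphisms, and injectivity and image are read off from that
    comparison. *)
Lemma is_kernelP (K X Y : CC) (i : hom K X) (f : hom X Y) :
  is_kernel i f <-> injective i /\ is_image_kernel i f.
Proof.
have honest K' (j : hom K' X) : injective j /\ is_image_kernel j f -> is_kernel j f.
  move=> [jinj jP]; split; first by apply/zero_morP => x /=; apply/jP; exists x.
  move=> Z g /zero_morP fg0.
  have [x|u uP] := lift_injective (g := g) jinj; first exact/jP/fg0.
  have mu : mor u.
    apply: (ab_lift_inj ab (i := j)) => //.
    by rewrite (_ : (fun x => j (u x)) = g); [exact: cmorP | exact/funext].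
  exists (@Cmor k T car mor Z K' u mu) => // u' u'P x /=.
  by apply: jinj; rewrite uP; apply: u'P.
split=> [ker|]; last exact: honest.
have [K0 [i0 i0P]] := ab_kernel ab f.
have ker0 := honest K0 i0 i0P; have [i0inj i0K] := i0P.
have [v iv _] := ker0.2 _ i ker.1; have [u iu _] := ker.2 _ i0 ker0.1.
have uv x : u (v x) = x.
  have [w _ wU] := ker.2 _ i ker.1.
  have E1 : u (v x) = w x by apply: (wU (cmp u v)) => y; exact: etrans (iu _) (iv _).
  exact: etrans E1 (esym (wU (idm K) (fun _ => erefl) x)).
split=> [x y ixy|x].
  rewrite -(uv x) -(uv y); congr (u _); apply: i0inj.
  exact: etrans (iv x) (etrans ixy (esym (iv y))).
rewrite i0K; split=> [[y <-]|[y <-]].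
  by exists (u y); apply: iu.
by exists (v y); apply: iv.
Qed.

Lemma is_cokernelP (X Y K : CC) (f : hom X Y) (p : hom Y K) :
  is_cokernel f p <-> (forall y, exists x, p x = y) /\ is_image_kernel f p.
Proof.
have honest K' (q : hom Y K') : (forall y, exists x, q x = y) /\ is_image_kernel f q ->
    is_cokernel f q.
  move=> [qsurj qP]; split; first by apply/zero_morP => x /=; apply/qP; exists x.
  move=> Z g /zero_morP gf0.
  have [x|u uP] := lift_surjective (g := g) qsurj.
    by move/qP => [y <-]; apply: gf0.
  have mu : mor u.
    apply: (ab_lift_surj ab (p := q)) => //.
    by rewrite (_ : (fun x => u (q x)) = g); [exact: cmorP | exact/funext].
  exists (@Cmor k T car mor K' Z u mu) => // u' u'P y /=.
  by have [x <-] := qsurj y; rewrite uP; apply: u'P.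
split=> [coker|]; last exact: honest.
have [Q0 [p0 p0P]] := ab_cokernel ab f.
have coker0 := honest Q0 p0 p0P; have [p0surj p0K] := p0P.
have [v vp _] := coker0.2 _ p coker.1; have [u up _] := coker.2 _ p0 coker0.1.
have vu x : v (u x) = x.
  have [w _ wU] := coker.2 _ p coker.1.
  have E1 : v (u x) = w x.
    apply: (wU (cmp v u)) => y; exact: etrans (congr1 v (up y)) (vp y).
  exact: etrans E1 (esym (wU (idm K) (fun _ => erefl) x)).
split=> [y|x].
  have [x xP] := p0surj (u y); exists x; rewrite -(vu y) -xP.
  exact/esym/vp.
rewrite -p0K; split=> [px|p0x].
  by rewrite -(up x) /= px linear0.
by rewrite -(vp x) /= p0x linear0.
Qed.

Lemma short_exactP (X' X X'' : CC) (f : hom X' X) (g : hom X X'') :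
  short_exact f g <->
  [/\ injective f, forall y, exists x, g x = y & is_image_kernel f g].
Proof.
split=> [[/is_kernelP [finj fg] /is_cokernelP [gsurj _]]|[finj gsurj fg]] //.
by split; [apply/is_kernelP | apply/is_cokernelP].
Qed.

Lemma is_isoP (X Y : CC) (f : hom X Y) :
  (forall u : {linear car Y -> car X}, (forall x, f (u x) = x) -> mor u) ->
  injective f -> (forall y, exists x, f x = y) -> is_iso f.
Proof.
move=> mf finj fsurj.
have [|u uP] := lift_injective (g := idfun) finj; first by move=> x; apply: fsurj.
exists (@Cmor k T car mor Y X u (mf u uP)); split=> x /=; last exact: uP.
by apply: finj; rewrite uP.
Qed.

End Concrete.

Arguments is_image_kernel {k T car X Y K} i f.

(** * Subobjects and quotients of comodules and Hopf modules *)

Section Vect.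
Variable k : fieldType.

Lemma vect_abelian : @abelian_concrete k (lmodType k) id (fun _ _ _ => True).
Proof.
pose mk (V W : lmodType k) (f : {linear V -> W}) :=
  @Cmor k (lmodType k) id (fun _ _ _ => True) V W f I.
split=> //.
- exists (kernel (@idfun k^o : {linear k^o -> k^o})) => x.
  by apply: val_inj; exact: (kernel_inclP x).
- move=> V W f; exists (kernel f), (mk _ _ (kernel_incl f)).
  split=> [|x]; first exact: kernel_incl_inj.
  by split=> [/kernel_incl_onto|[y <-]] //; apply: kernel_inclP.
- move=> V W f; have [S] := splitting_exists (subspace_im f).
  exists (spl_quo S), (mk _ _ (spl_p S)); split=> [y|x]; last exact: spl_pU.
  by exists (spl_s S y); apply: spl_ps.
Qed.

End Vect.

Lemma tassoc_natl (k : fieldType) (U U' V W : lmodType k) (f : {linear U -> U'})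
    (t : (U \ox V) \ox W) :
  tmap f idfun (tassoc t) = tassoc (tmap (tmap f idfun) idfun t).
Proof. by rewrite (tassoc_nat f idfun idfun); apply: eq_tmap => // x; rewrite tmap_id. Qed.

(** * Kernels, cokernels and coflatness for comodules *)

Section Comodules.
Variables (k : fieldType) (C : coalgType k).

(** The restricted map is linear and satisfies the axioms because these can be tested after [i],
    whose injectivity survives tensoring. *)
Lemma sub_coaction (V K : lmodType k) (rho : V -> V \ox C) (i : {linear K -> V}) :
  right_coaction rho -> injective i ->
  (forall x, exists t : K \ox C, tmap i idfun t = rho (i x)) ->
  exists2 rhoK : K -> K \ox C, right_coaction rhoK & rcoact_mor rhoK rho i.
Proof.
move=> [rl rA r1] iinj iP.
have ti_inj (W : lmodType k) : injective (tmap i (@idfun W)).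
  exact: (tmap_injective (g := idfun) iinj (@inj_id W)).
pose rho' := linmap rl.
have [|rK rKP] := lift_injective (i := tmap i idfun) (g := rho' \o i : {linear _ -> _}) (ti_inj C).
  exact: iP.
exists rK => [|m]; last exact/esym/rKP.
split=> [|x|x]; first exact: linearP.
  apply: ti_inj; rewrite tassoc_natl tmap_comp.
  rewrite (eq_tmap (f' := rho' \o i) (g' := idfun \o idfun) rKP) // -[X in tassoc X]tmap_comp.
  by rewrite rKP /= rA -[rho (i x)]rKP !tmap_comp.
apply: iinj; rewrite tlift_linear_map -[RHS]r1 -[rho (i x)]rKP tlift_tmap.
  by apply: eq_tlift => n c; rewrite linearZ.
exact: counit_bilinr.
Qed.

Lemma quotient_coaction (V Q : lmodType k) (rho : V -> V \ox C) (p : {linear V -> Q}) :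
  right_coaction rho -> (forall y, exists x, p x = y) ->
  (forall x, p x = 0 -> tmap p idfun (rho x) = 0) ->
  exists2 rhoQ : Q -> Q \ox C, right_coaction rhoQ & rcoact_mor rho rhoQ p.
Proof.
move=> [rl rA r1] psurj pP; pose rho' := linmap rl.
have [|rQ rQP] := lift_surjective (g := tmap p idfun \o rho' : {linear _ -> _}) psurj.
  exact: pP.
exists rQ => //; split=> [|y|y]; first exact: linearP.
  have [x <-] := psurj y; rewrite rQP /= !tmap_comp.
  rewrite (eq_tmap (f' := tmap p idfun \o rho') (g' := idfun \o idfun) rQP) // -[X in tassoc X]tmap_comp.
  by rewrite tassoc_nat rA tmap_comp; apply: eq_tmap => z //=; rewrite tmap_id.
have [x <-] := psurj y; rewrite rQP /= tlift_tmap; last exact: counit_bilinr.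
rewrite -[in RHS](r1 x) tlift_linear_map.
by apply: eq_tlift => n c; rewrite linearZ.
Qed.

Lemma rcoact_mor_lift_inj (V K Z : lmodType k) (rho : V -> V \ox C) (rhoK : K -> K \ox C)
    (rhoZ : Z -> Z \ox C) (i : {linear K -> V}) (u : {linear Z -> K}) :
  rcoact_mor rhoK rho i -> injective i ->
  rcoact_mor rhoZ rho (fun x => i (u x)) -> rcoact_mor rhoZ rhoK u.
Proof.
move=> mi iinj miu m; apply: (tmap_injective (g := @idfun C) iinj (@inj_id C)).
by rewrite -mi miu tmap_comp.
Qed.

Lemma rcoact_mor_lift_surj (V Q Z : lmodType k) (rho : V -> V \ox C) (rhoQ : Q -> Q \ox C)
    (rhoZ : Z -> Z \ox C) (p : {linear V -> Q}) (u : {linear Q -> Z}) :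
  rcoact_mor rho rhoQ p -> (forall y, exists x, p x = y) ->
  rcoact_mor rho rhoZ (fun x => u (p x)) -> rcoact_mor rhoQ rhoZ u.
Proof.
by move=> mp psurj mup y; have [x <-] := psurj y; rewrite mup mp tmap_comp.
Qed.

Lemma kernel_coaction (V W K : lmodType k) (rho : V -> V \ox C) (rhoW : {linear W -> (W \ox C)%type})
    (f : {linear V -> W}) (i : {linear K -> V}) : rcoact_mor rho rhoW f ->
  is_image_kernel (car := id) i f ->
  forall x, exists t : K \ox C, tmap i idfun t = rho (i x).
Proof.
move=> mf iP x; apply: (tmap_kerl (f := f)); first by move=> y /iP.
have <- := mf (i x); have -> : f (i x) = 0 by apply/iP; exists x.
exact: linear0.
Qed.

Lemma cokernel_coaction (V W Q : lmodType k) (rho : V -> V \ox C) (rhoW : W -> W \ox C)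
    (f : {linear V -> W}) (p : {linear W -> Q}) : rcoact_mor rho rhoW f ->
  is_image_kernel (car := id) f p ->
  forall x, p x = 0 -> tmap p idfun (rhoW x) = 0.
Proof.
move=> mf pP x /pP [y <-]; rewrite mf tmap_comp.
by apply: (tmap0l idfun (f := p \o f : {linear _ -> _})) => z; apply/pP; exists z.
Qed.

Lemma rcomod_abelian : @abelian_concrete k (rcomod C) (@rcomod_car k C)
    (fun M N f => rcoact_mor (@rcoact k C M) (@rcoact k C N) f).
Proof.
have va := vect_abelian k.
split.
- move=> X Y m; rewrite linear0.
  have l0 : linear (fun _ : X => 0 : Y) by move=> a x y; rewrite scaler0 addr0.
  by rewrite (tmap0l idfun (f := linmap l0)).
- have [Z Z0] := ab_zero va.
  have l0 : linear (fun _ : Z => 0 : Z \ox C) by move=> a x y; rewrite scaler0 addr0.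
  have P : right_coaction (linmap l0).
    split=> [|x|x]; [exact: linearP | by rewrite !linear0 | by rewrite [LHS]Z0 [RHS]Z0].
  by exists (Rcomod P).
- move=> X Y f; pose f' := @Cmor k (lmodType k) id (fun _ _ _ => True) X Y f I.
  have [K [i [iinj iP]]] := ab_kernel va f'.
  have [] := sub_coaction (rcomodP X) iinj.
    exact: (kernel_coaction (rhoW := @rcoact k C Y) (f := f') (cmorP f) iP).
  move=> rK rKP mi.
  exists (Rcomod rKP), (@Cmor k _ _ _ (Rcomod rKP) X (cmor_fun i) mi); by split.
- move=> X Y f; pose f' := @Cmor k (lmodType k) id (fun _ _ _ => True) X Y f I.
  have [Q [p [psurj pP]]] := ab_cokernel va f'.
  have [] := quotient_coaction (rcomodP Y) psurj.
    exact: (cokernel_coaction (f := f') (cmorP f) pP).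
  move=> rQ rQP mp.
  exists (Rcomod rQP), (@Cmor k _ _ _ Y (Rcomod rQP) (cmor_fun p) mp); by split.
- by move=> K X Z i u iinj; apply: rcoact_mor_lift_inj (cmorP i) iinj.
- by move=> X Q Z p u psurj; apply: rcoact_mor_lift_surj (cmorP p) psurj.
Qed.

(** The left exact half of the cotensor functor, which holds without coflatness: the defining
    equation can be tested after tensoring with an injective comodule map. *)
Lemma cotensor_reflect (M M' : rcomod_cat C) (N : lcomod_cat C) (j : hom M' M)
    (y : rcomod_car M' \ox lcomod_car N) :
  injective j -> cotensor_pred (tmap j idfun y : rcomod_car M \ox lcomod_car N) ->
  cotensor_pred y.
Proof.
move=> jinj /eqP yP; apply/eqP.
apply: (tmap_injective (g := @idfun (tensor C N)) jinj (@inj_id (tensor C N))).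
rewrite [RHS]tmap_comp.
have -> : tmap (j \o idfun) (idfun \o @lcoact k C N) y = tmap idfun (@lcoact k C N) (tmap j idfun y).
  by rewrite tmap_comp.
rewrite -yP tassoc_natl !tmap_comp.
by congr tassoc; apply: eq_tmap => // x /=; rewrite (cmorP j).
Qed.

(* Coflatness is used only in this form: an element of the cotensor product
   that lifts to the tensor product lifts to the cotensor product. *)
Lemma coflat_lift (N : lcomod_cat C) : left_coflat N ->
  forall (V W : rcomod_cat C) (f : hom V W) (z : rcomod_car V \ox lcomod_car N),
  cotensor_pred (tmap f idfun z : rcomod_car W \ox lcomod_car N) ->
  exists2 x : rcomod_car V \ox lcomod_car N, cotensor_pred x & tmap f idfun x = tmap f idfun z.
Proof.
move=> coflat V W f z zP; have ab := rcomod_abelian.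
have [K [i [iinj iP]]] := ab_kernel ab f.
have [Q [p [psurj pP]]] := ab_cokernel ab i.
(* [f] factors as the surjection [p] followed by an injective comodule map [j]. Exactness is applied
   to the kernel sequence of [p], once the cotensor condition has been reflected along [j]. *)
have [|j jP] := lift_surjective (g := f : {linear V -> W}) psurj.
  by move=> x /pP /iP.
have mj : rcoact_mor (@rcoact k C Q) (@rcoact k C W) j.
  apply: (rcoact_mor_lift_surj (cmorP p) psurj) => m.
  rewrite jP (cmorP f); apply: eq_tmap => // x; exact/esym/jP.
have jinj : injective j.
  move=> x y; have [x' <-] := psurj x; have [y' <-] := psurj y; rewrite !jP => fxy.
  apply/eqP; rewrite -subr_eq0 -linearB; apply/eqP/pP/iP.
  by rewrite linearB fxy subrr.
pose jm : @hom (rcomod_cat C) Q W :=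
  @Cmor k (rcomod C) (@rcomod_car k C)
    (fun M N f => rcoact_mor (@rcoact k C M) (@rcoact k C N) f) Q W j mj.
have E (t : rcomod_car V \ox lcomod_car N) : tmap f idfun t = tmap jm idfun (tmap p idfun t).
  by rewrite tmap_comp; apply: eq_tmap => // x /=; rewrite jP.
have yP : cotensor_pred (tmap p idfun z : rcomod_car Q \ox lcomod_car N).
  by apply: (cotensor_reflect (j := jm)) => //; rewrite -E.
have ex : @short_exact (rcomod_cat C) K V Q i p by apply/(short_exactP ab).
have /(short_exactP (vect_abelian k)) [_ surj _] := coflat _ _ _ _ _ ex.
have [[x xP] /(congr1 (@cotensor_val k C Q N)) /= xE] := surj (Cotensor yP).
by exists x; rewrite // !E xE.
Qed.

End Comodules.

Section Actions.
Variables (k : fieldType) (A : algType k).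

Lemma sub_action (V K : lmodType k) (act : A -> V -> V) (i : {linear K -> V}) :
  left_action act -> injective i -> (forall a x, exists y, i y = act a (i x)) ->
  exists2 actK : A -> K -> K, left_action actK & lact_mor actK act i.
Proof.
move=> [ab a1 aM] iinj iP.
have [[a x]|r rP] := @choice _ _ (fun (ax : A * K) y => i y = act ax.1 (i ax.2)); first exact: iP.
exists (fun a x => r (a, x)) => [|a m]; last exact: rP.
split=> [|m|m a b]; [|by apply: iinj; rewrite rP a1|by apply: iinj; rewrite !rP aM].
apply: bilin_intro => [m|a] b x y; apply: iinj; rewrite linearP !rP /=.
  by rewrite (bilinDl ab) (bilinZl ab).
by rewrite linearP (bilinDr ab) (bilinZr ab).
Qed.

Lemma quotient_action (V Q : lmodType k) (act : A -> V -> V) (p : {linear V -> Q}) :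
  left_action act -> (forall y, exists x, p x = y) ->
  (forall a x, p x = 0 -> p (act a x) = 0) ->
  exists2 actQ : A -> Q -> Q, left_action actQ & lact_mor act actQ p.
Proof.
move=> [ab a1 aM] psurj pP; have [s ps] := surjective_section psurj.
have E a x : p (act a (s (p x))) = p (act a x).
  pose La := linmap (ab.2 a); apply/eqP; rewrite -subr_eq0 -linearB.
  rewrite -[act a x]/(La x) -[act a _]/(La _) -linearB; apply/eqP/pP.
  by rewrite linearB ps subrr.
exists (fun a y => p (act a (s y))) => [|a m /=]; last by rewrite E.
split=> [|y|y a b]; [|by rewrite a1 ps|by rewrite aM E].
by apply: bilin_intro; lin.
Qed.

End Actions.

Lemma tmap2_natr (k : fieldType) (A V W U U' X : lmodType k) (act : A -> V -> V)
    (actW : A -> W -> W) (c : U' -> U -> X) (f : {linear V -> W}) s t :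
  bilinear_map actW -> bilinear_map c -> (forall a v, f (act a v) = actW a (f v)) ->
  tmap f idfun (tmap2 act c s t) = tmap2 actW c s (tmap f idfun t).
Proof.
move=> bW bc fE; rewrite !tmap2_tlift tlift_linear_map; apply: eq_tlift => a u'.
rewrite tlift_linear_map tlift_tmap; last by lin.
by apply: eq_tlift => v u /=; rewrite tmapE /= fE.
Qed.

Section HopfModules.
Variables (k : fieldType) (H : hopfAlgType k) (I : left_ideal_coideal H).
Local Notation C := (factor I).

Lemma Hmod_rcomod_abelian : @abelian_concrete k (Hmod_rcomod I) (@Hr_car k H I)
    (fun M N f => lact_mor (@Hr_act k H I M) (@Hr_act k H I N) f /\
                  rcoact_mor (@Hr_coact k H I M) (@Hr_coact k H I N) f).
Proof.
have va := vect_abelian k; have ra := rcomod_abelian C.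
have cb := factor_act_bilin I.
split.
- by move=> X Y; split; [move=> a m; rewrite (bilin0r (lact_bilin (Hr_actP Y)))
    | exact: (ab_mor0 ra (Rcomod (Hr_coactP X)) (Rcomod (Hr_coactP Y)))].
- have [Z Z0] := ab_zero ra.
  have l0 : bilinear_map (fun (_ : H) (_ : Z) => 0 : Z).
    by split=> ? a x y; rewrite scaler0 addr0.
  have P : left_action (fun (_ : H) (_ : Z) => 0 : Z) by split=> // m; rewrite [RHS]Z0.
  have Q (h : H) (m : Z) : rcoact (0 : Z) = tmap2 (fun _ _ => 0) (@factor_act k H I) (comul h) (rcoact m).
    rewrite linear0 /tmap2 /tlift big1 // => p _.
    by rewrite /tmap /tlift big1 // => q _; rewrite tens0l.
  by exists (HmodRcomod P (rcomodP Z) Q).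
- move=> X Y f.
  pose f' := @Cmor k (rcomod C) (@rcomod_car k C) (fun M N f =>
    rcoact_mor (@rcoact k C M) (@rcoact k C N) f) (Rcomod (Hr_coactP X))
    (Rcomod (Hr_coactP Y)) (cmor_fun f) (cmorP f).2.
  have [K [i [iinj iP]]] := ab_kernel ra f'.
  have [a x|aK aKP ia] := sub_action (Hr_actP X) iinj.
    by apply/iP; rewrite /= (cmorP f).1 (_ : cmor_fun f _ = 0) ?(bilin0r (lact_bilin (Hr_actP Y))) //; apply/iP; exists x.
  have Q (h : H) (m : K) : rcoact (aK h m) = tmap2 aK (@factor_act k H I) (comul h) (rcoact m).
    apply: (tmap_injective (g := @idfun C) iinj (@inj_id C)).
    have ir : Hr_coact (i m) = tmap i idfun (rcoact m) := cmorP i m.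
    rewrite -[LHS](cmorP i) ia [LHS]Hr_compat ir (tmap2_natr _ _ _ _ ia) //.
    exact: lact_bilin (Hr_actP X).
  exists (HmodRcomod aKP (rcomodP K) Q), (@Cmor k _ _ _ (HmodRcomod aKP (rcomodP K) Q) X
    (cmor_fun i) (conj ia (cmorP i))); by split.
- move=> X Y f.
  pose f' := @Cmor k (rcomod C) (@rcomod_car k C) (fun M N f =>
    rcoact_mor (@rcoact k C M) (@rcoact k C N) f) (Rcomod (Hr_coactP X))
    (Rcomod (Hr_coactP Y)) (cmor_fun f) (cmorP f).2.
  have [K [p [psurj pP]]] := ab_cokernel ra f'.
  have [a x /pP [y <-]|aK aKP pa] := quotient_action (Hr_actP Y) psurj.
    by rewrite /= -(cmorP f).1; apply/pP; exists (Hr_act a y).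
  have Q (h : H) (m : K) : rcoact (aK h m) = tmap2 aK (@factor_act k H I) (comul h) (rcoact m).
    have [x <-] := psurj m; rewrite -pa !(cmorP p) [X in tmap _ _ X]Hr_compat.
    by apply: tmap2_natr => //; apply: lact_bilin aKP.
  exists (HmodRcomod aKP (rcomodP K) Q), (@Cmor k _ _ _ Y (HmodRcomod aKP (rcomodP K) Q)
    (cmor_fun p) (conj pa (cmorP p))); by split.
- move=> K X Z i u iinj [mi1 mi2]; split.
    by move=> a m; apply: iinj; rewrite mi1 (cmorP i).1.
  exact: rcoact_mor_lift_inj (cmorP i).2 iinj mi2.
- move=> X Q Z p u psurj [mp1 mp2]; split.
    by move=> a y; have [x <-] := psurj y; rewrite -(cmorP p).1 mp1.
  exact: rcoact_mor_lift_surj (cmorP p).2 psurj mp2.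
Qed.

Definition Hmod_forget (M : Hmod_rcomod_cat I) : rcomod_cat C := Rcomod (@Hr_coactP k H I M).

Definition Hmod_forget_mor (M N : Hmod_rcomod_cat I) (f : hom M N) :
    hom (Hmod_forget M) (Hmod_forget N) :=
  @Cmor k (rcomod C) (@rcomod_car k C) (fun M N f => rcoact_mor (@rcoact k C M) (@rcoact k C N) f)
    (Hmod_forget M) (Hmod_forget N) (cmor_fun f) (cmorP f).2.

Lemma Hmod_forget_exact (X' X X'' : Hmod_rcomod_cat I) (f : hom X' X) (g : hom X X'') :
  short_exact f g -> short_exact (Hmod_forget_mor f) (Hmod_forget_mor g).
Proof.
move=> /(short_exactP Hmod_rcomod_abelian) [finj gsurj fg].
exact/(short_exactP (rcomod_abelian C)).
Qed.

End HopfModules.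

Section PushCoaction.
Variables (k : fieldType) (C D : coalgType k) (f : {linear C -> D}).
Hypotheses (fE : forall c, comul (f c) = tmap f f (comul c)) (f_counit : forall c, counit (f c) = counit c).
Variables (M : lmodType k) (rho : M -> M \ox C).

Lemma push_coaction : right_coaction rho -> right_coaction (fun m => tmap idfun f (rho m)).
Proof.
move=> rhoP; have lr : lin rho := rcoact_linear rhoP.
split=> [|m|m]; first by lin.
  have -> : tmap (fun m => tmap idfun f (rho m)) idfun (tmap idfun f (rho m)) =
      tmap (tmap idfun f) f (tmap (linmap lr) idfun (rho m)).
    rewrite [LHS](@tmap_comp _ _ _ _ _ _ _ idfun f (tmap idfun f \o linmap lr) idfun) [RHS]tmap_comp.
    exact: eq_tmap.
  rewrite tassoc_nat [tassoc _](rcoactA rhoP) !tmap_comp.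
  by apply: eq_tmap => // c /=; rewrite fE.
rewrite tlift_tmap; last by lin.
by rewrite -[RHS](rcoact1 rhoP); apply: eq_tlift => n c; rewrite f_counit.
Qed.

End PushCoaction.

(** * Cotensor products with H and coinvariants *)

Section FactorModule.
Variables (k : fieldType) (H : hopfAlgType k) (I : left_ideal_coideal H).
Local Notation C := (factor I).
Local Notation pi := (@factor_pi k H I).
Local Notation "h *c c" := (@factor_act k H I h c) (at level 40).

Let cb := factor_act_bilin I.

Lemma factor_act1 c : 1 *c c = c.
Proof. by elim/factor_ind: c => x; rewrite factor_actE mul1r. Qed.

Lemma factor_actM g h c : (g * h) *c c = g *c (h *c c).
Proof. by elim/factor_ind: c => x; rewrite !factor_actE mulrA. Qed.

Lemma factor_act_one h : h *c (one_factor I) = pi h.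
Proof. by rewrite factor_actE mulr1. Qed.

Lemma factor_left_action : left_action (@factor_act k H I).
Proof. by split; [exact: cb | exact: factor_act1 | move=> *; apply: factor_actM]. Qed.

Lemma comul_factor_pi (W : lmodType k) (F : C -> C -> W) x : bilinear_map F ->
  tlift F (comul (pi x : C)) = tlift (fun a b => F (pi a) (pi b)) (comul x).
Proof. by move=> bF; rewrite -[comul _]/(factor_comul _) factor_comulE tlift_tmap. Qed.

Lemma comul_factor_act (W : lmodType k) (F : C -> C -> W) h c : bilinear_map F ->
  tlift F (comul (h *c c : C)) =
  tlift (fun a b => tlift (fun c1 c2 => F (a *c c1) (b *c c2)) (comul c)) (comul h).
Proof.
move=> bF; elim/factor_ind: c => x; rewrite factor_actE comul_factor_pi //.
rewrite comulM_tlift; last by lin.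
apply: eq_tlift => a b; rewrite comul_factor_pi; last by lin.
by apply: eq_tlift => u v; rewrite !factor_actE.
Qed.

Lemma counit_factor_act h (c : C) : counit (h *c c : C) = counit h * counit c.
Proof.
elim/factor_ind: c => x; rewrite factor_actE -[LHS]/(factor_counit _) factor_counitE counitM.
by rewrite -[counit (pi x)]/(factor_counit _) factor_counitE.
Qed.

Lemma comul_one_factor : comul (one_factor I) = one_factor I \ox one_factor I.
Proof. by rewrite -[LHS]/(factor_comul _) factor_comulE comul1 tmapE. Qed.

Lemma counit_one_factor : counit (one_factor I) = 1.
Proof. by rewrite -[LHS]/(factor_counit _) factor_counitE counit1. Qed.

Lemma factor_compat h (c : C) :
  comul (h *c c : C) = tmap2 (@factor_act k H I) (@factor_act k H I) (comul h) (comul c).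
Proof.
rewrite tmap2_tlift -[LHS]tlift_tens comul_factor_act //; last by lin.
Qed.

Lemma factor_right_coaction : right_coaction (@comul k C).
Proof. by split; [exact: comul_linear | exact: comulA | exact: counitr]. Qed.

Definition factor_Hmod : Hmod_rcomod_cat I :=
  HmodRcomod factor_left_action factor_right_coaction factor_compat.

Definition cotensor_elt (V : rcomod_cat C) (y : rcomod_car V \ox H) : Prop :=
  cotensor_pred (N := H_lcomod I) y.

Lemma cotensor_eltP (V : rcomod_cat C) (y : rcomod_car V \ox H) :
  cotensor_elt y <->
  tlift (fun v h => tlift (fun v0 c => v0 \ox (c \ox h)) (rcoact v)) y =
  tlift (fun v h => tlift (fun h1 h2 => v \ox (pi h1 \ox h2)) (comul h)) y.
Proof.
have l : lin (@rcoact k C V) by lin.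
rewrite /cotensor_elt /cotensor_pred tassoc_tlift // tmap_idl_tlift /=.
have -> : tlift (fun u h => tlift (fun c h => u \ox (c \ox h)) (tmap pi idfun (comul h))) y =
   tlift (fun v h => tlift (fun h1 h2 => v \ox (pi h1 \ox h2)) (comul h)) y.
  by apply: eq_tlift => v h; rewrite tlift_tmap //; lin.
by split=> [/eqP|->].
Qed.

(** The form in which the cotensor condition enters Sweedler computations: the coaction of V is
    traded for the comultiplication of H. *)
Lemma cotensor_sum (V : rcomod_cat C) (y : rcomod_car V \ox H) (W : lmodType k)
    (F : rcomod_car V -> C -> H -> W) : cotensor_elt y -> trilin F ->
  tlift (fun v h => tlift (fun v0 c => F v0 c h) (rcoact v)) y =
  tlift (fun v h => tlift (fun h1 h2 => F v (pi h1) h2) (comul h)) y.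
Proof.
move=> /eqP E tF; have [F1 F2 F3] := tF.
rewrite (tlift_coassoc (d := @rcoact k C V) (e := @lcoact k C (H_lcomod I)) E tF).
apply: eq_tlift => v h; rewrite /= tlift_tmap //.
by split=> *; [apply: F2 | apply: F3].
Qed.

Lemma cotensor_elt_map (V W : rcomod_cat C) (f : hom V W) (y : rcomod_car V \ox H) :
  cotensor_elt y -> cotensor_elt (tmap f idfun y : rcomod_car W \ox H).
Proof.
move=> yP.
exact: (@cotensor_map_subproof k C V W (H_lcomod I) (H_lcomod I) f (idm (H_lcomod I)) (Cotensor yP)).
Qed.

Definition coinvariant (V : rcomod_cat C) (v : rcomod_car V) :=
  rcoact v = v \ox one_factor I.

Lemma coinvariant_cotensor (V : rcomod_cat C) (v : rcomod_car V) :
  coinvariant v -> cotensor_elt (v \ox 1).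
Proof.
rewrite /coinvariant => vP; apply/eqP; rewrite tmapE /= vP tassocE tmapE /= comul1.
by rewrite tmapE.
Qed.

End FactorModule.

(** * Coinvariants of Hopf modules and the twist by the inverse antipode *)

Section Coinvariants.
Variables (k : fieldType) (H : hopfAlgType k) (I : left_ideal_coideal H).
Local Notation C := (factor I).
Local Notation S := (@antipode k H).
Local Notation pi := (@factor_pi k H I).
Local Notation "h *c c" := (@factor_act k H I h c) (at level 40).
Variable S' : H -> H.
Hypotheses (SK : cancel S S') (S'K : cancel S' S).

Let cb := factor_act_bilin I.
Let lS' := inverse_antipode_lin SK S'K.

Section HopfModule.
Variable M : Hmod_rcomod_cat I.
Local Notation "h *a m" := (@Hr_act k H I M h m) (at level 40).
Let rho := @Hr_coact k H I M.
Let ab : bilinear_map (@Hr_act k H I M) := lact_bilin (Hr_actP M).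
Let lrho : lin rho := rcoact_linear (Hr_coactP M).

Lemma Hr_coact_act (W : lmodType k) (F : Hr_car M -> C -> W) h m : bilinear_map F ->
  tlift F (rho (h *a m)) =
  tlift (fun a b => tlift (fun m0 c => F (a *a m0) (b *c c)) (rho m)) (comul h).
Proof.
move=> bF; rewrite /rho Hr_compat tmap2_tlift tlift_tlift //; apply: eq_tlift => a b.
by rewrite tlift_tlift //; apply: eq_tlift => m0 c; rewrite tliftE.
Qed.

(** A map from M []_C H to M^{co C} sending m (x) 1 to m. It transfers lifting along morphisms from
    cotensor products to coinvariants. *)
Definition twist (y : Hr_car M \ox H) : Hr_car M := tlift (fun m h => S' h *a m) y.

(** Since [S'] reverses the comultiplication, the left side involves S' h2 m0 (x) S' h1 m1 (x) h3.
    The cotensor condition turns this into S' h3 m (x) S' h2 pi(h1) (x) h4, and S' h2 h1 cancels to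
    leave 1_C. The last argument of [B] carries the spare factor of H: one application puts the
    counit there, the other keeps it. *)
Lemma twist_coinvariant_sum (W : lmodType k) (B : Hr_car M -> C -> H -> W)
    (y : Hr_car M \ox H) : trilin B -> cotensor_elt (V := Hmod_forget M) y ->
  tlift (fun m h => tlift (fun h1 h2 => tlift (fun n c => B n c h2) (rho (S' h1 *a m))) (comul h)) y =
  tlift (fun m h => tlift (fun h1 h2 => B (S' h1 *a m) (one_factor I) h2) (comul h)) y.
Proof.
move=> tB yP.
pose F (m : Hr_car M) (c : C) (h : H) := tlift (fun h1 h2 =>
  tlift (fun a b => B (S' b *a m) (S' a *c c) h2) (comul h1)) (comul h).
have tF : trilin F by rewrite /F; lin.
transitivity (tlift (fun m h => tlift (fun m0 c => F m0 c h) (rho m)) y).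
  apply: eq_tlift => m h; rewrite [RHS]tlift_exchange; apply: eq_tlift => h1 h2.
  rewrite Hr_coact_act; last by lin.
  rewrite (comul_inverse_antipode SK S'K (f := fun a b => tlift (fun m0 c => B (a *a m0) (b *c c) h2) (rho m)));
    last by lin.
  by rewrite tlift_exchange.
rewrite (cotensor_sum yP tF); apply: eq_tlift => m h.
rewrite /F -(@comul_coassoc _ _ _ (fun h1 z1 z2 =>
  tlift (fun a b => B (S' b *a m) (S' a *c pi h1) z2) (comul z1))); last by lin.
apply: eq_tlift => w z2.
rewrite -(@comul_coassoc _ _ _ (fun x a b => B (S' b *a m) (S' a *c pi x) z2)); last by lin.
under eq_tlift => v b.
  under eq_tlift do rewrite factor_actE.
  rewrite (tlift_inverse_antipodel SK S'K (f := fun z => B (S' b *a m) (pi z) z2)); last by lin.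
  over.
by rewrite (tlift_counitl (f := fun b => B (S' b *a m) (pi 1) z2)); last by lin.
Qed.

Lemma twist_coinvariant (y : Hr_car M \ox H) :
  cotensor_elt (V := Hmod_forget M) y -> coinvariant (V := Hmod_forget M) (twist y).
Proof.
move=> yP; rewrite /coinvariant /= /twist.
have tB : trilin (fun (n : Hr_car M) (c : C) (h : H) => counit h *: (n \ox c)) by lin.
have := twist_coinvariant_sum tB yP.
under eq_tlift => m h.
  under eq_tlift => h1 h2.
    rewrite -(tlift_lin (g := fun z => counit h2 *: z)); last by lin.
    rewrite tlift_tens.
    over.
  rewrite (tlift_counitr (f := fun h1 => rho (S' h1 *a m))); last by lin.
  over.
rewrite -(tlift_lin (g := rho)) // => E; rewrite -[LHS]/(rho _) E.
rewrite (tlift_lin (g := fun z => z \ox one_factor I)); last by lin.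
apply: eq_tlift => m h.
by rewrite (tlift_counitr (f := fun h1 => (S' h1 *a m) \ox one_factor I)); last by lin.
Qed.

(** The map [xi], m (x) h |-> S' h1 m (x) h2, sends the cotensor product into the kernel of the
    coinvariance defect tensored with H. Without coinvariants the defect is injective, hence
    [xi y = 0]; and [xi] is undone by [psi], m (x) h |-> h1 m (x) h2. *)
Lemma no_coinvariant_cotensor (y : Hr_car M \ox H) :
  (forall m : Hr_car M, coinvariant (V := Hmod_forget M) m -> m = 0) ->
  cotensor_elt (V := Hmod_forget M) y -> y = 0.
Proof.
move=> M0 yP.
pose xi (y : Hr_car M \ox H) := tlift (fun m h => tlift (fun h1 h2 => (S' h1 *a m) \ox h2) (comul h)) y.
have ld : lin (fun m => rho m - m \ox one_factor I) by lin.
have dinj : injective (linmap ld).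
  move=> u v /= /eqP; rewrite -subr_eq0 -[_ - _ - _](linearB (linmap ld)) /= subr_eq0 => /eqP uv.
  by apply/eqP; rewrite -subr_eq0; apply/eqP/M0.
have xi0 : xi y = 0.
  apply: (tmap_injective (g := @idfun H) dinj (@inj_id H)); rewrite linear0.
  rewrite /xi tmap_tlift.
  under eq_tlift => m h.
    rewrite tmap_tlift.
    under eq_tlift => h1 h2 do rewrite tmapE /= tensDl -scaleN1r tensZl scaleN1r.
    over.
  have tB : trilin (fun (n : Hr_car M) (c : C) (h : H) => n \ox c \ox h) by lin.
  have := twist_coinvariant_sum tB yP.
  under eq_tlift => m h.
    under eq_tlift => h1 h2.
      rewrite -(tlift_lin (g := fun z => z \ox h2)); last by lin.
      rewrite tlift_tens.
      over.
    over.
  move=> E; rewrite /tlift in E *.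
  under eq_bigr do rewrite big_split /= sumrN.
  by rewrite big_split /= E sumrN subrr.
pose psi z := tlift (fun m h => tlift (fun u v => (u *a m) \ox v) (comul h)) z.
have bpsi : bilinear_map (fun m h => tlift (fun u v => (u *a m) \ox v) (comul h)) by lin.
suff <- : psi (xi y) = y by rewrite xi0; exact: (tlift0 bpsi).
rewrite /psi /xi tlift_tlift // -[RHS]tlift_tens; apply: eq_tlift => m h.
rewrite tlift_tlift //.
under eq_tlift => h1 h2.
  rewrite tliftE //.
  under eq_tlift do rewrite -(lactM (Hr_actP M)).
  over.
rewrite -(@comul_coassoc _ _ _ (fun h1 u v => ((u * S' h1) *a m) \ox v)); last by lin.
under eq_tlift => w v.
  rewrite (tlift_inverse_antipoder SK S'K (f := fun z => (z *a m) \ox v)); last by lin.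
  over.
by rewrite (tlift_counitl (f := fun v => (1 *a m) \ox v)) ?(lact1 (Hr_actP M)) //; lin.
Qed.

End HopfModule.

(** The element (f m) (x) 1 lies in N []_C H and lifts to M (x) H, so by coflatness it lifts to M
    []_C H. Twisting the lift gives a coinvariant, and [f] commutes with the twist, which sends (f
    m) (x) 1 to f m. *)
Lemma coinvariant_lift (M N : Hmod_rcomod_cat I) (f : hom M N) (m : Hr_car M) :
  left_coflat (H_lcomod I) -> coinvariant (V := Hmod_forget N) (f m) ->
  exists2 m' : Hr_car M, coinvariant (V := Hmod_forget M) m' & f m' = f m.
Proof.
move=> coflat fm.
have [|y yP yE] := @coflat_lift _ _ _ coflat _ _ (Hmod_forget_mor f) (m \ox 1).
  by rewrite tmapE; apply: coinvariant_cotensor.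
exists (twist y); first exact: twist_coinvariant.
have bM := lact_bilin (Hr_actP M); have bN := lact_bilin (Hr_actP N).
have E (z : Hr_car M \ox H) : f (twist z) = twist (M := N) (tmap f idfun z).
  rewrite /twist tlift_linear_map tlift_tmap; last by lin.
  by apply: eq_tlift => u h /=; rewrite (cmorP f).1.
rewrite E [tmap _ _ _]yE -[tmap _ _ _]/(tmap f idfun (m \ox 1)) tmapE /twist tliftE; last by lin.
by rewrite (inverse_antipode1 SK) (lact1 (Hr_actP N)).
Qed.

(** * The Hopf module H (x) V of a comodule V *)

Section FreeHopfModule.
Variable V : rcomod_cat C.
Let rho := @rcoact k C V.
Let F : lmodType k := tensor H (rcomod_car V).

Definition free_act (g : H) (x : F) : F := tlift (fun h v => (g * h) \ox v) x.

Definition free_coact (x : F) : F \ox C := tlift (fun h v =>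
  tlift (fun h1 h2 => tlift (fun v0 c => (h1 \ox v0) \ox (h2 *c c)) (rho v)) (comul h)) x.

Let lrho : lin rho. Proof. by rewrite /rho; lin. Qed.

Lemma free_act_bilin : bilinear_map free_act.
Proof. by rewrite /free_act; lin. Qed.

Lemma free_coact_lin : lin free_coact.
Proof. by rewrite /free_coact; lin. Qed.

Lemma free_actE g h v : free_act g (h \ox v) = (g * h) \ox v.
Proof. by rewrite /free_act tliftE //; lin. Qed.

Lemma free_coactE (W : lmodType k) (G : F -> C -> W) h v : bilinear_map G ->
  tlift G (free_coact (h \ox v)) =
  tlift (fun h1 h2 => tlift (fun v0 c => G (h1 \ox v0) (h2 *c c)) (rho v)) (comul h).
Proof.
move=> bG; rewrite /free_coact tliftE; last by lin.
rewrite tlift_tlift //; apply: eq_tlift => h1 h2.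
by rewrite tlift_tlift //; apply: eq_tlift => v0 c; rewrite tliftE.
Qed.

Lemma free_left_action : left_action free_act.
Proof.
have ab := free_act_bilin.
split=> // [m|m g h]; move: m; apply: tens_lin_ext; [lin|lin| |lin|lin|] => u v.
  by rewrite free_actE mul1r.
by rewrite !free_actE mulrA.
Qed.

Lemma rcoact_coassoc (W : lmodType k) (G : rcomod_car V -> C -> C -> W) v : trilin G ->
  tlift (fun v0 c => tlift (fun u c' => G u c' c) (rho v0)) (rho v) =
  tlift (fun v0 c => tlift (fun c1 c2 => G v0 c1 c2) (comul c)) (rho v).
Proof.
exact: (tlift_coassoc (d := @rcoact k C V) (e := @comul k C) (rcoactA (rcomodP V) v)).
Qed.

Lemma free_right_coaction : right_coaction free_coact.
Proof.
have lF := free_coact_lin.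
split=> [|x|x]; first exact: lF.
  rewrite tassoc_tlift // tmap_idl_tlift; move: x; apply: tens_lin_ext; [lin|lin|] => h v.
  rewrite free_coactE; last by lin.
  rewrite free_coactE; last by lin.
  transitivity (tlift (fun h1 h2 => tlift (fun a b => tlift (fun v0 c => tlift (fun u c' =>
    (a \ox u) \ox (b *c c' \ox (h2 *c c))) (rho v0)) (rho v)) (comul h1)) (comul h)).
    apply: eq_tlift => h1 h2; rewrite [RHS]tlift_exchange; apply: eq_tlift => v0 c.
    by rewrite free_coactE; last by lin.
  rewrite comul_coassoc; last by lin.
  apply: eq_tlift => a h2.
  transitivity (tlift (fun v0 c => tlift (fun b d => tlift (fun c1 c2 =>
    (a \ox v0) \ox (b *c c1 \ox (d *c c2))) (comul c)) (comul h2)) (rho v)).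
    rewrite [RHS]tlift_exchange; apply: eq_tlift => b d.
    by rewrite (@rcoact_coassoc _ (fun u c' c => (a \ox u) \ox (b *c c' \ox (d *c c)))); last by lin.
  apply: eq_tlift => v0 c.
  by rewrite comul_factor_act; last by lin.
have bC : bilinear_map (fun (n : F) (c : C) => counit c *: n) by lin.
move: x; apply: tens_lin_ext; [lin|lin|] => h v.
rewrite free_coactE //.
under eq_tlift => h1 h2.
  under eq_tlift do rewrite counit_factor_act -scalerA.
  rewrite -(tlift_lin (g := fun z => counit h2 *: z)); last by lin.
  under eq_tlift do rewrite -tensZr.
  rewrite -(tlift_lin (g := fun z => h1 \ox z)); last by lin.
  rewrite (rcoact1 (rcomodP V)).
  over.
by rewrite (tlift_counitr (f := fun h1 => h1 \ox v)); last by lin.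
Qed.

Lemma free_compat h x :
  free_coact (free_act h x) = tmap2 free_act (@factor_act k H I) (comul h) (free_coact x).
Proof.
have lF := free_coact_lin; have ab := free_act_bilin.
rewrite tmap2_tlift; move: x; apply: tens_lin_ext; [lin|lin|] => g v.
rewrite free_actE -[LHS]tlift_tens free_coactE; last by lin.
rewrite comulM_tlift; last by lin.
apply: eq_tlift => a b; rewrite free_coactE; last by lin.
apply: eq_tlift => g1 g2; apply: eq_tlift => v0 c.
by rewrite free_actE factor_actM.
Qed.

Definition free_Hmod : Hmod_rcomod_cat I :=
  HmodRcomod free_left_action free_right_coaction free_compat.

Definition free_unit_fun (v : rcomod_car V) : F := 1 \ox v.

Lemma free_unit_linear : linear free_unit_fun.
Proof. by rewrite /free_unit_fun; lin. Qed.

Lemma free_unit_rcoact_mor : rcoact_mor rho free_coact (linmap free_unit_linear).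
Proof.
move=> v; rewrite -[LHS]tlift_tens /= /free_unit_fun free_coactE; last by lin.
rewrite comul1 tliftE; last by lin.
by rewrite tlift_eq_tmap; apply: eq_tlift => v0 c; rewrite factor_act1.
Qed.

Definition free_unit : hom V (Hmod_forget free_Hmod) :=
  @Cmor k (rcomod C) (@rcomod_car k C) (fun M N f => rcoact_mor (@rcoact k C M) (@rcoact k C N) f)
    V (Hmod_forget free_Hmod) (linmap free_unit_linear) free_unit_rcoact_mor.

Lemma free_unit_injective : injective free_unit.
Proof.
have b : bilinear_map (fun (h : H) (v : rcomod_car V) => counit h *: v) by lin.
move=> u v /= /(congr1 (tlift (fun h v => counit h *: v))).
by rewrite !tliftE // counit1 !scale1r.
Qed.

(** Consider [L], which sends (h (x) v) (x) c to v (x) S h2 c (x) S h1. On the coaction of h (x) v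
    the product S h2 h3 cancels and the coaction of v remains; on x (x) 1_C it yields the
    comultiplication of S h. Coinvariance of x says that the two arguments of [L] agree. *)
Lemma free_coinvariant_cotensor (x : F) :
  coinvariant (V := Hmod_forget free_Hmod) x ->
  cotensor_elt (tlift (fun h v => v \ox S h) x : rcomod_car V \ox H).
Proof.
move=> xP.
have bsw : bilinear_map (fun (h : H) (v : rcomod_car V) => v \ox S h) by lin.
apply/cotensor_eltP; rewrite tlift_tlift; last by lin.
rewrite [RHS]tlift_tlift; last by lin.
under eq_tlift => h v do [rewrite tliftE; last by lin].
under [RHS]eq_tlift => h v do [rewrite tliftE; last by lin].
pose L (z : F) (c : C) := tlift (fun h v =>
  tlift (fun h1 h2 => v \ox (S h2 *c c \ox S h1)) (comul h)) z.
have bL : bilinear_map L by rewrite /L; lin.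
have E : tlift L (free_coact x) = L x (one_factor I) by rewrite [free_coact x]xP tliftE.
transitivity (tlift L (free_coact x)); last first.
  rewrite E /L; apply: eq_tlift => h v.
  rewrite comul_antipode; last by lin.
  by apply: eq_tlift => h1 h2; rewrite factor_act_one.
have lF := free_coact_lin.
move: {xP E} x; apply: tens_lin_ext; [lin|lin|] => h v.
rewrite tliftE; last by lin.
rewrite free_coactE // /L.
under [RHS]eq_tlift => h1 h2.
  under eq_tlift => v0 c do [rewrite tliftE; last by lin].
  rewrite tlift_exchange.
  over.
rewrite comul_coassoc; last by lin.
under [RHS]eq_tlift => a z.
  rewrite tlift_exchange.
  under eq_tlift => v0 c.
    under eq_tlift do rewrite -factor_actM.
    rewrite (tlift_antipodel (f := fun w => v0 \ox (w *c c \ox S a))); last by lin.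
    rewrite factor_act1.
    over.
  rewrite -(tlift_lin (g := fun w => counit z *: w)); last by lin.
  over.
by rewrite (tlift_counitr (f := fun a => tlift (fun v0 c => v0 \ox (c \ox S a)) (rho v))) //; lin.
Qed.

End FreeHopfModule.

End Coinvariants.

(** * The torsion subcategory is the kernel of the cotensor functor *)

Section ProductComodule.
Variables (k : fieldType) (C : coalgType k) (V W : rcomod C).

Lemma pair_inl_linear : linear (fun v : V => (v, 0) : V * W).
Proof. by move=> a x y; congr pair; rewrite /= scaler0 addr0. Qed.

Lemma pair_inr_linear : linear (fun w : W => (0, w) : V * W).
Proof. by move=> a x y; congr pair; rewrite /= scaler0 addr0. Qed.

Definition prod_inl : {linear V -> (V * W)%type} := linmap pair_inl_linear.
Definition prod_inr : {linear W -> (V * W)%type} := linmap pair_inr_linear.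
Local Notation inl := prod_inl.
Local Notation inr := prod_inr.

(** Direct sums serve to add coefficients of two torsion comodules. *)
Definition prod_coact (x : V * W) : (V * W)%type \ox C :=
  tmap inl idfun (rcoact x.1) + tmap inr idfun (rcoact x.2).

Lemma prod_coact_linear : linear prod_coact.
Proof. by change (lin prod_coact); rewrite /prod_coact; lin. Qed.

Lemma prod_coact_inl v : prod_coact (inl v) = tmap inl idfun (rcoact v).
Proof. by rewrite /prod_coact -[(inl v).1]/v -[(inl v).2]/(0 : W) !linear0 addr0. Qed.

Lemma prod_coact_inr w : prod_coact (inr w) = tmap inr idfun (rcoact w).
Proof. by rewrite /prod_coact -[(inr w).1]/(0 : V) -[(inr w).2]/w !linear0 add0r. Qed.

Lemma pair_sum (x : V * W) : x = inl x.1 + inr x.2.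
Proof. by case: x => v w; rewrite -[RHS]/(v + 0, 0 + w) addr0 add0r. Qed.

Lemma prod_right_coaction : right_coaction prod_coact.
Proof.
pose rho := linmap prod_coact_linear.
have rinl v : rho (inl v) = tmap inl idfun (rcoact v) := prod_coact_inl v.
have rinr w : rho (inr w) = tmap inr idfun (rcoact w) := prod_coact_inr w.
split; first exact: prod_coact_linear.
  have D (X Y : lmodType k) (f : X -> Y) : lin f -> forall u v, f (u + v) = f u + f v.
    by move=> lf u v; have := lf 1 u v; rewrite !scale1r.
  have lL : lin (fun x => tassoc (tmap rho idfun (rho x))) by lin.
  have lR : lin (fun x => tmap idfun (@comul k C) (rho x)) by lin.
  move=> x; rewrite [x]pair_sum.
  apply: etrans (D _ _ _ lL _ _) _; apply: (etrans _ (esym (D _ _ _ lR _ _))).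
  congr (_ + _).
    rewrite rinl !tmap_comp.
    rewrite (eq_tmap (f' := tmap inl idfun \o @rcoact k C V) (g' := idfun \o idfun) rinl) //.
    by rewrite -[X in tassoc X]tmap_comp -tassoc_natl (rcoactA (rcomodP V)) tmap_comp.
  rewrite rinr !tmap_comp.
  rewrite (eq_tmap (f' := tmap inr idfun \o @rcoact k C W) (g' := idfun \o idfun) rinr) //.
  by rewrite -[X in tassoc X]tmap_comp -tassoc_natl (rcoactA (rcomodP W)) tmap_comp.
have b (U : lmodType k) : bilinear_map (fun (n : U) (c : C) => counit c *: n) by lin.
move=> x; rewrite /prod_coact (tliftD (b _)) !tlift_tmap // [RHS]pair_sum.
rewrite -[in RHS](rcoact1 (rcomodP V) x.1) -[in RHS](rcoact1 (rcomodP W) x.2) !tlift_linear_map.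
by congr (_ + _); apply: eq_tlift => u c; rewrite linearZ.
Qed.

Definition prod_rcomod : rcomod_cat C := Rcomod prod_right_coaction.

Lemma fst_rcoact_mor : rcoact_mor prod_coact (@rcoact k C V) (fst : {linear (V * W)%type -> V}).
Proof.
move=> x; rewrite /prod_coact tmapD !tmap_comp.
rewrite [X in _ + X](@tmap0l _ _ _ _ _ idfun (fst \o inr : {linear _ -> _})) // addr0.
by rewrite -[LHS]tmap_id; apply: eq_tmap.
Qed.

Lemma snd_rcoact_mor : rcoact_mor prod_coact (@rcoact k C W) (snd : {linear (V * W)%type -> W}).
Proof.
move=> x; rewrite /prod_coact tmapD !tmap_comp.
rewrite [X in X + _](@tmap0l _ _ _ _ _ idfun (snd \o inl : {linear _ -> _})) // add0r.
by rewrite -[LHS]tmap_id; apply: eq_tmap.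
Qed.

Lemma tmap_prod_eq0 (U : lmodType k) (y : (V * W)%type \ox U) :
  tmap (fst : {linear (V * W)%type -> V}) idfun y = 0 ->
  tmap (snd : {linear (V * W)%type -> W}) idfun y = 0 -> y = 0.
Proof.
move=> y1 y2.
have -> : y = tmap inl idfun (tmap (fst : {linear (V * W)%type -> V}) idfun y) +
    tmap inr idfun (tmap (snd : {linear (V * W)%type -> W}) idfun y).
  elim/tens_ind: y {y1 y2} => [|x u y IH]; first by rewrite !tmap0 addr0.
  by rewrite !tmapD addrACA -IH !tmapE -tensDl -pair_sum.
by rewrite y1 y2 !linear0 addr0.
Qed.

End ProductComodule.

Arguments prod_inl {k C} V W.
Arguments prod_inr {k C} V W.

(** * The largest proper H-stable subcoalgebra *)

Section Torsion.
Variables (k : fieldType) (H : hopfAlgType k) (I : left_ideal_coideal H).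
Local Notation C := (factor I).
Local Notation S := (@antipode k H).
Local Notation pi := (@factor_pi k H I).
Local Notation one := (one_factor I).
Local Notation "h *c c" := (@factor_act k H I h c) (at level 40).
Variable S' : H -> H.
Hypotheses (SK : cancel S S') (S'K : cancel S' S).
Hypothesis coflat : left_coflat (H_lcomod I).

Let cb := factor_act_bilin I.
Let lS' := inverse_antipode_lin SK S'K.

Lemma one_neq0 : (1 : H) <> 0.
Proof. by apply/eqP; apply: oner_neq0. Qed.

Lemma one_factor_neq0 : one <> 0.
Proof.
move=> /(congr1 (@counit k C)); rewrite counit_one_factor linear0.
by apply/eqP; apply: oner_neq0.
Qed.

Definition cotensor_zero (V : rcomod_cat C) :=
  forall y : rcomod_car V \ox H, cotensor_elt y -> y = 0.

Lemma Hmod_cotensor_zero (M : Hmod_rcomod_cat I) :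
  cotensor_zero (Hmod_forget M) <->
  forall m : Hr_car M, coinvariant (V := Hmod_forget M) m -> m = 0.
Proof.
split=> [M0 m mP|M0 y yP]; last exact: (no_coinvariant_cotensor SK S'K M0 yP).
exact: tens_eq0 (M0 _ (coinvariant_cotensor mP)) one_neq0.
Qed.

(** Coinvariants of H (x) V map to V []_C H by the flip twisted with S, which [S'] undoes;
    conversely v |-> 1 (x) v embeds V into H (x) V as a comodule. *)
Lemma free_cotensor_zero (V : rcomod_cat C) :
  cotensor_zero V <-> cotensor_zero (Hmod_forget (free_Hmod V)).
Proof.
split=> [V0|F0 y yP].
  apply/Hmod_cotensor_zero => x /free_coinvariant_cotensor /V0 x0.
  have : tlift (fun v h => S' h \ox v) (tlift (fun h v => v \ox S h) x) = 0.
    by rewrite x0 tlift0 //; lin.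
  rewrite tlift_tlift; last by lin.
  under eq_tlift => h v.
    rewrite tliftE; last by lin.
    rewrite SK.
    over.
  by rewrite tlift_tens.
apply: (tmap_injective (g := @idfun H) (@free_unit_injective _ _ _ V) (@inj_id H)).
by rewrite tmap0; apply/F0/(cotensor_elt_map (free_unit V)).
Qed.

Definition coefficient (V : rcomod_cat C) (f : {scalar rcomod_car V}) (v : rcomod_car V) : C :=
  tlift (fun u c => f u *: c) (rcoact v).

Definition torsion_coefficients : {pred C} :=
  fun c => `[< exists V, cotensor_zero V /\ exists f v, c = @coefficient V f v >].

Local Notation R := torsion_coefficients.

Lemma torsion_coefficientsP (c : C) :
  c \in R <-> exists V, cotensor_zero V /\ exists f v, c = @coefficient V f v.
Proof. by rewrite unfold_in; split=> /asboolP. Qed.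

Lemma coefficient_lin V (f : {scalar rcomod_car V}) : lin (@coefficient V f).
Proof. by rewrite /coefficient; lin. Qed.

Lemma rcoact_torsion_coefficients (V : rcomod_cat C) (v : rcomod_car V) :
  subspace (fun c => c \in R) -> cotensor_zero V -> tens_in predT R (rcoact v).
Proof.
move=> RS V0; apply: tens_in_functional => // f.
by apply/torsion_coefficientsP; exists V; split=> //; exists f, v.
Qed.

Lemma torsion_coefficients_subspace : subspace (fun c => c \in R).
Proof.
split.
  have [Z Z0] := ab_zero (rcomod_abelian C).
  have l0 : scalar (fun _ : rcomod_car Z => 0 : k) by move=> a x y; rewrite mulr0 addr0.
  apply/torsion_coefficientsP; exists Z; split.
    by move=> y _; rewrite -[y]tmap_id; apply: tmap0l => x; apply: Z0.
  exists (HB.pack (fun _ : rcomod_car Z => 0 : k)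
    (GRing.isLinear.Build k (rcomod_car Z) k *%R _ l0) : {scalar rcomod_car Z}), 0.
  by rewrite /coefficient linear0 tlift0 //; lin.
move=> a c d /torsion_coefficientsP [V [V0 [f [v ->]]]] /torsion_coefficientsP [W [W0 [g [w ->]]]].
apply/torsion_coefficientsP; exists (prod_rcomod V W); split.
  move=> y yP; apply: tmap_prod_eq0.
    apply: V0; exact: (@cotensor_elt_map _ _ _ (prod_rcomod V W) V
      (@Cmor k (rcomod C) (@rcomod_car k C) (fun M N f => rcoact_mor (@rcoact k C M) (@rcoact k C N) f)
      (prod_rcomod V W) V _ (@fst_rcoact_mor _ _ V W)) y yP).
  apply: W0; exact: (@cotensor_elt_map _ _ _ (prod_rcomod V W) W
      (@Cmor k (rcomod C) (@rcomod_car k C) (fun M N f => rcoact_mor (@rcoact k C M) (@rcoact k C N) f)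
      (prod_rcomod V W) W _ (@snd_rcoact_mor _ _ V W)) y yP).
have lfg : scalar (fun x : rcomod_car V * rcomod_car W => f x.1 + g x.2).
  by move=> b x y; rewrite !linearD !linearZ /= mulrDr addrACA.
pose F : {scalar rcomod_car (prod_rcomod V W)} :=
  HB.pack (fun x : rcomod_car V * rcomod_car W => f x.1 + g x.2)
  (GRing.isLinear.Build k (rcomod_car V * rcomod_car W)%type k *%R _ lfg).
exists F, (a *: prod_inl V W v + prod_inr V W w).
have bF : bilinear_map (fun u (c : C) => F u *: c) by lin.
rewrite (coefficient_lin F); congr (a *: _ + _).
  rewrite -[RHS]/(tlift _ (prod_coact _)) prod_coact_inl (tlift_tmap _ _ bF).
  by apply: eq_tlift => u e /=; rewrite linear0 addr0.
rewrite -[RHS]/(tlift _ (prod_coact _)) prod_coact_inr (tlift_tmap _ _ bF).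
by apply: eq_tlift => u e /=; rewrite linear0 add0r.
Qed.

Let RS := torsion_coefficients_subspace.

(** If c is the coefficient of v with respect to f, then h c is the coefficient of h (x) v in H (x)
    V with respect to counit (x) f, and H (x) V is again torsion. *)
Lemma torsion_coefficients_act h c : c \in R -> h *c c \in R.
Proof.
move=> /torsion_coefficientsP [V [V0 [f [v {c}->]]]].
apply/torsion_coefficientsP; exists (Hmod_forget (free_Hmod V)).
split; first exact: (free_cotensor_zero V).1.
have bf : bilinear_map (fun (h : H) (v : rcomod_car V) => counit h *: (f v : k^o)) by lin.
have lF : scalar (tlift (fun (h : H) (v : rcomod_car V) => counit h *: (f v : k^o))) :=
  tlift_linear bf.
exists (HB.pack (tlift (fun (h : H) (v : rcomod_car V) => counit h *: (f v : k^o)))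
  (GRing.isLinear.Build k (tensor H (rcomod_car V)) k *%R _ lF) :
  {scalar rcomod_car (Hmod_forget (free_Hmod V))}), (h \ox v).
rewrite /coefficient /= free_coactE /=; last first.
  by split=> [e|x] a y z; rewrite /= ?(tlift_linear bf) ?scalerDl ?scalerA // scalerDr !scalerA mulrC.
under [RHS]eq_tlift => h1 h2.
  under eq_tlift => v0 c do rewrite (tliftE bf) -scalerA.
  rewrite -(tlift_lin (g := fun z => counit h1 *: z)); last by lin.
  over.
rewrite (tlift_counitl (f := fun h => tlift (fun v0 c => f v0 *: (h *c c)) (rcoact v))); last by lin.
rewrite (tlift_lin (g := fun z => h *c z)); last by lin.
by apply: eq_tlift => u c; rewrite (bilinZr cb).
Qed.

(** Coassociativity makes v |-> (f (x) id) rho(v) a comodule map V -> C. Both the closure of [R]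
    under comultiplication and the Hopf module map H (x) V -> C used for 1_C rest on this. *)
Lemma coefficient_rcoact V (f : {scalar rcomod_car V}) v :
  comul (coefficient f v) = tmap (coefficient f) idfun (rcoact v).
Proof.
rewrite /coefficient (tlift_lin (g := @comul k C)); last by lin.
have E (a : k) (c : C) : comul (a *: c) = tlift (fun c1 c2 => a *: (c1 \ox c2)) (comul c).
  rewrite linearZ /= -{1}[comul c]tlift_tens.
  by rewrite (tlift_lin (g := fun z => a *: z)); last by lin.
under eq_tlift do rewrite E.
rewrite -(@rcoact_coassoc k H I V _ (fun u c1 c2 => f u *: (c1 \ox c2))); last by lin.
apply: eq_tlift => v0 c /=.
rewrite (tlift_lin (g := fun z => z \ox c)); last by lin.
by apply: eq_tlift => u c'; rewrite tensZl.
Qed.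

Lemma torsion_coefficients_comul c : c \in R -> tens_in R R (comul c).
Proof.
move=> /torsion_coefficientsP [V [V0 [f [v ->]]]].
have [s /allP sR E] := rcoact_torsion_coefficients v RS V0.
exists [seq (coefficient f p.1, p.2) | p <- s].
  apply/allP => _ /mapP [p ps ->] /=.
  have /andP [_ ->] := sR p ps; rewrite andbT.
  by apply/torsion_coefficientsP; exists V; split=> //; exists f, p.1.
rewrite coefficient_rcoact E big_map.
have lc : linear (coefficient f) by apply: coefficient_lin.
rewrite -[coefficient f]/(GRing.Linear.sort (linmap lc)) linear_sum.
by apply: eq_bigr => p _; apply: tmapE.
Qed.

(* h (x) v |-> h . (f (x) id) rho(v) is a morphism of Hopf modules H (x) V -> C;
   by exactness a preimage of 1_C can be chosen coinvariant. *)
Lemma one_notin_torsion_coefficients : one \notin R.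
Proof.
apply/negP => /torsion_coefficientsP [V [V0 [f [v E]]]].
pose phi (x : tensor H (rcomod_car V)) : C := tlift (fun h v => h *c coefficient f v) x.
have lc := @coefficient_lin V f.
have lphi : linear phi by apply: tlift_linear; lin.
have pE h u : phi (h \ox u) = h *c coefficient f u by rewrite /phi tliftE //; lin.
have m1 : lact_mor (@free_act _ _ _ V) (@factor_act k H I) phi.
  have ab := free_act_bilin V; have lp : lin phi by [].
  move=> h x; move: x; apply: tens_lin_ext; [lin|lin|] => g u.
  by rewrite free_actE !pE factor_actM.
have m2 : rcoact_mor (@free_coact _ _ _ V) (@comul k C) (linmap lphi).
  have lF := free_coact_lin (V := V); have lp : lin phi by [].
  move=> x; move: x; apply: tens_lin_ext; [lin|lin|] => h u.
  rewrite /= pE -[LHS]tlift_tens comul_factor_act; last by lin.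
  rewrite tlift_eq_tmap free_coactE; last by lin.
  apply: eq_tlift => h1 h2; rewrite coefficient_rcoact tlift_eq_tmap tlift_tlift; last by lin.
  by apply: eq_tlift => u0 c; rewrite tliftE ?pE //; lin.
pose phim : hom (free_Hmod V) (factor_Hmod I) :=
  @Cmor k (Hmod_rcomod I) (@Hr_car k H I) (fun M N f =>
    lact_mor (@Hr_act k H I M) (@Hr_act k H I N) f /\
    rcoact_mor (@Hr_coact k H I M) (@Hr_coact k H I N) f)
    (free_Hmod V) (factor_Hmod I) (linmap lphi) (conj m1 m2).
have p1 : phim (1 \ox v) = one by rewrite /= pE factor_act1 -E.
have [|x xP xE] := @coinvariant_lift _ _ _ _ SK S'K _ _ phim (1 \ox v) coflat.
  by rewrite /coinvariant p1 /= comul_one_factor.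
apply: one_factor_neq0; rewrite -p1 -xE.
have -> : x = 0; last exact: linear0.
exact: ((Hmod_cotensor_zero (free_Hmod V)).1 ((free_cotensor_zero V).1 V0)).
Qed.

Lemma torsion_coefficients_proper : proper_stable_subcoalg R.
Proof.
split.
- have [R0 RD] := RS; split; first exact: R0.
  by move=> a x y; apply: RD.
- exact: torsion_coefficients_comul.
- exact: torsion_coefficients_act.
- by exists one; apply: one_notin_torsion_coefficients.
Qed.

(* A proper H-stable subcoalgebra is a Hopf submodule of C not containing 1_C,
   hence has no nonzero coinvariants. *)
Lemma proper_stable_sub (Q : {pred C}) c : proper_stable_subcoalg Q -> c \in Q -> c \in R.
Proof.
move=> [Qsub Qcomul Qact [d dQ]] cQ.
have QS : subspace (fun c => c \in Q) by case: Qsub => Q0 QD; split=> // a x y; apply: QD.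
have oneQ : one \notin Q.
  apply: contra dQ => oQ; have [x ->] : exists x, d = x *c one.
    by elim/factor_ind: d => x; exists x; rewrite factor_act_one.
  exact: Qact.
have [T] := splitting_exists QS.
have iinj : injective (spl_i T) by apply: can_inj (spl_ri T).
have [x|rK rKP mi] := @sub_coaction k C C (spl_sub T) comul (spl_i T) (factor_right_coaction I) iinj.
  have [s /allP sQ ->] := Qcomul _ (spl_iU T x).
  exists (\sum_(p <- s) spl_r T p.1 \ox p.2); rewrite linear_sum big_seq [RHS]big_seq.
  apply: eq_bigr => p /sQ /andP [pQ _]; rewrite /= tmapE /=; congr (_ \ox _).
  exact: (spl_onto T pQ).
have [h x|aK aKP ai] := sub_action (factor_left_action I) iinj.
  by exists (spl_r T (h *c spl_i T x)); apply: (spl_onto T); apply: Qact; exact: (spl_iU T).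
have QC h m : rK (aK h m) = tmap2 aK (@factor_act k H I) (comul h) (rK m).
  apply: (tmap_injective (g := @idfun C) iinj (@inj_id C)).
  by rewrite -mi ai factor_compat mi (tmap2_natr _ _ _ _ ai).
pose K := HmodRcomod aKP rKP QC.
have K0 : cotensor_zero (Hmod_forget K).
  apply/Hmod_cotensor_zero => m mP.
  (* A coinvariant c of C satisfies Delta c = c (x) 1_C; applying the counit to the first factor
     shows that it is a multiple of 1_C. *)
  have im : comul (spl_i T m : C) = spl_i T m \ox one by rewrite mi [rK m]mP tmapE.
  have E : spl_i T m = counit (spl_i T m : C) *: one.
    by rewrite -{1}[spl_i T m](@counitl k C) im tliftE //; lin.
  have [c0|/eqP c0] := eqVneq (counit (spl_i T m : C)) 0.
    by apply: iinj; rewrite linear0 E c0 scale0r.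
  case/negP: oneQ; rewrite -[one]scale1r -(mulVf (introN eqP c0)) -scalerA -E.
  exact: (subspaceZ QS) (spl_iU T m).
apply/torsion_coefficientsP; exists (Hmod_forget K); split=> //.
(* With the counit of C as functional, the coefficient of [c] in the comodule [Q] is [c] itself. *)
have lf : scalar (fun m : spl_sub T => counit (spl_i T m : C)) by move=> a x y; rewrite !linearP.
exists (HB.pack (fun m : spl_sub T => counit (spl_i T m : C))
  (GRing.isLinear.Build k (spl_sub T) k *%R _ lf) : {scalar spl_sub T}), (spl_r T c).
rewrite -[LHS](spl_onto T cQ) -{1}[spl_i T _](@counitl k C) mi tlift_tmap //.
exact: counit_bilinl.
Qed.

(** The subcoalgebras attached to the various v all lie in [R], and [R] is H-stable, so the coaction
    of H (x) V takes values in (H (x) V) (x) R. For a coinvariant x this value is x (x) 1_C with 1_C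
    outside [R], which forces x = 0. Conversely [R] itself serves for every v. *)
Lemma rcomod_TP (V : rcomod_cat C) : rcomod_T V <-> cotensor_zero V.
Proof.
split=> [VT|V0 v]; last first.
  exists R; first exact: torsion_coefficients_proper.
  exact: rcoact_torsion_coefficients.
apply/free_cotensor_zero/Hmod_cotensor_zero => x xP.
have [T] := splitting_exists RS.
have p1 : spl_p T one <> 0 by move/(spl_pU T); apply/negP/one_notin_torsion_coefficients.
apply: tens_eq0 p1.
have -> : x \ox spl_p T one = tmap idfun (spl_p T) (x \ox one) by rewrite tmapE.
rewrite -xP /=; have lF := free_coact_lin (V := V).
have l0 : lin (fun x : tensor H (rcomod_car V) => 0 : tensor H (rcomod_car V) \ox spl_quo T).
  by move=> a y z; rewrite scaler0 addr0.
move: x {xP}; apply: (@tens_lin_ext _ _ _ _ _ (fun=> 0)); [lin|exact: l0|] => h v.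
rewrite tlift_eq_tmap free_coactE; last by lin.
rewrite {1}/tlift big1 // => q _.
have b : bilinear_map (fun (v0 : rcomod_car V) c => (q.1 \ox v0) \ox spl_p T (q.2 *c c)) by lin.
have [Q QP [s /allP sQ E]] := VT v.
transitivity (\sum_(p <- s) (q.1 \ox p.1) \ox spl_p T (q.2 *c p.2)).
  transitivity (linmap (tlift_linear b) (rcoact v)); first by [].
  by rewrite E linear_sum; apply: eq_bigr => p _; apply: tliftE.
rewrite big_seq big1 // => p /sQ /andP [_ pQ].
have /(spl_pU T) -> : q.2 *c p.2 \in R; last exact: tens0r.
by apply: torsion_coefficients_act; apply: proper_stable_sub pQ.
Qed.

Lemma Hmod_rcomod_TP (M : Hmod_rcomod_cat I) :
  Hmod_rcomod_T M <-> forall m : Hr_car M, coinvariant (V := Hmod_forget M) m -> m = 0.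
Proof. by rewrite -Hmod_cotensor_zero -rcomod_TP. Qed.

(** Subobjects and extensions use only left exactness of the cotensor product; for quotients
    coflatness provides preimages. *)
Lemma cotensor_zero_exact (X' X X'' : rcomod_cat C) (f : hom X' X) (g : hom X X'') :
  short_exact f g -> cotensor_zero X <-> cotensor_zero X' /\ cotensor_zero X''.
Proof.
move=> /(short_exactP (rcomod_abelian C)) [finj gsurj fg].
split=> [X0|[X'0 X''0] y yP].
  split=> y yP.
    apply: (tmap_injective (g := @idfun H) finj (@inj_id H)).
    by rewrite tmap0; apply/X0/(cotensor_elt_map f).
  have [z zy] := tmap_surjective (g := @idfun H) gsurj (fun y => ex_intro _ y erefl) y.
  have [|x xP xE] := @coflat_lift _ _ _ coflat _ _ g z; first by rewrite zy.
  by rewrite -zy -[LHS]xE (X0 _ xP) tmap0.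
have /(X''0 _) gy0 := cotensor_elt_map g yP.
have [|y' y'E] := tmap_kerl (i := f) _ gy0; first by move=> x /fg.
rewrite -y'E (X'0 y') ?tmap0 //.
by apply: (cotensor_reflect (j := f)) => //; rewrite y'E.
Qed.

Lemma rcomod_T_serre : serre (@rcomod_T k H I).
Proof.
by move=> X' X X'' f g /cotensor_zero_exact; rewrite !rcomod_TP.
Qed.

Lemma Hmod_rcomod_T_serre : serre (@Hmod_rcomod_T k H I).
Proof.
move=> X' X X'' f g /Hmod_forget_exact; exact: rcomod_T_serre.
Qed.

End Torsion.

(** * Hopf modules and modules over the coinvariants *)

Section CoinvariantAlgebra.
Variables (k : fieldType) (H : hopfAlgType k) (I : left_ideal_coideal H).
Local Notation C := (factor I).
Local Notation A := (coinv I).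
Local Notation S := (@antipode k H).
Local Notation pi := (@factor_pi k H I).
Local Notation one := (one_factor I).
Local Notation "h *c c" := (@factor_act k H I h c) (at level 40).
Local Notation j := (@coinv_val k H I).
Variable S' : H -> H.
Hypotheses (SK : cancel S S') (S'K : cancel S' S).

Let cb := factor_act_bilin I.
Let lS' := inverse_antipode_lin SK S'K.

Lemma coinv_val_inj : injective j.
Proof. exact: val_inj. Qed.

Lemma coinv_valM (a b : A) : j (a * b) = j a * j b. Proof. by []. Qed.

Lemma coinv_comul (W : lmodType k) (F : C -> H -> W) (a : A) : bilinear_map F ->
  tlift (fun u v => F (pi u) v) (comul (j a)) = F one (j a).
Proof.
by move=> bF; rewrite -(tlift_tmap pi idfun bF) (eqP (coinvP a)) tliftE.
Qed.

Lemma coinv_pi (a : A) : pi (j a) = counit (j a) *: one.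
Proof.
rewrite -(coinv_comul (F := fun c h => counit h *: c)); last by lin.
rewrite -[LHS](tlift_counitr (f := fun h => pi h)) //; lin.
Qed.

(** Thus [S'] carries the left coinvariants A into the right coinvariants of H. This is what makes
    S' a preserve coinvariants of Hopf modules. In Sweedler form, S' a2 (x) S' a1 1_C is compared
    with S' a3 (x) S' a2 pi(a1) by means of pi(a1) (x) a2 = 1_C (x) a. *)
Lemma coinv_inverse_antipode (W : lmodType k) (F : H -> C -> W) (a : A) : bilinear_map F ->
  tlift (fun u v => F u (pi v)) (comul (S' (j a))) = F (S' (j a)) one.
Proof.
move=> bF; rewrite (comul_inverse_antipode SK S'K (f := fun u v => F u (pi v))); last by lin.
pose G c h := tlift (fun u v => F (S' v) (S' u *c c)) (comul h).
have bG : bilinear_map G by rewrite /G; lin.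
transitivity (G one (j a)).
  by rewrite /G; apply: eq_tlift => u v; rewrite factor_act_one.
rewrite -(coinv_comul _ bG) /G -comul_coassoc; last by lin.
under eq_tlift => w v.
  under eq_tlift do rewrite factor_actE.
  rewrite (tlift_inverse_antipodel SK S'K (f := fun x => F (S' v) (pi x))); last by lin.
  over.
by rewrite (tlift_counitl (f := fun v => F (S' v) one)); last by lin.
Qed.

Lemma trivial_right_coaction (W : lmodType k) :
  right_coaction (fun w : W => w \ox one).
Proof.
split=> [a x y|w|w]; first by rewrite tensDl tensZl.
  have l : lin (fun w : W => w \ox one) by lin.
  rewrite (tassoc_tlift _ l) !tliftE; [|by lin..].
  by rewrite tmapE /= comul_one_factor.
rewrite tliftE; last by lin.
by rewrite counit_one_factor scale1r.
Qed.

Definition trivial_rcomod (W : lmodType k) : rcomod_cat C := Rcomod (trivial_right_coaction W).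

(** For the trivial coaction the cotensor condition says that [y] is killed by id (x) (coinvariance
    defect of H); the kernel of the defect is A, and tensoring with W is exact. *)
Lemma trivial_cotensor (W : lmodType k) (y : W \ox H) :
  cotensor_elt (V := trivial_rcomod W) y -> exists t : W \ox A, tmap idfun j t = y.
Proof.
move=> /cotensor_eltP yP.
have ld : linear (fun h => tmap pi idfun (comul h) - one \ox h).
  by change (lin (fun h => tmap pi idfun (comul h) - one \ox h)); lin.
apply: (tmap_kerr (f := linmap ld)).
  move=> h /= /eqP; rewrite subr_eq0 => hP.
  by exists (@Coinv k H I h hP).
rewrite tlift_eq_tmap /=.
transitivity (tlift (fun w h => tlift (fun h1 h2 => w \ox (pi h1 \ox h2)) (comul h)) y -
  tlift (fun w h => w \ox (one \ox h)) y).
  have E (w : W) h : w \ox (tmap pi idfun (comul h) - one \ox h) =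
      tlift (fun h1 h2 => w \ox (pi h1 \ox h2)) (comul h) - w \ox (one \ox h).
    rewrite -(tlift_lin (g := fun z => w \ox z)); last by lin.
    by rewrite tensDr -scaleN1r tensZr scaleN1r.
  under eq_tlift do rewrite E.
  by rewrite /tlift sumrB.
rewrite -yP; apply/eqP; rewrite subr_eq0; apply/eqP; apply: eq_tlift => w h /=.
by rewrite tliftE //; lin.
Qed.

(** The flip twisted with S moves [x] into W []_C H = W (x) A; flipping back with [S'] gives the
    stated form. *)
Lemma free_trivial_coinvariant (W : lmodType k) (x : tensor H W) :
  coinvariant (V := Hmod_forget (free_Hmod (trivial_rcomod W))) x ->
  exists t : tensor W A, x = tlift (fun w a => S' (j a) \ox w) t.
Proof.
move=> /free_coinvariant_cotensor /trivial_cotensor [t tE]; exists t.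
have : tlift (fun w h => S' h \ox w) (tmap idfun j t) = tlift (fun w a => S' (j a) \ox w) t.
  by rewrite tlift_tmap //; lin.
move=> <-; rewrite tE tlift_tlift; last by lin.
rewrite -[LHS]tlift_tens; apply: eq_tlift => h w.
by rewrite tliftE ?SK //; lin.
Qed.

Lemma free_trivial_coinvariant_one (W : lmodType k) (w : W) :
  coinvariant (V := Hmod_forget (free_Hmod (trivial_rcomod W))) (1 \ox w).
Proof.
rewrite /coinvariant /= -[LHS]tlift_tens free_coactE; last by lin.
rewrite comul1 tliftE; last by lin.
by rewrite /= tliftE ?factor_act1 //; lin.
Qed.

End CoinvariantAlgebra.

Section HopfModuleEquivalence.
Variables (k : fieldType) (H : hopfAlgType k) (I : left_ideal_coideal H).
Local Notation C := (factor I).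
Local Notation A := (coinv I).
Local Notation S := (@antipode k H).
Local Notation one := (one_factor I).
Local Notation "h *c c" := (@factor_act k H I h c) (at level 40).
Local Notation j := (@coinv_val k H I).
Variable S' : H -> H.
Hypotheses (SK : cancel S S') (S'K : cancel S' S).

Let cb := factor_act_bilin I.
Let lS' := inverse_antipode_lin SK S'K.
Let HM := Hmod_rcomod_cat I.
Let AM := rmod_cat A.
Local Notation coinvt := (@coinvariant k H I (Hmod_forget _)).

Definition Hmod_mor (M N : HM) (f : {linear Hr_car M -> Hr_car N})
    (fa : lact_mor (@Hr_act k H I M) (@Hr_act k H I N) f)
    (fc : rcoact_mor (@Hr_coact k H I M) (@Hr_coact k H I N) f) : hom M N :=
  @Cmor k (Hmod_rcomod I) (@Hr_car k H I) (fun M N f =>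
    lact_mor (@Hr_act k H I M) (@Hr_act k H I N) f /\
    rcoact_mor (@Hr_coact k H I M) (@Hr_coact k H I N) f) M N f (conj fa fc).

Definition rmod_mor (M N : AM) (f : {linear rmod_car M -> rmod_car N})
    (fa : ract_mor (@ract k A M) (@ract k A N) f) : hom M N :=
  @Cmor k (rmod A) (@rmod_car k A) (fun M N f => ract_mor (@ract k A M) (@ract k A N) f) M N f fa.

Lemma Hmod_coinvariant_map (M N : HM) (f : hom M N) (m : Hr_car M) :
  coinvariant (V := Hmod_forget M) m -> coinvariant (V := Hmod_forget N) (f m).
Proof. by rewrite /coinvariant /= => mP; rewrite (cmorP f).2 mP tmapE. Qed.

Lemma Hmod_coinvariant_inj (M N : HM) (f : hom M N) (m : Hr_car M) : injective f ->
  coinvariant (V := Hmod_forget N) (f m) -> coinvariant (V := Hmod_forget M) m.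
Proof.
rewrite /coinvariant /= => finj fm; apply: (tmap_injective (g := @idfun C) finj (@inj_id C)).
by rewrite -(cmorP f).2 fm tmapE.
Qed.

Section Coinvariants.
Variable M : HM.
Local Notation "h *a m" := (@Hr_act k H I M h m) (at level 40).
Let ab : bilinear_map (@Hr_act k H I M) := lact_bilin (Hr_actP M).

Lemma coinvariant_defect_linear : linear (fun m : Hr_car M => Hr_coact m - m \ox one).
Proof.
have l : lin (@Hr_coact k H I M) := rcoact_linear (Hr_coactP M).
by change (lin (fun m : Hr_car M => Hr_coact m - m \ox one)); lin.
Qed.

Definition coinvariants : lmodType k := kernel (linmap coinvariant_defect_linear).
Definition coinvariants_incl : {linear coinvariants -> Hr_car M} := kernel_incl _.

Lemma coinvariants_incl_inj : injective coinvariants_incl.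
Proof. exact: kernel_incl_inj. Qed.

Lemma coinvariants_inclP x : coinvariant (V := Hmod_forget M) (coinvariants_incl x).
Proof. by have /= /eqP := kernel_inclP x; rewrite subr_eq0 => /eqP. Qed.

Lemma coinvariants_onto m : coinvariant (V := Hmod_forget M) m ->
  exists x, coinvariants_incl x = m.
Proof. by move=> mP; apply: kernel_incl_onto; apply/eqP; rewrite /= subr_eq0; apply/eqP. Qed.

Lemma coinvariant_act m (a : A) : coinvariant (V := Hmod_forget M) m ->
  coinvariant (V := Hmod_forget M) (S' (j a) *a m).
Proof.
move=> mP; rewrite /coinvariant /= -[LHS]tlift_tens Hr_coact_act; last by lin.
under eq_tlift => u v.
  rewrite [Hr_coact m]mP tliftE; last by lin.
  rewrite factor_act_one.
  over.
by rewrite (coinv_inverse_antipode SK S'K (F := fun u c => (u *a m) \ox c)); last by lin.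
Qed.

(** Through [S'], which reverses products, the left H-action becomes a right A-action. *)
Definition coinvariants_act (x : coinvariants) (a : A) : coinvariants :=
  sval (cid (coinvariants_onto (coinvariant_act a (coinvariants_inclP x)))).

Lemma coinvariants_actE x a :
  coinvariants_incl (coinvariants_act x a) = S' (j a) *a coinvariants_incl x.
Proof. exact: (svalP (cid (coinvariants_onto (coinvariant_act a (coinvariants_inclP x))))). Qed.

Lemma coinvariants_right_action : right_action coinvariants_act.
Proof.
split=> [|x|x a b]; last 2 first.
- by apply: coinvariants_incl_inj; rewrite coinvariants_actE (inverse_antipode1 SK) (lact1 (Hr_actP M)).
- apply: coinvariants_incl_inj; rewrite !coinvariants_actE.
  by rewrite coinv_valM (inverse_antipodeM SK S'K) (lactM (Hr_actP M)).
apply: bilin_intro => [a|x] c y z; apply: coinvariants_incl_inj.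
  by rewrite linearP !coinvariants_actE linearP (bilinDr ab) (bilinZr ab).
by rewrite linearP !coinvariants_actE linearP lS' (bilinDl ab) (bilinZl ab).
Qed.

Definition coinvariants_rmod : AM := Rmod coinvariants_right_action.

End Coinvariants.

Arguments coinvariants_incl {M}.

Lemma coinvariants_map_exists (M N : HM) (f : hom M N) :
  exists g : hom (coinvariants_rmod M) (coinvariants_rmod N),
    forall x, coinvariants_incl (g x) = f (coinvariants_incl x).
Proof.
have [|g gE] := lift_injective (g := f \o @coinvariants_incl M : {linear _ -> _})
  (@coinvariants_incl_inj N).
  by move=> x; apply/coinvariants_onto/Hmod_coinvariant_map/coinvariants_inclP.
have gE' x : coinvariants_incl (g x) = f (coinvariants_incl x) := gE x.
have ga : ract_mor (@coinvariants_act M) (@coinvariants_act N) g.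
  move=> x a; apply: coinvariants_incl_inj.
  by rewrite gE' !coinvariants_actE (cmorP f).1 gE'.
by exists (rmod_mor (M := coinvariants_rmod M) (N := coinvariants_rmod N) ga).
Qed.

Definition coinvariants_map (M N : HM) (f : hom M N) := sval (cid (coinvariants_map_exists f)).

Lemma coinvariants_mapE (M N : HM) (f : hom M N) x :
  coinvariants_incl (coinvariants_map f x) = f (coinvariants_incl x).
Proof. exact: (svalP (cid (coinvariants_map_exists f))). Qed.

Definition coinvariants_functor : functor HM AM.
Proof.
apply: (@Functor HM AM coinvariants_rmod coinvariants_map).
- by move=> M N f g fg x; apply: coinvariants_incl_inj; rewrite !coinvariants_mapE fg.
- by move=> M x; apply: coinvariants_incl_inj; rewrite coinvariants_mapE.
- by move=> M N P g f x; apply: coinvariants_incl_inj; rewrite !coinvariants_mapE.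
Defined.

(** * The left adjoint W |-> H (x)_A W *)

Section Induction.
Variable W : AM.
Let wb : bilinear_map (@ract k A W) := ract_bilin (rmodP W).

Definition free_trivial (X : lmodType k) : HM := free_Hmod (trivial_rcomod I X).

(** The relations of H (x)_A W, as a map whose cokernel is taken in Hopf modules. With trivial
    coactions on W and A (x) W it is colinear because the elements S' a are right coinvariant. *)
Definition balance (x : tensor H (tensor A (rmod_car W))) : tensor H (rmod_car W) :=
  tlift (fun h => tlift (fun a w => h \ox ract w a - (h * S' (j a)) \ox w)) x.

Let bbal : bilinear_map (fun h : H =>
  tlift (fun (a : A) (w : rmod_car W) => h \ox ract w a - (h * S' (j a)) \ox w)).
Proof. by lin. Qed.

Lemma balanceE h a w : balance (h \ox (a \ox w)) = h \ox ract w a - (h * S' (j a)) \ox w.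
Proof. by rewrite /balance !tliftE //; lin. Qed.

Lemma balance_linear : linear balance. Proof. exact: tlift_linear. Qed.

Lemma free_trivial_coact (X U : lmodType k) (F : tensor H X -> C -> U) h (x : X) : bilinear_map F ->
  tlift F (@free_coact k H I (trivial_rcomod I X) (h \ox x)) =
  tlift (fun h1 h2 => F (h1 \ox x) (factor_pi I h2)) (comul h).
Proof.
move=> bF; apply: etrans (free_coactE (V := trivial_rcomod I X) h x bF) _.
apply: eq_tlift => h1 h2.
by rewrite /= tliftE ?factor_act_one //; lin.
Qed.

Lemma balance_lact_mor : lact_mor (@Hr_act k H I (free_trivial (tensor A (rmod_car W))))
  (@Hr_act k H I (free_trivial (rmod_car W))) (linmap balance_linear).
Proof.
have a1 := free_act_bilin (trivial_rcomod I (tensor A (rmod_car W))).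
have a2 := free_act_bilin (trivial_rcomod I (rmod_car W)).
have lb : lin balance by apply: balance_linear.
move=> g x /=; move: x; apply: tens_lin_ext; [lin|lin|] => h t.
rewrite free_actE; move: t; apply: tens_lin_ext; [lin|lin|] => a w.
by rewrite !balanceE (bilinDr a2) -scaleN1r (bilinZr a2) !free_actE scaleN1r mulrA.
Qed.

Lemma balance_rcoact_mor : rcoact_mor (@Hr_coact k H I (free_trivial (tensor A (rmod_car W))))
  (@Hr_coact k H I (free_trivial (rmod_car W))) (linmap balance_linear).
Proof.
have l1 := @free_coact_lin k H I (trivial_rcomod I (tensor A (rmod_car W))).
have l2 := @free_coact_lin k H I (trivial_rcomod I (rmod_car W)).
have lb : lin balance by apply: balance_linear.
move=> x; move: x; apply: tens_lin_ext; [lin|lin|] => h t.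
move: t; apply: tens_lin_ext; [lin|lin|] => a w.
rewrite tlift_eq_tmap free_trivial_coact; last by lin.
rewrite /= balanceE -[LHS]tlift_tens.
have lt : lin (tlift (@tens k (tensor H (rmod_car W)) C)) by lin.
have E (u v : tensor H (rmod_car W)) : free_coact (V := trivial_rcomod I (rmod_car W)) (u - v) =
    free_coact (V := trivial_rcomod I (rmod_car W)) u - free_coact (V := trivial_rcomod I (rmod_car W)) v.
  by rewrite -scaleN1r addrC l2 addrC scaleN1r.
rewrite tlift_tens E -[X in X - _]tlift_tens -[X in _ - X]tlift_tens.
rewrite !free_trivial_coact; [|by lin..].
rewrite comulM_tlift; last by lin.
under [RHS]eq_tlift => h1 h2 do rewrite balanceE tensDl -scaleN1r tensZl scaleN1r.
rewrite [RHS]/tlift sumrB; congr (_ - _); apply: eq_bigr => p _.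
under eq_tlift do rewrite -factor_actE.
by rewrite (coinv_inverse_antipode SK S'K (F := fun u c => (p.1 * u) \ox w \ox (p.2 *c c)))
  ?factor_act_one //; lin.
Qed.

Definition balance_mor : hom (free_trivial (tensor A (rmod_car W))) (free_trivial (rmod_car W)) :=
  Hmod_mor balance_lact_mor balance_rcoact_mor.

Let coker := cid (ab_cokernel (Hmod_rcomod_abelian I) balance_mor).
Definition induced : HM := projT1 coker.
Definition induced_proj : hom (free_trivial (rmod_car W)) induced := projT1 (cid (projT2 coker)).

Lemma induced_proj_onto y : exists x, induced_proj x = y.
Proof. by have [] := projT2 (cid (projT2 coker)). Qed.

Lemma induced_proj_eq0 x : induced_proj x = 0 <-> exists y, balance y = x.
Proof. by have [_] := projT2 (cid (projT2 coker)). Qed.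

Lemma induced_proj_balance h (w : rmod_car W) a :
  induced_proj (h \ox ract w a) = induced_proj ((h * S' (j a)) \ox w).
Proof.
apply/eqP; rewrite -subr_eq0 -linearB; apply/eqP/induced_proj_eq0.
by exists (h \ox (a \ox w)); rewrite balanceE.
Qed.

Lemma induced_ind (P : Hr_car induced -> Prop) :
  (forall x, P (induced_proj x)) -> forall y, P y.
Proof. by move=> Pp y; have [x <-] := induced_proj_onto y. Qed.

Lemma induced_ext (U : lmodType k) (f g : Hr_car induced -> U) : lin f -> lin g ->
  (forall h w, f (induced_proj (h \ox w)) = g (induced_proj (h \ox w))) -> forall y, f y = g y.
Proof.
move=> lf lg fg; apply: induced_ind; apply: tens_lin_ext => //.
  by apply: (lin_comp lf); lin.
by apply: (lin_comp lg); lin.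
Qed.

Lemma induced_lift (N : HM) (f : hom (free_trivial (rmod_car W)) N) :
  (forall h w a, f (h \ox ract w a) = f ((h * S' (j a)) \ox w)) ->
  exists g : hom induced N, forall x, g (induced_proj x) = f x.
Proof.
move=> fb; have [|g gE] := lift_surjective (g := f : {linear _ -> Hr_car N}) induced_proj_onto.
  move=> x /induced_proj_eq0 [y <-]; have lb : lin balance by apply: balance_linear.
  have l0 (V : lmodType k) : lin (fun _ : V => 0 : Hr_car N) by move=> b u v; rewrite scaler0 addr0.
  move: y; apply: (@tens_lin_ext _ _ _ _ _ (fun=> 0)); [lin|exact: l0|] => h t.
  move: t; apply: (@tens_lin_ext _ _ _ _ _ (fun=> 0)); [lin|exact: l0|] => a w.
  by rewrite balanceE linearB fb subrr.
have [] : lact_mor (@Hr_act k H I induced) (@Hr_act k H I N) g /\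
    rcoact_mor (@Hr_coact k H I induced) (@Hr_coact k H I N) g.
  apply: (ab_lift_surj (Hmod_rcomod_abelian I) (p := induced_proj) (u := g) induced_proj_onto).
  by rewrite (_ : (fun x => g _) = f); [exact: (cmorP f) | exact/funext].
by move=> ga gc; exists (Hmod_mor ga gc).
Qed.

End Induction.

Lemma induced_map_exists (W W' : AM) (f : hom W W') :
  exists g : hom (induced W) (induced W'),
    forall h w, g (induced_proj W (h \ox w)) = induced_proj W' (h \ox f w).
Proof.
pose tf := tmap (@idfun H) f.
have tE h w : tf (h \ox w) = h \ox f w by rewrite /tf tmapE.
have lt : lin tf by move=> a x y; apply: linearP.
have ta : lact_mor (@Hr_act k H I (free_trivial (rmod_car W)))
    (@Hr_act k H I (free_trivial (rmod_car W'))) tf.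
  have a1 := free_act_bilin (trivial_rcomod I (rmod_car W)).
  have a2 := free_act_bilin (trivial_rcomod I (rmod_car W')).
  move=> g x /=; move: x; apply: tens_lin_ext; [lin|lin|] => h w.
  by rewrite free_actE !tE free_actE.
have tc : rcoact_mor (@Hr_coact k H I (free_trivial (rmod_car W)))
    (@Hr_coact k H I (free_trivial (rmod_car W'))) tf.
  have l1 := @free_coact_lin k H I (trivial_rcomod I (rmod_car W)).
  have l2 := @free_coact_lin k H I (trivial_rcomod I (rmod_car W')).
  move=> x; move: x; apply: tens_lin_ext; [lin|lin|] => h w.
  rewrite tE -[LHS]tlift_tens free_trivial_coact; last by lin.
  rewrite tlift_eq_tmap free_trivial_coact; last by lin.
  by apply: eq_tlift => h1 h2; rewrite tE.
have [|g gE] := @induced_lift W (induced W') (cmp (induced_proj W') (Hmod_mor ta tc)).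
  by move=> h w a; rewrite /= !tmapE /= (cmorP f) induced_proj_balance.
by exists g => h w; rewrite gE /= tmapE.
Qed.

Definition induced_map (W W' : AM) (f : hom W W') := sval (cid (induced_map_exists f)).

Lemma induced_mapE (W W' : AM) (f : hom W W') h w :
  induced_map f (induced_proj W (h \ox w)) = induced_proj W' (h \ox f w).
Proof. exact: (svalP (cid (induced_map_exists f))). Qed.

Definition induction_functor : functor AM HM.
Proof.
apply: (@Functor AM HM induced induced_map).
- by move=> W W' f g fg; apply: induced_ext; [lin|lin|] => h w; rewrite !induced_mapE fg.
- by move=> W; apply: induced_ext; [lin|lin|] => h w; rewrite !induced_mapE.
- by move=> W W' W'' g f; apply: induced_ext; [lin|lin|] => h w; rewrite /= !induced_mapE.
Defined.

Lemma induced_proj_act (W : AM) g x :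
  induced_proj W (free_act (V := trivial_rcomod I (rmod_car W)) g x) = Hr_act g (induced_proj W x).
Proof. exact: ((cmorP (induced_proj W)).1 g x). Qed.

Lemma induction_unit_exists (W : AM) : exists u : hom W (coinvariants_rmod (induced W)),
  forall w, coinvariants_incl (u w) = induced_proj W (1 \ox w).
Proof.
have lu : linear (fun w : rmod_car W => induced_proj W (1 \ox w)).
  by change (lin (fun w : rmod_car W => induced_proj W (1 \ox w))); lin.
have [|u uE] := lift_injective (g := linmap lu) (@coinvariants_incl_inj (induced W)).
  move=> w; apply: coinvariants_onto; apply: (Hmod_coinvariant_map (induced_proj W)).
  exact: free_trivial_coinvariant_one.
have ua : ract_mor (@ract k A W) (@coinvariants_act (induced W)) u.
  move=> w a; apply: coinvariants_incl_inj; rewrite coinvariants_actE !uE /=.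
  by rewrite induced_proj_balance mul1r -induced_proj_act free_actE mulr1.
by exists (rmod_mor (M := W) (N := coinvariants_rmod (induced W)) ua).
Qed.

Definition induction_unit (W : AM) := sval (cid (induction_unit_exists W)).

Lemma induction_unitE W w : coinvariants_incl (induction_unit W w) = induced_proj W (1 \ox w).
Proof. exact: (svalP (cid (induction_unit_exists W))). Qed.

Lemma induction_counit_exists (M : HM) : exists e : hom (induced (coinvariants_rmod M)) M,
  forall h x, e (induced_proj (coinvariants_rmod M) (h \ox x)) = Hr_act h (coinvariants_incl x).
Proof.
have ab := lact_bilin (Hr_actP M).
pose W := coinvariants_rmod M.
pose e0 (x : tensor H (rmod_car W)) := tlift (fun h w => Hr_act h (coinvariants_incl (M := M) w)) x.
have le0 : lin e0 by rewrite /e0; lin.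
have eE h w : e0 (h \ox w) = Hr_act h (coinvariants_incl w) by rewrite /e0 tliftE //; lin.
have ta : lact_mor (@Hr_act k H I (free_trivial (rmod_car W))) (@Hr_act k H I M) (linmap le0).
  have a1 := free_act_bilin (trivial_rcomod I (rmod_car W)).
  move=> g x /=; move: x; apply: tens_lin_ext; [lin|lin|] => h w.
  by rewrite free_actE !eE (lactM (Hr_actP M)).
have tc : rcoact_mor (@Hr_coact k H I (free_trivial (rmod_car W))) (@Hr_coact k H I M) (linmap le0).
  have l1 := @free_coact_lin k H I (trivial_rcomod I (rmod_car W)).
  have l2 : lin (@Hr_coact k H I M) := rcoact_linear (Hr_coactP M).
  move=> x; move: x; apply: tens_lin_ext; [lin|lin|] => h w.
  rewrite tlift_eq_tmap free_trivial_coact; last by lin.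
  rewrite /= eE -[LHS]tlift_tens Hr_coact_act; last by lin.
  apply: eq_tlift => h1 h2; rewrite [Hr_coact _]coinvariants_inclP tliftE; last by lin.
  by rewrite factor_act_one eE.
have [|e eP] := @induced_lift W M (Hmod_mor ta tc).
  by move=> h w a; rewrite /= !eE coinvariants_actE (lactM (Hr_actP M)).
by exists e => h x; rewrite eP /= eE.
Qed.

Definition induction_counit (M : HM) := sval (cid (induction_counit_exists M)).

Lemma induction_counitE M h x :
  induction_counit M (induced_proj (coinvariants_rmod M) (h \ox x)) = Hr_act h (coinvariants_incl x).
Proof. exact: (svalP (cid (induction_counit_exists M))). Qed.

Definition induction_adjunction : adjunction induction_functor coinvariants_functor.
Proof.
apply: (@Adjunction HM AM induction_functor coinvariants_functor induction_unit induction_counit).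
- move=> W W' f w; apply: coinvariants_incl_inj.
  by rewrite coinvariants_mapE !induction_unitE induced_mapE.
- move=> M N f; apply: induced_ext; [lin|lin|] => h x.
  by rewrite /= induced_mapE !induction_counitE coinvariants_mapE (cmorP f).1.
- move=> W; apply: induced_ext; [lin|lin|] => h w.
  by rewrite /= induced_mapE induction_counitE induction_unitE -induced_proj_act free_actE mulr1.
- move=> M x; apply: coinvariants_incl_inj.
  by rewrite coinvariants_mapE induction_unitE induction_counitE (lact1 (Hr_actP M)).
Defined.

Hypothesis coflat : left_coflat (H_lcomod I).

(* Writing t in A (x) W, the coinvariants of H (x) W are the sums of S' a (x) w,
   which the relations of the induced module turn into 1 (x) w a. *)
Lemma induction_unit_surjective W y : exists w, induction_unit W w = y.
Proof.
have [x xy] := induced_proj_onto (coinvariants_incl y).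
have [|x' x'P x'E] := coinvariant_lift SK S'K (f := induced_proj W) (m := x) coflat.
  by rewrite xy; apply: coinvariants_inclP.
have [t tE] := free_trivial_coinvariant SK S'K x'P.
have wb : bilinear_map (@ract k A W) := ract_bilin (rmodP W).
exists (tlift (fun w a => ract w a) t); apply: coinvariants_incl_inj.
rewrite induction_unitE -xy -x'E tE (tlift_lin (g := fun w => 1 \ox w)); last by lin.
rewrite !(tlift_lin (g := induced_proj W)); [|by lin..].
by apply: eq_tlift => w a; rewrite induced_proj_balance mul1r.
Qed.

(** If w dies, 1 (x) w is a value of [balance], and by coflatness a value at a coinvariant, hence at
    a sum of S' a (x) (b (x) v). The flip twisted with S moves the equation to W (x) A, where it
    reads w (x) 1 = sum of (v b (x) a - v (x) b a). The action W (x) A -> W kills the right side and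
    sends the left side to w. *)
Lemma induction_unit_injective W : injective (induction_unit W).
Proof.
have wb : bilinear_map (@ract k A W) := ract_bilin (rmodP W).
have lj : lin j by move=> a x y; apply: linearP.
suff W0 w : induction_unit W w = 0 -> w = 0.
  move=> x y xy; apply/eqP; rewrite -subr_eq0; apply/eqP/W0.
  by rewrite linearB xy subrr.
move=> /(congr1 coinvariants_incl); rewrite induction_unitE linear0 => /induced_proj_eq0 [z zE].
have [|z' z'P z'E] := coinvariant_lift SK S'K (f := balance_mor W) (m := z) coflat.
  by rewrite [balance_mor W z]zE; apply: free_trivial_coinvariant_one.
have [t tE] := free_trivial_coinvariant SK S'K z'P.
pose sw (x : tensor H (rmod_car W)) : tensor (rmod_car W) H := tlift (fun h w => w \ox S h) x.
have lsw : lin sw by rewrite /sw; lin.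
have swE h v : sw (h \ox v) = v \ox S h by rewrite /sw tliftE //; lin.
(* For varying [a], a differential of the bar complex W (x) A (x) A -> W (x) A -> W. *)
pose d (x : tensor A (rmod_car W)) (a : A) : tensor (rmod_car W) A :=
  tlift (fun a' v => ract v a' \ox a - v \ox (a' * a)) x.
have ld : bilinear_map d by rewrite /d; lin.
have dE a' v a : d (a' \ox v) a = ract v a' \ox a - v \ox (a' * a) by rewrite /d tliftE //; lin.
have lb := @balance_linear W.
have E : tmap idfun j (tlift d t) = tmap idfun j (w \ox (1 : A)).
  have -> : tmap idfun j (w \ox (1 : A)) = sw (1 \ox w) by rewrite tmapE swE antipode1.
  rewrite -zE -[balance z]/(balance_mor W z) -z'E tE.
  rewrite (tlift_lin (g := balance_mor W)); last by lin.
  rewrite (tlift_lin (g := sw)) // tmap_tlift; apply: eq_tlift => x a.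
  have lda : lin (fun x => tmap idfun j (d x a)) by lin.
  have lsb : lin (fun x => sw (balance_mor W (S' (j a) \ox x))) by lin.
  apply: (tens_lin_ext lda lsb) => a' v.
  rewrite [balance_mor W _]balanceE dE tmapB !tmapE addrC -scaleN1r -[in RHS]scaleN1r.
  rewrite [in RHS]addrC lsw !swE S'K -(inverse_antipodeM SK S'K) S'K.
  by [].
have {E}dt := tmap_injective (f := @idfun (rmod_car W)) (g := j) (@inj_id _)
  (@coinv_val_inj k H I) E.
have bd' : bilinear_map (fun (w : rmod_car W) (a : A) => ract w a) by [].
have := congr1 (tlift (fun w a => ract w a)) dt.
rewrite tliftE // (ract1 (rmodP W)) => <-; rewrite tlift_tlift //.
have l0 (V : lmodType k) : lin (fun _ : V => 0 : rmod_car W) by move=> b u v; rewrite scaler0 addr0.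
move: (t); apply: (@tens_lin_ext _ _ _ _ _ (fun=> 0)); [lin|exact: l0|] => x a.
rewrite tliftE; last by lin.
have lx : lin (fun x => tlift (fun w a => ract w a) (d x a)) by lin.
apply: (tens_lin_ext lx (l0 _)) => a' v.
rewrite dE (tliftD wb) -scaleN1r -tensZl !tliftE // (bilinZl wb) scaleN1r.
by rewrite (ractM (rmodP W)) subrr.
Qed.

(** Coinvariants of the kernel vanish, which gives injectivity. A coinvariant of N dies in the
    cokernel, hence comes from M, and [coinvariant_lift] makes the preimage coinvariant. *)
Lemma coinvariants_functor_iso (M N : HM) (f : hom M N) :
  serre_iso (@Hmod_rcomod_T k H I) f -> is_iso (fmap coinvariants_functor f).
Proof.
move=> [[K [i [/(is_kernelP (Hmod_rcomod_abelian I)) [iinj iP] K0]]]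
        [Q [p [/(is_cokernelP (Hmod_rcomod_abelian I)) [psurj pP] Q0]]]].
move/(Hmod_rcomod_TP SK S'K coflat): K0 => K0; move/(Hmod_rcomod_TP SK S'K coflat): Q0 => Q0.
have finj : injective (coinvariants_map f).
  suff f0 x : coinvariants_map f x = 0 -> x = 0.
    move=> x y xy; apply/eqP; rewrite -subr_eq0; apply/eqP/f0.
    by rewrite linearB xy subrr.
  move=> /(congr1 coinvariants_incl); rewrite coinvariants_mapE linear0 => /iP [y yE].
  apply: coinvariants_incl_inj; rewrite -yE linear0 (K0 y) ?linear0 //.
  by apply: (Hmod_coinvariant_inj (f := i)) => //; rewrite yE; apply: coinvariants_inclP.
apply: is_isoP => // [u uE x a|y].
  by apply: finj; rewrite uE (cmorP (coinvariants_map f)) uE.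
have /pP [m mE] : p (coinvariants_incl y) = 0.
  by apply/Q0/(Hmod_coinvariant_map p)/coinvariants_inclP.
have [|m' m'P m'E] := coinvariant_lift SK S'K (f := f) (m := m) coflat.
  by rewrite mE; apply: coinvariants_inclP.
have [x xE] := coinvariants_onto m'P.
by exists x; apply: coinvariants_incl_inj; rewrite coinvariants_mapE xE m'E.
Qed.

(** By a triangle identity the counit is, on coinvariants, inverse to the bijective unit. Its kernel
    and cokernel therefore have no nonzero coinvariants, coflatness being used again for the
    cokernel. *)
Lemma induction_counit_serre_iso (M : HM) :
  serre_iso (@Hmod_rcomod_T k H I) (induction_counit M).
Proof.
have unitK x : induction_counit M (coinvariants_incl (induction_unit (coinvariants_rmod M) x)) =
    coinvariants_incl x.
  by rewrite induction_unitE induction_counitE (lact1 (Hr_actP M)).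
split.
  have [K [i [iinj iP]]] := ab_kernel (Hmod_rcomod_abelian I) (induction_counit M).
  exists K, i; split; first exact/(is_kernelP (Hmod_rcomod_abelian I)).
  apply/(Hmod_rcomod_TP SK S'K coflat) => m mP; apply: iinj; rewrite linear0.
  have [y yE] := coinvariants_onto (Hmod_coinvariant_map i mP).
  have [x xy] := induction_unit_surjective y.
  rewrite -yE -xy (_ : x = 0) ?linear0 //; apply: coinvariants_incl_inj.
  by rewrite -unitK xy yE linear0; apply/iP; exists m.
have [Q [p [psurj pP]]] := ab_cokernel (Hmod_rcomod_abelian I) (induction_counit M).
exists Q, p; split; first exact/(is_cokernelP (Hmod_rcomod_abelian I)).
apply/(Hmod_rcomod_TP SK S'K coflat) => q qP; have [m mq] := psurj q.
have [|m' m'P m'E] := coinvariant_lift SK S'K (f := p) (m := m) coflat; first by rewrite mq.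
rewrite -mq -m'E; apply/pP; have [x <-] := coinvariants_onto m'P.
by exists (coinvariants_incl (induction_unit (coinvariants_rmod M) x)); apply: unitK.
Qed.

Lemma Hmod_rcomod_localization : localization (@Hmod_rcomod_T k H I) induction_adjunction.
Proof.
split.
- exact: (Hmod_rcomod_T_serre SK S'K coflat).
- move=> W; apply: is_isoP => [u uE x a||].
  + by apply: induction_unit_injective; rewrite uE (cmorP (induction_unit W)) uE.
  + exact: induction_unit_injective.
  + exact: induction_unit_surjective.
- exact: coinvariants_functor_iso.
- exact: induction_counit_serre_iso.
Qed.

End HopfModuleEquivalence.

(** * Comodules and relative Hopf modules *)

Section RelativeHopfModules.
Variables (k : fieldType) (H : hopfAlgType k) (I : left_ideal_coideal H).
Local Notation C := (factor I).
Local Notation A := (coinv I).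
Local Notation S := (@antipode k H).
Local Notation pi := (@factor_pi k H I).
Local Notation one := (one_factor I).
Local Notation "h *c c" := (@factor_act k H I h c) (at level 40).
Local Notation j := (@coinv_val k H I).

Let cb := factor_act_bilin I.

(** A is the kernel of the coinvariance defect of H, so A (x) H is the kernel of the defect tensored
    with H; coassociativity shows that Delta(a) lies there. *)
Lemma coinv_coact_exists : exists2 d : A -> A \ox H,
  right_coaction d & rcoact_mor d (@comul k H) j.
Proof.
have Hco : right_coaction (@comul k H) by split; [exact: comul_linear | exact: comulA | exact: counitr].
apply: (sub_coaction Hco (@coinv_val_inj k H I)) => a.
have ld : linear (fun h => tmap pi idfun (comul h) - one \ox h).
  by change (lin (fun h => tmap pi idfun (comul h) - one \ox h)); lin.
apply: (tmap_kerl (f := linmap ld)).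
  by move=> h /= /eqP; rewrite subr_eq0 => hP; exists (@Coinv k H I h hP).
transitivity (tlift (fun u v => tlift (fun u1 u2 => (pi u1 \ox u2) \ox v) (comul u)) (comul (j a)) -
  tlift (fun u v => (one \ox u) \ox v) (comul (j a))).
  rewrite tlift_eq_tmap /tlift -sumrB; apply: eq_bigr => p _ /=.
  rewrite -/(tlift (fun u1 u2 => (pi u1 \ox u2) \ox p.2) (comul p.1)).
  rewrite -(tlift_lin (g := fun z => z \ox p.2)); last by lin.
  by rewrite tensDl -scaleN1r tensZl scaleN1r.
rewrite comul_coassoc; last by lin.
rewrite (coinv_comul (F := fun c h => tlift (fun u v => (c \ox u) \ox v) (comul h))); last by lin.
by rewrite subrr.
Qed.

Definition coinv_coact : A -> A \ox H := s2val (cid2 coinv_coact_exists).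

Lemma coinv_coactP : right_coaction coinv_coact.
Proof. exact: (s2valP (cid2 coinv_coact_exists)). Qed.

Lemma coinv_coactE a : tmap j idfun (coinv_coact a) = comul (j a).
Proof. exact/esym/(s2valP' (cid2 coinv_coact_exists)). Qed.

Lemma coinv_coact_lin : lin coinv_coact.
Proof. exact: (rcoact_linear coinv_coactP). Qed.

Lemma coinv_coact_val (W : lmodType k) (F : H -> H -> W) a : bilinear_map F ->
  tlift (fun b h => F (j b) h) (coinv_coact a) = tlift F (comul (j a)).
Proof. by move=> bF; rewrite -coinv_coactE tlift_tmap. Qed.

(** Identifies the tensor left existential in [rr_compat] and [lr_compat], so that compatibility can
    be used with one fixed coaction on A. *)
Lemma coinv_coact_unique a t : tmap j idfun t = comul (j a) -> t = coinv_coact a.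
Proof.
rewrite -coinv_coactE.
exact: (tmap_injective (f := j) (g := @idfun H) (@coinv_val_inj k H I) (@inj_id H)).
Qed.

Lemma coinv_coact_counit (W : lmodType k) (f : H -> W) a : lin f ->
  tlift (fun b h => counit (j b) *: f h) (coinv_coact a) = f (j a).
Proof.
move=> lf; rewrite (coinv_coact_val (F := fun b h => counit b *: f h)); last by lin.
exact: tlift_counitl.
Qed.

Let HC := rcomod H.

Section PushForward.
Variable X : HC.

Definition push_coact (x : X) : X \ox C := tmap idfun pi (rcoact x).

Lemma push_coactE (W : lmodType k) (F : X -> C -> W) x : bilinear_map F ->
  tlift F (push_coact x) = tlift (fun y h => F y (pi h)) (rcoact x).
Proof. by move=> bF; rewrite /push_coact tlift_tmap. Qed.

Lemma rcoact_coassocH (W : lmodType k) (G : X -> H -> H -> W) x : trilin G ->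
  tlift (fun y h => tlift (fun u g => G u g h) (rcoact y)) (rcoact x) =
  tlift (fun y h => tlift (fun g1 g2 => G y g1 g2) (comul h)) (rcoact x).
Proof. exact: (tlift_coassoc (d := @rcoact k H X) (e := comul) (rcoactA (rcomodP X) x)). Qed.

Lemma push_coact_lin : lin push_coact.
Proof. by rewrite /push_coact; lin. Qed.

Lemma push_right_coaction : right_coaction push_coact.
Proof.
exact: (@push_coaction k H C pi (@factor_comulE k H I) (@factor_counitE k H I) X _ (rcomodP X)).
Qed.

Definition push_rcomod : rcomod_cat C := Rcomod push_right_coaction.

(* X []_C H = X []_H (H []_C H), and H []_C H is H (x) A. *)
Lemma push_cotensor (y : tensor X H) : cotensor_elt (V := push_rcomod) y ->
  exists t : tensor X A, y = tlift (fun x a => tlift (fun x0 x1 => x0 \ox (x1 * j a)) (rcoact x)) t.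
Proof.
(* x (x) h |-> x0 (x) S x1 h inverts x (x) h |-> x0 (x) x1 h, and it turns the pushed coaction on X
   into the trivial one. The image [z] of [y] is then in X (x) A by [trivial_cotensor]. *)
move=> yP; pose z : tensor X H := tlift (fun x h => tlift (fun x0 x1 => x0 \ox (S x1 * h)) (rcoact x)) y.
have [|t tE] := @trivial_cotensor k H I X z.
  apply/cotensor_eltP.
  rewrite /z !tlift_tlift; [|by lin..].
  pose K (x : X) (c : C) (h : H) := tlift (fun x0 x1 =>
    tlift (fun u v => x0 \ox (S v *c c \ox (S u * h))) (comul x1)) (rcoact x).
  have tK : trilin K by rewrite /K; lin.
  transitivity (tlift (fun x h => tlift (fun h1 h2 => K x (pi h1) h2) (comul h)) y); last first.
    apply: eq_tlift => x h; rewrite /K tlift_exchange tlift_tlift; last by lin.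
    apply: eq_tlift => x0 x1; rewrite tliftE; last by lin.
    rewrite comulM_tlift; last by lin.
    rewrite comul_antipode; last by lin.
    rewrite tlift_exchange; apply: eq_tlift => u v; apply: eq_tlift => h1 h2.
    by rewrite factor_actE.
  rewrite -(cotensor_sum yP tK); apply: eq_tlift => x h.
  have bK : bilinear_map (fun v0 c => K v0 c h) by lin.
  apply/esym; apply: etrans (push_coactE x bK) _; rewrite /K.
  rewrite tlift_tlift; last by lin.
  rewrite (@rcoact_coassocH _ (fun u g w => tlift (fun a b => u \ox (S b *c pi w \ox (S a * h))) (comul g)));
    last by lin.
  apply: eq_tlift => x0 z'; rewrite [RHS]tliftE; last by lin.
  rewrite /= [RHS]tliftE; last by lin.
  rewrite comul_coassoc; last by lin.
  under eq_tlift => u q.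
    under eq_tlift do rewrite factor_actE.
    rewrite (tlift_antipodel (f := fun b => x0 \ox (pi b \ox (S u * h)))); last by lin.
    over.
  by rewrite (tlift_counitr (f := fun u => x0 \ox (pi 1 \ox (S u * h)))); last by lin.
exists t.
have -> : tlift (fun x a => tlift (fun x0 x1 => x0 \ox (x1 * j a)) (rcoact x)) t =
    tlift (fun x h => tlift (fun x0 x1 => x0 \ox (x1 * h)) (rcoact x)) (tmap idfun j t).
  by rewrite tlift_tmap //; lin.
rewrite tE /z tlift_tlift; last by lin.
rewrite -[LHS]tlift_tens; apply: eq_tlift => x h.
rewrite tlift_tlift; last by lin.
under [RHS]eq_tlift => x0 x1.
  rewrite tliftE; last by lin.
  under eq_tlift do rewrite mulrA.
  over.
rewrite (@rcoact_coassocH _ (fun u g w => u \ox (g * S w * h))); last by lin.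
under [RHS]eq_tlift => x0 x1.
  rewrite (tlift_antipoder (f := fun g => x0 \ox (g * h))) ?mul1r; last by lin.
  over.
rewrite -[in LHS](rcoact1 (rcomodP X) x) (tlift_lin (g := fun z => z \ox h)); last by lin.
by apply: eq_tlift => x0 x1; rewrite tensZl.
Qed.

End PushForward.

Let RM := rcomod_cat C.
Let RR := rmod_rcomod_cat I.

Definition rcomod_mor (V W : RM) (f : {linear rcomod_car V -> rcomod_car W})
    (fc : rcoact_mor (@rcoact k C V) (@rcoact k C W) f) : hom V W :=
  @Cmor k (rcomod C) (@rcomod_car k C) (fun M N f => rcoact_mor (@rcoact k C M) (@rcoact k C N) f)
    V W f fc.

Definition rr_mor (M N : RR) (f : {linear rr_car M -> rr_car N})
    (fa : ract_mor (@rr_act k H I M) (@rr_act k H I N) f)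
    (fc : rcoact_mor (@rr_coact k H I M) (@rr_coact k H I N) f) : hom M N :=
  @Cmor k (rmod_rcomod I) (@rr_car k H I) (fun M N f =>
    ract_mor (@rr_act k H I M) (@rr_act k H I N) f /\
    rcoact_mor (@rr_coact k H I M) (@rr_coact k H I N) f) M N f (conj fa fc).

(** * The relative Hopf module V []_C H *)

Section CotensorModule.
Variable V : RM.
Let VH : lmodType k := tensor (rcomod_car V) H.
Let rho := @rcoact k C V.

Let lrho : lin rho. Proof. by rewrite /rho; lin. Qed.

Definition cotensor_defect (y : VH) : tensor (rcomod_car V) (tensor C H) :=
  tlift (fun v h => tlift (fun v0 c => v0 \ox (c \ox h)) (rho v)) y -
  tlift (fun v h => tlift (fun h1 h2 => v \ox (pi h1 \ox h2)) (comul h)) y.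

Lemma cotensor_defect_linear : linear cotensor_defect.
Proof. by change (lin cotensor_defect); rewrite /cotensor_defect; lin. Qed.

(** The cotensor product once more, now as the kernel of a linear map, so that the kernel lemmas for
    tensor products give the H-coaction on it. *)
Definition cotens : lmodType k := kernel (linmap cotensor_defect_linear).
Definition cotens_incl : {linear cotens -> VH} := kernel_incl _.

Lemma cotens_incl_inj : injective cotens_incl.
Proof. exact: kernel_incl_inj. Qed.

Lemma cotens_inclP y : cotensor_elt (V := V) (cotens_incl y).
Proof.
apply/cotensor_eltP; have /= /eqP := kernel_inclP y.
by rewrite subr_eq0 => /eqP.
Qed.

Lemma cotens_onto y : cotensor_elt (V := V) y -> exists x, cotens_incl x = y.
Proof.
by move=> /cotensor_eltP yP; apply: kernel_incl_onto; apply/eqP; rewrite /= subr_eq0; apply/eqP.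
Qed.

Definition tens_mulr (a : A) (y : VH) : VH := tlift (fun v h => v \ox (h * j a)) y.

Lemma tens_mulr_cotensor a y : cotensor_elt (V := V) y -> cotensor_elt (V := V) (tens_mulr a y).
Proof.
move=> yP; apply/cotensor_eltP; rewrite /tens_mulr !tlift_tlift; [|by lin..].
transitivity (tlift (fun v h => tlift (fun v0 c => v0 \ox (c \ox (h * j a))) (rho v)) y).
  by apply: eq_tlift => v h; rewrite tliftE //; lin.
have tF : trilin (fun (v : rcomod_car V) (c : C) (h : H) => v \ox (c \ox (h * j a))) by lin.
rewrite (cotensor_sum yP tF); apply: eq_tlift => v h.
rewrite tliftE; last by lin.
rewrite comulM_tlift; last by lin.
apply: eq_tlift => h1 h2; rewrite /=.
under [RHS]eq_tlift do rewrite -factor_actE.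
rewrite (coinv_comul (F := fun c h => v \ox (h1 *c c \ox (h2 * h)))); last by lin.
by rewrite factor_act_one.
Qed.

Definition cotens_act (y : cotens) (a : A) : cotens :=
  sval (cid (cotens_onto (tens_mulr_cotensor a (cotens_inclP y)))).

Lemma cotens_actE y a : cotens_incl (cotens_act y a) = tens_mulr a (cotens_incl y).
Proof. exact: (svalP (cid (cotens_onto (tens_mulr_cotensor a (cotens_inclP y))))). Qed.

Lemma tens_mulr_bilin : bilinear_map tens_mulr.
Proof.
have lj : lin j by move=> a x y; apply: linearP.
by rewrite /tens_mulr; lin.
Qed.

Lemma cotens_right_action : right_action cotens_act.
Proof.
have mb := tens_mulr_bilin.
split=> [|y|y a b]; last 2 first.
- apply: cotens_incl_inj; rewrite cotens_actE /tens_mulr -[RHS]tlift_tens.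
  by apply: eq_tlift => v h; rewrite mulr1.
- apply: cotens_incl_inj; rewrite !cotens_actE /tens_mulr tlift_tlift; last by lin.
  by apply: eq_tlift => v h; rewrite tliftE ?mulrA //; lin.
apply: bilin_intro => [a|y] c u v; apply: cotens_incl_inj.
  by rewrite linearP !cotens_actE linearP (bilinDr mb) (bilinZr mb).
by rewrite linearP !cotens_actE (bilinDl mb) (bilinZl mb).
Qed.

Definition tens_coact (y : VH) : VH \ox H :=
  tlift (fun v h => tlift (fun h1 h2 => (v \ox h1) \ox h2) (comul h)) y.

Lemma tens_coactE (U : lmodType k) (F : VH -> H -> U) y : bilinear_map F ->
  tlift F (tens_coact y) = tlift (fun v h => tlift (fun h1 h2 => F (v \ox h1) h2) (comul h)) y.
Proof.
move=> bF; rewrite /tens_coact tlift_tlift //; apply: eq_tlift => v h.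
by rewrite tlift_tlift //; apply: eq_tlift => h1 h2; rewrite tliftE.
Qed.

Lemma tens_right_coaction : right_coaction tens_coact.
Proof.
have lt : lin tens_coact by rewrite /tens_coact; lin.
split=> [|y|y]; first exact: lt.
  rewrite (tassoc_tlift _ lt) tmap_idl_tlift !tens_coactE; [|by lin..].
  apply: eq_tlift => v h.
  under eq_tlift => h1 h2.
    rewrite tens_coactE; last by lin.
    rewrite tliftE; last by lin.
    over.
  by rewrite comul_coassoc //; lin.
rewrite tens_coactE; last by lin.
rewrite -[RHS]tlift_tens; apply: eq_tlift => v h.
by rewrite (tlift_counitr (f := fun h => v \ox h)) //; lin.
Qed.

Lemma cotens_coact_exists : exists2 d : cotens -> cotens \ox H,
  right_coaction d & rcoact_mor d tens_coact cotens_incl.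
Proof.
apply: (sub_coaction tens_right_coaction cotens_incl_inj) => y.
apply: (tmap_kerl (f := linmap cotensor_defect_linear)).
  by move=> x fx; exact: (kernel_incl_onto fx).
have yP := cotens_inclP y; set x := cotens_incl y in yP *.
have bD : bilinear_map (fun z (h : H) => linmap cotensor_defect_linear z \ox h) by lin.
rewrite tlift_eq_tmap tens_coactE //=.
transitivity (tlift (fun v h => tlift (fun h1 h2 =>
    tlift (fun v0 c => v0 \ox (c \ox h1) \ox h2) (rho v)) (comul h)) x -
  tlift (fun v h => tlift (fun h1 h2 =>
    tlift (fun a b => v \ox (pi a \ox b) \ox h2) (comul h1)) (comul h)) x).
  have E v h1 h2 : cotensor_defect (v \ox h1) \ox h2 =
      tlift (fun v0 c => v0 \ox (c \ox h1) \ox h2) (rho v) -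
      tlift (fun a b => v \ox (pi a \ox b) \ox h2) (comul h1).
    rewrite /cotensor_defect !tliftE; [|by lin..].
    rewrite tensDl -[- _ in LHS]scaleN1r tensZl scaleN1r; congr (_ - _).
      by rewrite (tlift_lin (g := fun z => z \ox h2)) //; lin.
    by rewrite (tlift_lin (g := fun z => z \ox h2)) //; lin.
  rewrite -tlift_sub; apply: eq_tlift => v h.
  by rewrite -tlift_sub; apply: eq_tlift => h1 h2; apply: E.
have tF : trilin (fun (v : rcomod_car V) (c : C) (h : H) =>
  tlift (fun h1 h2 => v \ox (c \ox h1) \ox h2) (comul h)) by lin.
apply/eqP; rewrite subr_eq0; apply/eqP.
under eq_tlift do rewrite tlift_exchange.
rewrite (cotensor_sum yP tF); apply: eq_tlift => v h.
by rewrite comul_coassoc //; lin.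
Qed.

Definition cotens_coact : cotens -> cotens \ox H := s2val (cid2 cotens_coact_exists).

Lemma cotens_coactP : right_coaction cotens_coact.
Proof. exact: (s2valP (cid2 cotens_coact_exists)). Qed.

Lemma cotens_coactE y : tmap cotens_incl idfun (cotens_coact y) = tens_coact (cotens_incl y).
Proof. exact/esym/(s2valP' (cid2 cotens_coact_exists)). Qed.

Lemma cotens_coact_incl (U : lmodType k) (F : VH -> H -> U) y : bilinear_map F ->
  tlift (fun x h => F (cotens_incl x) h) (cotens_coact y) =
  tlift (fun v h => tlift (fun h1 h2 => F (v \ox h1) h2) (comul h)) (cotens_incl y).
Proof. by move=> bF; rewrite -tens_coactE // -cotens_coactE tlift_tmap. Qed.

Lemma cotens_compat y (a : A) : exists2 t : A \ox H, tmap j idfun t = comul (j a) &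
  cotens_coact (cotens_act y a) = tmap2 cotens_act *%R (cotens_coact y) t.
Proof.
have mb := tens_mulr_bilin.
exists (coinv_coact a); first exact: coinv_coactE.
apply: (tmap_injective (g := @idfun H) cotens_incl_inj (@inj_id H)).
rewrite cotens_coactE cotens_actE tmap2_tlift tmap_tlift.
transitivity (tlift (fun x h => tlift (fun u v => tens_mulr u (cotens_incl x) \ox (h * v))
    (coinv_coact a)) (cotens_coact y)); last first.
  apply: eq_tlift => x h; rewrite tmap_tlift; apply: eq_tlift => u v.
  by rewrite tmapE cotens_actE.
rewrite (cotens_coact_incl (F := fun z h => tlift (fun u v => tens_mulr u z \ox (h * v))
    (coinv_coact a))); last by lin.
rewrite -[LHS]tlift_tens tens_coactE; last by lin.
rewrite {1}/tens_mulr tlift_tlift; last by lin.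
apply: eq_tlift => v h; rewrite tliftE; last by lin.
rewrite comulM_tlift; last by lin.
apply: eq_tlift => h1 h2.
rewrite -(coinv_coact_val (F := fun u w => v \ox (h1 * u) \ox (h2 * w))); last by lin.
by apply: eq_tlift => u w; rewrite /tens_mulr tliftE //; lin.
Qed.

Definition cotens_rr : RR :=
  RmodRcomod cotens_right_action cotens_coactP cotens_compat.

End CotensorModule.

Arguments cotens_incl {V}.

Lemma cotens_map_exists (V W : RM) (f : hom V W) :
  exists g : hom (cotens_rr V) (cotens_rr W),
    forall y, cotens_incl (g y) = tmap f idfun (cotens_incl y).
Proof.
have [y|g gE] := lift_injective (g := tmap f idfun \o @cotens_incl V : {linear _ -> _})
  (@cotens_incl_inj W).
  by apply: cotens_onto; apply: (cotensor_elt_map f); apply: cotens_inclP.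
have gE' y : cotens_incl (g y) = tmap f idfun (cotens_incl y) := gE y.
have ga : ract_mor (@cotens_act V) (@cotens_act W) g.
  move=> y a; apply: cotens_incl_inj; rewrite gE' !cotens_actE gE' /tens_mulr.
  rewrite tmap_tlift tlift_tmap; last by lin.
  by apply: eq_tlift => v h; rewrite tmapE.
have gc : rcoact_mor (@cotens_coact V) (@cotens_coact W) g.
  move=> y; apply: (tmap_injective (g := @idfun H) (@cotens_incl_inj W) (@inj_id H)).
  rewrite cotens_coactE gE' -[LHS]tlift_tens tens_coactE; last by lin.
  rewrite tlift_tmap; last by lin.
  rewrite tmap_comp tlift_eq_tmap.
  under [RHS]eq_tlift => x h do rewrite [X in X \ox _]gE'.
  rewrite (cotens_coact_incl (F := fun z h => tmap f idfun z \ox h)); last by lin.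
  by apply: eq_tlift => v h; apply: eq_tlift => h1 h2; rewrite tmapE.
by exists (rr_mor (M := cotens_rr V) (N := cotens_rr W) ga gc).
Qed.

Definition cotens_map (V W : RM) (f : hom V W) := sval (cid (cotens_map_exists f)).

Lemma cotens_mapE (V W : RM) (f : hom V W) y :
  cotens_incl (cotens_map f y) = tmap f idfun (cotens_incl y).
Proof. exact: (svalP (cid (cotens_map_exists f))). Qed.

Definition cotens_functor : functor RM RR.
Proof.
apply: (@Functor RM RR cotens_rr cotens_map).
- move=> V W f g fg y; apply: cotens_incl_inj; rewrite !cotens_mapE.
  exact: eq_tmap.
- move=> V y; apply: cotens_incl_inj; rewrite cotens_mapE -[RHS]tmap_id.
  exact: eq_tmap.
- move=> V W U g f y; apply: cotens_incl_inj; rewrite !cotens_mapE tmap_comp.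
  exact: eq_tmap.
Defined.

(** * The left adjoint M |-> M / M A^+ *)

Section Reduction.
Variable M : RR.
Let ab : bilinear_map (@rr_act k H I M) := ract_bilin (rr_actP M).
Let rho := @rr_coact k H I M.
Let MA : lmodType k := tensor (rr_car M) A.

Let lrho : lin rho. Proof. exact: (rcoact_linear (rr_coactP M)). Qed.
Let ldA := coinv_coact_lin.
Let lj : lin j. Proof. by move=> a x y; apply: linearP. Qed.

Definition underlying : HC := Rcomod (rr_coactP M).

Lemma rr_coact_act (W : lmodType k) (F : rr_car M -> H -> W) m a : bilinear_map F ->
  tlift F (rho (rr_act m a)) =
  tlift (fun m0 m1 => tlift (fun b h => F (rr_act m0 b) (m1 * h)) (coinv_coact a)) (rho m).
Proof.
move=> bF; have [t /coinv_coact_unique -> E] := rr_compat m a.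
rewrite /rho E tmap2_tlift tlift_tlift //; apply: eq_tlift => m0 m1.
by rewrite tlift_tlift //; apply: eq_tlift => b h; rewrite tliftE.
Qed.

(** With this coaction on M (x) A the relations of M / M A^+ form a comodule map, and
    [push_cotensor] describes the cotensor product of M (x) A with H. *)
Definition diag_coact (x : MA) : MA \ox H := tlift (fun m a =>
  tlift (fun m0 m1 => tlift (fun b h => (m0 \ox b) \ox (m1 * h)) (coinv_coact a)) (rho m)) x.

Lemma diag_coactE (W : lmodType k) (F : MA -> H -> W) m a : bilinear_map F ->
  tlift F (diag_coact (m \ox a)) =
  tlift (fun m0 m1 => tlift (fun b h => F (m0 \ox b) (m1 * h)) (coinv_coact a)) (rho m).
Proof.
move=> bF; rewrite /diag_coact tliftE; last by lin.
rewrite tlift_tlift //; apply: eq_tlift => m0 m1.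
by rewrite tlift_tlift //; apply: eq_tlift => b h; rewrite tliftE.
Qed.

Lemma diag_right_coaction : right_coaction diag_coact.
Proof.
have ld : lin diag_coact by rewrite /diag_coact; lin.
split=> [|x|x]; first exact: ld.
  rewrite (tassoc_tlift _ ld) tmap_idl_tlift; move: x; apply: tens_lin_ext; [lin|lin|] => m a.
  rewrite !diag_coactE; [|by lin..].
  transitivity (tlift (fun m0 m1 => tlift (fun m00 m01 => tlift (fun b h => tlift (fun b0 b1 =>
     (m00 \ox b0) \ox (m01 * b1 \ox (m1 * h))) (coinv_coact b)) (coinv_coact a)) (rho m0)) (rho m)).
    apply: eq_tlift => m0 m1; rewrite [RHS]tlift_exchange; apply: eq_tlift => b h.
    by rewrite diag_coactE //; lin.
  rewrite (@rcoact_coassocH underlying _ (fun u g q => tlift (fun b h => tlift (fun b0 b1 =>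
     (u \ox b0) \ox (g * b1 \ox (q * h))) (coinv_coact b)) (coinv_coact a))); last by lin.
  apply: eq_tlift => m0 m1.
  under eq_tlift => g q.
    rewrite (@rcoact_coassocH (Rcomod coinv_coactP) _ (fun u b1 h => (m0 \ox u) \ox (g * b1 \ox (q * h))));
      last by lin.
    over.
  rewrite tlift_exchange; apply: eq_tlift => b h /=.
  by rewrite comulM_tlift //; lin.
move: x; apply: tens_lin_ext; [lin|lin|] => m a.
rewrite diag_coactE; last by lin.
under eq_tlift => m0 m1.
  under eq_tlift do rewrite counitM -scalerA -tensZr.
  rewrite -(tlift_lin (g := fun z => counit m1 *: z)); last by lin.
  rewrite -(tlift_lin (g := fun z => m0 \ox z)); last by lin.
  rewrite (rcoact1 coinv_coactP) -tensZl.
  over.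
by rewrite -(tlift_lin (g := fun z => z \ox a)) ?(rcoact1 (rr_coactP M)) //; lin.
Qed.

Definition diag_rcomod : HC := Rcomod diag_right_coaction.

(** Its image is M A^+, where A^+ is the kernel of the counit on A. *)
Definition augment (x : MA) : rr_car M :=
  tlift (fun m a => rr_act m a - counit (j a) *: m) x.

Lemma augmentE m a : augment (m \ox a) = rr_act m a - counit (j a) *: m.
Proof. by rewrite /augment tliftE //; lin. Qed.

Lemma augment_linear : linear augment.
Proof. by apply: tlift_linear; lin. Qed.

(** The comparison takes place over C: there the term with the counit gives m0 (x) pi(m1 a) = m0 (x)
    m1 pi(a), which is counit(a) m0 (x) pi(m1) because pi(a) = counit(a) 1_C. *)
Lemma augment_rcoact_mor : rcoact_mor (@rcoact k C (push_rcomod diag_rcomod))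
  (@rcoact k C (push_rcomod underlying)) (linmap augment_linear).
Proof.
have ld : lin diag_coact := rcoact_linear diag_right_coaction.
have la : lin augment := augment_linear.
have lp := push_coact_lin (X := underlying); have lp' := push_coact_lin (X := diag_rcomod).
move=> x; move: x; apply: tens_lin_ext; [lin|lin|] => m a.
transitivity (tlift (fun m0 m1 => tlift (fun b h =>
  augment (m0 \ox b) \ox pi (m1 * h)) (coinv_coact a)) (rho m)); last first.
  rewrite tlift_eq_tmap; apply/esym.
  apply: etrans (@push_coactE diag_rcomod _ (fun x c => augment x \ox c) (m \ox a) _) _; first by lin.
  by apply: (@diag_coactE _ (fun x h => augment x \ox pi h)); lin.
rewrite /= augmentE [LHS](linB _ _ lp) (linZ _ _ lp).
under [RHS]eq_tlift => m0 m1.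
  under eq_tlift do rewrite augmentE tensDl -scaleN1r tensZl scaleN1r.
  rewrite tlift_sub.
  under [X in _ - X]eq_tlift do rewrite tensZl.
  rewrite (coinv_coact_counit (f := fun h => m0 \ox pi (m1 * h))); last by lin.
  rewrite -factor_actE coinv_pi (bilinZr cb) factor_act_one tensZr.
  over.
rewrite tlift_sub; congr (_ - _).
  rewrite -[LHS]tlift_tens push_coactE; last by lin.
  by rewrite [LHS]rr_coact_act //; lin.
rewrite -(tlift_lin (g := fun z => counit (j a) *: z)); last by lin.
by congr (_ *: _).
Qed.

Definition augment_mor : hom (push_rcomod diag_rcomod) (push_rcomod underlying) :=
  rcomod_mor augment_rcoact_mor.

Let coker := cid (ab_cokernel (rcomod_abelian C) augment_mor).
Definition reduced : RM := projT1 coker.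
Definition reduced_proj : hom (push_rcomod underlying) reduced := projT1 (cid (projT2 coker)).

Lemma reduced_proj_onto y : exists x, reduced_proj x = y.
Proof. by have [] := projT2 (cid (projT2 coker)). Qed.

Lemma reduced_proj_eq0 x : reduced_proj x = 0 <-> exists y, augment y = x.
Proof. by have [_] := projT2 (cid (projT2 coker)). Qed.

Lemma reduced_proj_act m a : reduced_proj (rr_act m a) = counit (j a) *: reduced_proj m.
Proof.
apply/eqP; rewrite -subr_eq0 -linearZ -linearB; apply/eqP/reduced_proj_eq0.
by exists (m \ox a); rewrite augmentE.
Qed.

Lemma reduced_ext (U : lmodType k) (f g : rcomod_car reduced -> U) :
  (forall m, f (reduced_proj m) = g (reduced_proj m)) -> forall y, f y = g y.
Proof. by move=> fg y; have [x <-] := reduced_proj_onto y. Qed.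

Lemma reduced_lift (V : RM) (f : hom (push_rcomod underlying) V) :
  (forall m a, f (rr_act m a) = counit (j a) *: f m) ->
  exists g : hom reduced V, forall m, g (reduced_proj m) = f m.
Proof.
move=> fa; have [|g gE] := lift_surjective (g := f : {linear _ -> rcomod_car V}) reduced_proj_onto.
  move=> x /reduced_proj_eq0 [y <-]; have lb : lin augment by apply: augment_linear.
  have l0 : lin (fun _ : MA => 0 : rcomod_car V) by move=> b u v; rewrite scaler0 addr0.
  move: y; apply: (tens_lin_ext _ l0); [lin|] => m a.
  by rewrite augmentE linearB linearZ /= fa subrr.
have gc : rcoact_mor (@rcoact k C reduced) (@rcoact k C V) g.
  apply: (ab_lift_surj (rcomod_abelian C) (p := reduced_proj) (u := g) reduced_proj_onto).
  by rewrite (_ : (fun x => g _) = f); [exact: (cmorP f) | exact/funext].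
by exists (rcomod_mor gc).
Qed.

End Reduction.

Lemma push_mor_rcoact (M N : RR) (f : hom M N) :
  rcoact_mor (push_coact (X := underlying M)) (push_coact (X := underlying N)) f.
Proof.
move=> m; rewrite /push_coact [@rcoact k H (underlying N) (f m)]((cmorP f).2 m).
apply: etrans (@tmap_comp k _ _ _ _ _ _ f idfun idfun pi (rr_coact m)) _.
exact: esym (@tmap_comp k _ _ _ _ _ _ idfun pi f idfun (rr_coact m)).
Qed.

Definition push_mor (M N : RR) (f : hom M N) :
    hom (push_rcomod (underlying M)) (push_rcomod (underlying N)) :=
  rcomod_mor (V := push_rcomod (underlying M)) (W := push_rcomod (underlying N))
    (push_mor_rcoact f).

Lemma reduced_map_exists (M N : RR) (f : hom M N) : exists g : hom (reduced M) (reduced N),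
  forall m, g (reduced_proj M m) = reduced_proj N (f m).
Proof.
apply: (@reduced_lift M (reduced N) (cmp (reduced_proj N) (push_mor f))) => m a.
by rewrite /= (cmorP f).1 reduced_proj_act.
Qed.

Definition reduced_map (M N : RR) (f : hom M N) := sval (cid (reduced_map_exists f)).

Lemma reduced_mapE (M N : RR) (f : hom M N) m :
  reduced_map f (reduced_proj M m) = reduced_proj N (f m).
Proof. exact: (svalP (cid (reduced_map_exists f))). Qed.

Definition reduction_functor : functor RR RM.
Proof.
apply: (@Functor RR RM reduced reduced_map).
- by move=> M N f g fg; apply: reduced_ext => m; rewrite !reduced_mapE fg.
- by move=> M; apply: reduced_ext => m; rewrite !reduced_mapE.
- by move=> M N P g f; apply: reduced_ext => m; rewrite /= !reduced_mapE.
Defined.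

Section Unit.
Variable M : RR.
Let ab : bilinear_map (@rr_act k H I M) := ract_bilin (rr_actP M).
Let rho := @rr_coact k H I M.
Let p := reduced_proj M.

Let lrho : lin rho. Proof. exact: (rcoact_linear (rr_coactP M)). Qed.
Let lp : lin p. Proof. by move=> a x y; apply: linearP. Qed.

Definition reduction_unit_fun (m : rr_car M) : tensor (rcomod_car (reduced M)) H :=
  tmap p idfun (rho m).

Lemma reduction_unit_linear : linear reduction_unit_fun.
Proof. by change (lin reduction_unit_fun); rewrite /reduction_unit_fun; lin. Qed.

Lemma coact_cotensor (m : rr_car M) : cotensor_elt (V := push_rcomod (underlying M)) (rho m).
Proof.
apply/cotensor_eltP.
transitivity (tlift (fun n h => tlift (fun n0 h0 => n0 \ox (pi h0 \ox h)) (rho n)) (rho m)).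
  apply: eq_tlift => n h.
  by apply: (@push_coactE (underlying M) _ (fun n0 c => n0 \ox (c \ox h))); lin.
by apply: (@rcoact_coassocH (underlying M) _ (fun n g h => n \ox (pi g \ox h))); lin.
Qed.

Lemma reduction_unit_exists : exists u : hom M (cotens_rr (reduced M)),
  forall m, cotens_incl (u m) = reduction_unit_fun m.
Proof.
have [m|u uE] := lift_injective (g := linmap reduction_unit_linear) (@cotens_incl_inj (reduced M)).
  by apply: cotens_onto; apply: (cotensor_elt_map p); apply: coact_cotensor.
have ua : ract_mor (@rr_act k H I M) (@cotens_act (reduced M)) u.
  move=> m a; apply: cotens_incl_inj; rewrite cotens_actE !uE /= /reduction_unit_fun /tens_mulr.
  rewrite tlift_tmap; last by lin.
  rewrite tlift_eq_tmap /rho rr_coact_act; last by lin.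
  apply: eq_tlift => m0 m1.
  under eq_tlift do rewrite reduced_proj_act tensZl.
  by rewrite (coinv_coact_counit (f := fun h => p m0 \ox (m1 * h))); last by lin.
have uc : rcoact_mor (@rr_coact k H I M) (@cotens_coact (reduced M)) u.
  move=> m; apply: (tmap_injective (g := @idfun H) (@cotens_incl_inj (reduced M)) (@inj_id H)).
  rewrite cotens_coactE uE -[linmap _ m]/(reduction_unit_fun m) /reduction_unit_fun.
  rewrite -[LHS]tlift_tens tens_coactE; last by lin.
  rewrite tlift_tmap; last by lin.
  rewrite tmap_comp tlift_eq_tmap.
  transitivity (tlift (fun n h => tlift (fun n0 h0 => (p n0 \ox h0) \ox h) (rho n)) (rho m)).
    by rewrite (@rcoact_coassocH (underlying M) _ (fun n g h => (p n \ox g) \ox h)); last by lin.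
  apply: eq_tlift => n h; rewrite [X in X \ox _]uE -[linmap _ n]/(reduction_unit_fun n) /reduction_unit_fun.
  by rewrite tlift_eq_tmap (tlift_lin (g := fun z => z \ox h)) //; lin.
by exists (rr_mor (M := M) (N := cotens_rr (reduced M)) ua uc).
Qed.

Definition reduction_unit := sval (cid reduction_unit_exists).

Lemma reduction_unitE m : cotens_incl (reduction_unit m) = tmap p idfun (rho m).
Proof. exact: (svalP (cid reduction_unit_exists)). Qed.

End Unit.

Section Counit.
Variable V : RM.
Let rho := @rcoact k C V.
Let lrho : lin rho. Proof. by rewrite /rho; lin. Qed.

Definition eval_counit (y : tensor (rcomod_car V) H) : rcomod_car V :=
  tlift (fun v h => counit h *: v) y.

Lemma eval_counit_lin : lin eval_counit.
Proof. by rewrite /eval_counit; lin. Qed.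

Lemma reduction_counit_exists : exists e : hom (reduced (cotens_rr V)) V,
  forall y, e (reduced_proj (cotens_rr V) y) = eval_counit (cotens_incl y).
Proof.
have le := eval_counit_lin.
have lf : linear (fun y : cotens V => eval_counit (cotens_incl y)).
  by change (lin (fun y : cotens V => eval_counit (cotens_incl y))); lin.
have fc : rcoact_mor (push_coact (X := underlying (cotens_rr V))) rho (linmap lf).
  move=> y; rewrite tlift_eq_tmap.
  apply: etrans (esym (@push_coactE (underlying (cotens_rr V)) _
    (fun x c => linmap lf x \ox c) y _)); last by lin.
  rewrite /= (cotens_coact_incl (F := fun z h => eval_counit z \ox pi h)); last by lin.
  rewrite /eval_counit (tlift_lin (g := rho)) //.
  have tF : trilin (fun (v : rcomod_car V) (c : C) (h : H) => counit h *: (v \ox c)) by lin.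
  transitivity (tlift (fun v h => tlift (fun v0 c => counit h *: (v0 \ox c)) (rho v)) (cotens_incl y)).
    apply: eq_tlift => v h; rewrite (linZ _ _ lrho) -{1}[rho v]tlift_tens.
    by rewrite (tlift_lin (g := fun z => counit h *: z)) //; lin.
  rewrite (cotensor_sum (cotens_inclP y) tF); apply: eq_tlift => v h.
  rewrite (tlift_counitr (f := fun h => v \ox pi h)); last by lin.
  under [RHS]eq_tlift => h1 h2.
    rewrite tliftE; last by lin.
    rewrite tensZl.
    over.
  by rewrite (tlift_counitl (f := fun h => v \ox pi h)); last by lin.
have [|e eE] := @reduced_lift (cotens_rr V) V (rcomod_mor (V := push_rcomod (underlying (cotens_rr V))) fc).
  move=> y a; change (eval_counit (cotens_incl (cotens_act y a)) = counit (j a) *: eval_counit (cotens_incl y)).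
  rewrite cotens_actE /eval_counit /tens_mulr tlift_tlift; last by lin.
  rewrite (tlift_lin (g := fun z => counit (j a) *: z)); last by lin.
  apply: eq_tlift => v h; rewrite tliftE; last by lin.
  by rewrite counitM scalerA mulrC.
by exists e.
Qed.

Definition reduction_counit := sval (cid reduction_counit_exists).

Lemma reduction_counitE y :
  reduction_counit (reduced_proj (cotens_rr V) y) = eval_counit (cotens_incl y).
Proof. exact: (svalP (cid reduction_counit_exists)). Qed.

(** Stated apart from the adjunction because it also computes the kernel and the cokernel of the
    counit. *)
Lemma reduction_triangle (y : cotens V) :
  cotens_map reduction_counit (reduction_unit (cotens_rr V) y) = y.
Proof.
have le := eval_counit_lin.
apply: cotens_incl_inj; rewrite cotens_mapE reduction_unitE tmap_comp tlift_eq_tmap.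
under eq_tlift => x h do rewrite [X in X \ox _]reduction_counitE.
rewrite (cotens_coact_incl (F := fun z h => eval_counit z \ox h)); last by lin.
rewrite -[RHS]tlift_tens; apply: eq_tlift => v h.
under eq_tlift => h1 h2.
  rewrite /eval_counit tliftE; last by lin.
  rewrite tensZl.
  over.
by rewrite (tlift_counitl (f := fun h => v \ox h)); last by lin.
Qed.

End Counit.

Definition reduction_adjunction : adjunction reduction_functor cotens_functor.
Proof.
apply: (@Adjunction RM RR reduction_functor cotens_functor reduction_unit reduction_counit).
- move=> M N f m; apply: cotens_incl_inj.
  rewrite cotens_mapE !reduction_unitE (cmorP f).2 !tmap_comp.
  by apply: eq_tmap => // x /=; rewrite reduced_mapE.
- move=> V W f; apply: reduced_ext => y.
  rewrite /= reduced_mapE !reduction_counitE cotens_mapE /eval_counit.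
  rewrite tlift_tmap; last by lin.
  rewrite tlift_linear_map; apply: eq_tlift => v h.
  by rewrite linearZ.
- move=> M; apply: reduced_ext => m.
  rewrite /= reduced_mapE reduction_counitE reduction_unitE /eval_counit.
  rewrite tlift_tmap; last by lin.
  rewrite -[in RHS](rcoact1 (rr_coactP M) m) tlift_linear_map.
  by apply: eq_tlift => n h; rewrite linearZ.
- exact: reduction_triangle.
Defined.

Variable S' : H -> H.
Hypotheses (SK : cancel S S') (S'K : cancel S' S).
Hypothesis coflat : left_coflat (H_lcomod I).

(** By coflatness [y] lifts to M []_C H, whose elements are sums of m0 (x) m1 a. The image of such a
    term is the unit at m multiplied by a, that is, the unit at m a. *)
Lemma reduction_unit_surjective M y : exists m, reduction_unit M m = y.
Proof.
have [z zy] := tmap_surjective (g := @idfun H) (@reduced_proj_onto M)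
  (fun y => ex_intro _ y erefl) (cotens_incl y).
have [|x xP xE] := @coflat_lift _ _ _ coflat _ _ (reduced_proj M) z.
  by rewrite zy; apply: cotens_inclP.
have [t tE] := push_cotensor xP.
have ab : bilinear_map (@rr_act k H I M) := ract_bilin (rr_actP M).
have lrho : lin (@rr_coact k H I M) := rcoact_linear (rr_coactP M).
exists (tlift (fun m a => rr_act m a) t); apply: cotens_incl_inj.
rewrite reduction_unitE -zy -[RHS]xE tE !tmap_tlift.
rewrite (tlift_lin (g := fun m => tmap (reduced_proj M) idfun (rr_coact m))); last by lin.
apply: eq_tlift => m a; rewrite -reduction_unitE (cmorP (reduction_unit M)).1 cotens_actE.
rewrite reduction_unitE tmap_tlift /tens_mulr tlift_tmap; last by lin.
by apply: eq_tlift => m0 m1; rewrite tmapE.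
Qed.

(** If the unit kills m, then rho(m) comes from (M (x) A) (x) H, and by coflatness from its cotensor
    part, hence from a sum of u0 (x) u1 a with u in M (x) A. Undoing n (x) h |-> n0 (x) n1 h leaves
    m (x) 1 = sum of (n b (x) a - n (x) b a) in M (x) A, and the action of A sends this to m = 0. *)
Lemma reduction_unit_injective M : injective (reduction_unit M).
Proof.
have ab : bilinear_map (@rr_act k H I M) := ract_bilin (rr_actP M).
have lrho : lin (@rr_coact k H I M) := rcoact_linear (rr_coactP M).
have lj : lin j by move=> a x y; apply: linearP.
have lau : lin (@augment M) := @augment_linear M.
suff M0 m : reduction_unit M m = 0 -> m = 0.
  move=> x y xy; apply/eqP; rewrite -subr_eq0; apply/eqP/M0.
  by rewrite linearB xy subrr.
move=> /(congr1 cotens_incl); rewrite reduction_unitE linear0 => pm0.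
have [|z zE] := tmap_kerl (i := augment_mor M) _ pm0; first by move=> x /reduced_proj_eq0.
have [|x xP xE] := @coflat_lift _ _ _ coflat _ _ (augment_mor M) z.
  by rewrite zE; apply: coact_cotensor.
have [t tE] := push_cotensor xP.
(* The left inverse of n (x) h |-> n0 (x) n1 h, obtained from the antipode; it sends rho(m) to m (x)
   1. *)
pose psi (u : tensor (rr_car M) H) : tensor (rr_car M) H :=
  tlift (fun n h => tlift (fun n0 n1 => n0 \ox (S n1 * h)) (rr_coact n)) u.
have lpsi : lin psi by rewrite /psi; lin.
have psiE n h : psi (tlift (fun n0 n1 => n0 \ox (n1 * h)) (rr_coact n)) = n \ox h.
  rewrite /psi tlift_tlift; last by lin.
  under eq_tlift => n0 n1.
    rewrite tliftE; last by lin.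
    under eq_tlift do rewrite mulrA.
    over.
  rewrite (@rcoact_coassocH (underlying M) _ (fun u g w => u \ox (S g * w * h))); last by lin.
  under eq_tlift => n0 n1.
    rewrite (tlift_antipodel (f := fun g => n0 \ox (g * h))) ?mul1r; last by lin.
    over.
  rewrite -[in RHS](rcoact1 (rr_coactP M) n) (tlift_lin (g := fun z => z \ox h)); last by lin.
  by apply: eq_tlift => x0 x1; rewrite tensZl.
pose d (x : tensor (rr_car M) A) (a : A) : tensor (rr_car M) A :=
  tlift (fun n b => rr_act n b \ox a - n \ox (b * a)) x.
have ld : bilinear_map d by rewrite /d; lin.
have dE n b a : d (n \ox b) a = rr_act n b \ox a - n \ox (b * a) by rewrite /d tliftE //; lin.
have E : tmap idfun j (tlift d t) = tmap idfun j (m \ox (1 : A)).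
  have -> : tmap idfun j (m \ox (1 : A)) = psi (rr_coact m).
    rewrite tmapE -[LHS]psiE; congr psi.
    by rewrite -[RHS]tlift_tens; apply: eq_tlift => n0 n1; rewrite mulr1.
  rewrite -zE -xE tE tmap_tlift tmap_tlift (tlift_lin (g := psi)) //.
  apply: eq_tlift => u a.
  rewrite [in RHS]tmap_tlift.
  have lL : lin (fun u => tmap idfun j (d u a)) by lin.
  have lR : lin (fun u => psi (tlift (fun x0 x1 => augment x0 \ox (x1 * j a)) (diag_coact u))).
    have ldc : lin (@diag_coact M) := rcoact_linear (diag_right_coaction M).
    apply: (lin_comp lpsi); apply: lin_comp ldc; apply: tlift_linear; lin.
  transitivity (psi (tlift (fun x0 x1 => augment x0 \ox (x1 * j a)) (diag_coact u))); last first.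
    by congr psi; apply: eq_tlift => x0 x1; rewrite tmapE.
  apply: (tens_lin_ext lL lR) => n b.
  rewrite dE tmapB !tmapE diag_coactE; last by lin.
  under eq_tlift => n0 n1.
    under eq_tlift do rewrite augmentE tensDl -scaleN1r tensZl scaleN1r.
    rewrite tlift_sub.
    under [X in _ - X]eq_tlift do rewrite tensZl.
    rewrite (coinv_coact_counit (f := fun h => n0 \ox (n1 * h * j a))); last by lin.
    over.
  rewrite tlift_sub (linB _ _ lpsi); congr (_ - _).
    by rewrite -psiE rr_coact_act //; lin.
  rewrite -psiE; congr psi; apply: eq_tlift => n0 n1.
  by rewrite -mulrA.
have {E}dt := tmap_injective (f := @idfun (rr_car M)) (g := j) (@inj_id _)
  (@coinv_val_inj k H I) E.
have := congr1 (tlift (fun n a => rr_act n a)) dt.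
rewrite tliftE // (ract1 (rr_actP M)) => <-; rewrite tlift_tlift //.
have l0 (V : lmodType k) : lin (fun _ : V => 0 : rr_car M) by move=> b u v; rewrite scaler0 addr0.
move: (t); apply: (@tens_lin_ext _ _ _ _ _ (fun=> 0)); [lin|exact: l0|] => u a.
rewrite tliftE; last by lin.
have lx : lin (fun x => tlift (fun n a => rr_act n a) (d x a)) by lin.
apply: (tens_lin_ext lx (l0 _)) => n b.
rewrite dE (tliftD ab) -scaleN1r -tensZl !tliftE // (bilinZl ab) scaleN1r.
by rewrite (ractM (rr_actP M)) subrr.
Qed.

Lemma cotens_functor_iso (V W : RM) (f : hom V W) :
  serre_iso (@rcomod_T k H I) f -> is_iso (fmap cotens_functor f).
Proof.
move=> [[K [i [/(is_kernelP (rcomod_abelian C)) [iinj iP] K0]]]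
        [Q [p [/(is_cokernelP (rcomod_abelian C)) [psurj pP] Q0]]]].
move/(rcomod_TP SK S'K coflat): K0 => K0; move/(rcomod_TP SK S'K coflat): Q0 => Q0.
have finj : injective (cotens_map f).
  suff f0 x : cotens_map f x = 0 -> x = 0.
    move=> x y xy; apply/eqP; rewrite -subr_eq0; apply/eqP/f0.
    by rewrite linearB xy subrr.
  move=> /(congr1 cotens_incl); rewrite cotens_mapE linear0 => fx0.
  have [|y yE] := tmap_kerl (i := i) _ fx0; first by move=> v /iP.
  apply: cotens_incl_inj; rewrite -yE linear0 (K0 y) ?tmap0 //.
  by apply: (cotensor_reflect (j := i)) => //; rewrite yE; apply: cotens_inclP.
apply: is_isoP => // [u uE|y].
  split=> [x a|x].
    by apply: finj; rewrite uE (cmorP (cotens_map f)).1 uE.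
  apply: (tmap_injective (g := @idfun H) finj (@inj_id H)).
  rewrite -[LHS]((cmorP (cotens_map f)).2 (u x)) uE [RHS]tmap_comp -[LHS]tmap_id.
  by apply: eq_tmap => // z; rewrite /= uE.
have [||z zE] := tmap_kerl (i := f) (f := p) _ (t := cotens_incl y).
- by move=> w /pP.
- by apply: Q0; apply: (cotensor_elt_map p); apply: cotens_inclP.
have [|x xP xE] := @coflat_lift _ _ _ coflat _ _ f z.
  by rewrite zE; apply: cotens_inclP.
have [x' x'E] := cotens_onto xP.
by exists x'; apply: cotens_incl_inj; rewrite cotens_mapE x'E xE.
Qed.

(** After cotensoring with H the counit becomes invertible, by the triangle identity and the
    surjectivity of the unit; hence its kernel and cokernel have zero cotensor product with H. *)
Lemma reduction_counit_serre_iso (V : RM) : serre_iso (@rcomod_T k H I) (reduction_counit V).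
Proof.
split.
  have [K [i [iinj iP]]] := ab_kernel (rcomod_abelian C) (reduction_counit V).
  exists K, i; split; first exact/(is_kernelP (rcomod_abelian C)).
  apply/(rcomod_TP SK S'K coflat) => x xP; apply: (tmap_injective (f := i) (g := @idfun H) iinj (@inj_id H)).
  rewrite tmap0.
  have [y yE] := cotens_onto (cotensor_elt_map i xP).
  have [z zy] := reduction_unit_surjective y.
  rewrite -yE -zy (_ : z = 0) ?linear0 //.
  rewrite -[z]reduction_triangle zy; apply: cotens_incl_inj; rewrite linear0 cotens_mapE yE tmap_comp.
  by rewrite tmap0l // => w /=; apply/iP; exists w.
have [Q [p [psurj pP]]] := ab_cokernel (rcomod_abelian C) (reduction_counit V).
exists Q, p; split; first exact/(is_cokernelP (rcomod_abelian C)).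
apply/(rcomod_TP SK S'K coflat) => q qP.
have [z zq] := tmap_surjective (g := @idfun H) psurj (fun y => ex_intro _ y erefl) q.
have [|x xP xE] := @coflat_lift _ _ _ coflat _ _ p z; first by rewrite zq.
have [y yE] := cotens_onto xP.
rewrite -zq -[LHS]xE -yE -[y]reduction_triangle cotens_mapE [LHS]tmap_comp.
by rewrite tmap0l // => w /=; apply/pP; exists w.
Qed.

Lemma rcomod_localization : localization (@rcomod_T k H I) reduction_adjunction.
Proof.
split.
- exact: (rcomod_T_serre SK S'K coflat).
- move=> M; apply: is_isoP => [u uE||].
  + split=> [x a|x]; first by apply: reduction_unit_injective; rewrite uE (cmorP (reduction_unit M)).1 uE.
    apply: (tmap_injective (g := @idfun H) (@reduction_unit_injective M) (@inj_id H)).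
    rewrite -[LHS]((cmorP (reduction_unit M)).2 (u x)) uE [RHS]tmap_comp -[LHS]tmap_id.
    by apply: eq_tmap => // z; rewrite /= uE.
  + exact: reduction_unit_injective.
  + exact: reduction_unit_surjective.
- exact: cotens_functor_iso.
- exact: reduction_counit_serre_iso.
Qed.

End RelativeHopfModules.

(** * Equivalences that do not change the underlying vector spaces *)

Section ConcreteEquivalence.
Variable k : fieldType.
Variables (T1 : Type) (car1 : T1 -> lmodType k).
Variable mor1 : forall X Y, (car1 X -> car1 Y) -> Prop.
Hypothesis mor_id1 : forall X, mor1 (fun x : car1 X => x).
Hypothesis mor_cmp1 : forall X Y Z (g : {linear car1 Y -> car1 Z})
  (f : {linear car1 X -> car1 Y}), mor1 g -> mor1 f -> mor1 (fun x => g (f x)).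
Variables (T2 : Type) (car2 : T2 -> lmodType k).
Variable mor2 : forall X Y, (car2 X -> car2 Y) -> Prop.
Hypothesis mor_id2 : forall X, mor2 (fun x : car2 X => x).
Hypothesis mor_cmp2 : forall X Y Z (g : {linear car2 Y -> car2 Z})
  (f : {linear car2 X -> car2 Y}), mor2 g -> mor2 f -> mor2 (fun x => g (f x)).
Variables (F : T1 -> T2) (G : T2 -> T1).
Variables (a : forall X, {linear car1 X -> car2 (F X)}) (a' : forall X, {linear car2 (F X) -> car1 X}).
Variables (b : forall Y, {linear car2 Y -> car1 (G Y)}) (b' : forall Y, {linear car1 (G Y) -> car2 Y}).
Hypotheses (aK : forall X, cancel (a X) (a' X)) (a'K : forall X, cancel (a' X) (a X)).
Hypotheses (bK : forall Y, cancel (b Y) (b' Y)) (b'K : forall Y, cancel (b' Y) (b Y)).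
Hypothesis Fmor : forall X X' (f : {linear car1 X -> car1 X'}),
  mor1 f -> mor2 (fun x => a X' (f (a' X x))).
Hypothesis Gmor : forall Y Y' (f : {linear car2 Y -> car2 Y'}),
  mor2 f -> mor1 (fun x => b Y' (f (b' Y x))).
Hypothesis GF : forall X, mor1 (fun x : car1 X => b (F X) (a X x)) /\
  mor1 (fun x : car1 (G (F X)) => a' X (b' (F X) x)).
Hypothesis FG : forall Y, mor2 (fun y : car2 Y => a (G Y) (b Y y)) /\
  mor2 (fun y : car2 (F (G Y)) => b' Y (a' (G Y) y)).

Let C1 := concrete_category mor_id1 mor_cmp1.
Let C2 := concrete_category mor_id2 mor_cmp2.

(** The linear bijections [a], [a'], [b], [b'] are identities in all applications. They are
    parameters because for abstract [F] and [G] the carriers of [X] and [F X] are not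
    convertible. *)
Definition transfer_functor : functor C1 C2.
Proof.
apply: (@Functor C1 C2 F (fun X Y f =>
  @Cmor k T2 car2 mor2 (F X) (F Y) (a Y \o (f \o a' X)) (Fmor (cmorP f)))).
- by move=> X Y f g fg x; rewrite /= fg.
- by move=> X x; rewrite /= a'K.
- by move=> X Y Z g f x; rewrite /= aK.
Defined.

Definition transfer_functor_back : functor C2 C1.
Proof.
apply: (@Functor C2 C1 G (fun X Y f =>
  @Cmor k T1 car1 mor1 (G X) (G Y) (b Y \o (f \o b' X)) (Gmor (cmorP f)))).
- by move=> X Y f g fg x; rewrite /= fg.
- by move=> X x; rewrite /= b'K.
- by move=> X Y Z g f x; rewrite /= bK.
Defined.

Definition transfer_unit : natural_iso (functor_cmp transfer_functor_back transfer_functor) (functor_id C1).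
Proof.
apply: (@NaturalIso C1 C1 (functor_cmp transfer_functor_back transfer_functor) (functor_id C1)
  (fun X => @Cmor k T1 car1 mor1 (G (F X)) X (a' X \o b' (F X)) (GF X).2)
  (fun X => @Cmor k T1 car1 mor1 X (G (F X)) (b (F X) \o a X) (GF X).1)).
- by move=> X Y f x; rewrite /= bK aK.
- by move=> X x; rewrite /= a'K b'K.
- by move=> X x; rewrite /= bK aK.
Defined.

Definition transfer_counit : natural_iso (functor_cmp transfer_functor transfer_functor_back) (functor_id C2).
Proof.
apply: (@NaturalIso C2 C2 (functor_cmp transfer_functor transfer_functor_back) (functor_id C2)
  (fun Y => @Cmor k T2 car2 mor2 (F (G Y)) Y (b' Y \o a' (G Y)) (FG Y).2)
  (fun Y => @Cmor k T2 car2 mor2 Y (F (G Y)) (a (G Y) \o b Y) (FG Y).1)).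
- by move=> X Y f x; rewrite /= aK bK.
- by move=> X x; rewrite /= b'K a'K.
- by move=> X x; rewrite /= aK bK.
Defined.

Definition concrete_equivalence : adjoint_equivalence transfer_functor transfer_functor_back.
Proof.
apply: (@AdjointEquivalence _ _ _ _ transfer_unit transfer_counit).
- by move=> X x; rewrite /= a'K.
- by move=> Y y; rewrite /= b'K.
Defined.

End ConcreteEquivalence.

(** * Change of side along anti-isomorphisms of algebras and coalgebras *)

Section AntiIsomorphicAlgebras.
Variables (k : fieldType) (A B : algType k).
Variables (s : {linear A -> B}) (t : {linear B -> A}).
Hypotheses (sK : cancel s t) (tK : cancel t s).
Hypotheses (s1 : s 1 = 1) (sM : forall x y, s (x * y) = s y * s x).

Lemma anti_inverse1 : t 1 = 1. Proof. by rewrite -s1 sK. Qed.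

Lemma anti_inverseM x y : t (x * y) = t y * t x.
Proof. by rewrite -[RHS]sK sM !tK. Qed.

Lemma opposite_left_action (M : lmodType k) (act : M -> B -> M) :
  right_action act -> left_action (fun x m => act m (s x)).
Proof.
move=> actP; have ab := ract_bilin actP.
split=> [|m|m x y]; first by lin.
  by rewrite s1 (ract1 actP).
by rewrite sM (ractM actP).
Qed.

Lemma opposite_right_action (M : lmodType k) (act : A -> M -> M) :
  left_action act -> right_action (fun m x => act (t x) m).
Proof.
move=> actP; have ab := lact_bilin actP.
split=> [|m|m x y]; first by lin.
  by rewrite anti_inverse1 (lact1 actP).
by rewrite anti_inverseM (lactM actP).
Qed.

Lemma opposite_modules : cat_equivalent (rmod_cat B) (lmod_cat A).
Proof.
apply: adjoint_equivalence_equivalent.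
apply: (@concrete_equivalence k (rmod B) (@rmod_car k B) _ _ _ (lmod A) (@lmod_car k A) _ _ _
  (fun M => Lmod (opposite_left_action (rmodP M))) (fun M => Rmod (opposite_right_action (lmodP M)))
  (fun M => (@idfun (rmod_car M) : {linear _ -> _})) (fun M => (@idfun (rmod_car M) : {linear _ -> _}))
  (fun M => (@idfun (lmod_car M) : {linear _ -> _})) (fun M => (@idfun (lmod_car M) : {linear _ -> _}))).
- by [].
- by [].
- by [].
- by [].
- by move=> M N f fP x m /=; rewrite fP.
- by move=> M N f fP m x /=; rewrite fP.
- by move=> M; split=> m x /=; rewrite tK.
- by move=> M; split=> x m /=; rewrite sK.
Qed.

End AntiIsomorphicAlgebras.

Section AntiIsomorphicCoalgebras.
Variables (k : fieldType) (C D : coalgType k).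
Variables (u : {linear C -> D}) (v : {linear D -> C}).
Hypotheses (uK : cancel u v) (vK : cancel v u).
Hypotheses (uE : forall c, comul (u c) = tmap u u (tswap C C (comul c)))
  (u_counit : forall c, counit (u c) = counit c).

Lemma anti_inverse_comul d : comul (v d) = tmap v v (tswap D D (comul d)).
Proof.
rewrite -{2}[d]vK uE tswap_tmap tswapK tmap_comp -[LHS]tmap_id.
by apply: eq_tmap => x /=; rewrite uK.
Qed.

Lemma anti_inverse_counit d : counit (v d) = counit d.
Proof. by rewrite -[d in RHS]vK u_counit. Qed.

End AntiIsomorphicCoalgebras.

Section SwappedCoactions.
Variables (k : fieldType) (C D : coalgType k) (u : {linear C -> D}).
Hypotheses (uE : forall c, comul (u c) = tmap u u (tswap C C (comul c)))
  (u_counit : forall c, counit (u c) = counit c).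
Variable M : lmodType k.

Lemma anti_comul_tlift (W : lmodType k) (F : D -> D -> W) c : bilinear_map F ->
  tlift F (comul (u c)) = tlift (fun c1 c2 => F (u c2) (u c1)) (comul c).
Proof.
move=> bF; rewrite uE tlift_tmap // tlift_tswap //; lin.
Qed.

Definition swap_lcoact (lam : M -> C \ox M) (m : M) : M \ox D := tmap idfun u (tswap C M (lam m)).
Definition swap_rcoact (rho : M -> M \ox C) (m : M) : D \ox M := tmap u idfun (tswap M C (rho m)).

Lemma swap_lcoactE lam (W : lmodType k) (F : M -> D -> W) m : bilinear_map F ->
  tlift F (swap_lcoact lam m) = tlift (fun c n => F n (u c)) (lam m).
Proof. by move=> bF; rewrite /swap_lcoact tlift_tmap // tlift_tswap //; lin. Qed.

Lemma swap_rcoactE rho (W : lmodType k) (F : D -> M -> W) m : bilinear_map F ->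
  tlift F (swap_rcoact rho m) = tlift (fun n c => F (u c) n) (rho m).
Proof. by move=> bF; rewrite /swap_rcoact tlift_tmap // tlift_tswap //; lin. Qed.

Lemma swap_right_coaction lam : left_coaction lam -> right_coaction (swap_lcoact lam).
Proof.
move=> lamP; have ll : lin lam := lcoact_linear lamP.
have ls : lin (swap_lcoact lam) by rewrite /swap_lcoact; lin.
split=> [|m|m]; first exact: ls.
  rewrite (tassoc_tlift _ ls) tmap_idl_tlift !swap_lcoactE; [|by lin..].
  transitivity (tlift (fun c n => tlift (fun c' n' => n' \ox (u c' \ox u c)) (lam n)) (lam m)).
    by apply: eq_tlift => c n; rewrite swap_lcoactE //; lin.
  rewrite -(tlift_coassoc (d := comul) (e := linmap ll) (lcoactA lamP m)
    (F := fun c1 c2 n => n \ox (u c2 \ox u c1))); last by lin.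
  by apply: eq_tlift => c n; rewrite anti_comul_tlift //; lin.
rewrite swap_lcoactE; last by lin.
by rewrite -[RHS](lcoact1 lamP); apply: eq_tlift => c n; rewrite u_counit.
Qed.

Lemma swap_left_coaction rho : right_coaction rho -> left_coaction (swap_rcoact rho).
Proof.
move=> rhoP; have lr : lin rho := rcoact_linear rhoP.
have ls : lin (swap_rcoact rho) by rewrite /swap_rcoact; lin.
have lc : lin (@comul k D) by move=> a x y; apply: linearP.
split=> [|m|m]; first exact: ls.
  rewrite (tassoc_tlift _ lc) tmap_idl_tlift !swap_rcoactE; [|by lin..].
  transitivity (tlift (fun n c => tlift (fun c1 c2 => u c2 \ox (u c1 \ox n)) (comul c)) (rho m)).
    by apply: eq_tlift => n c; rewrite anti_comul_tlift //; lin.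
  rewrite -(tlift_coassoc (d := linmap lr) (e := comul) (rcoactA rhoP m)
    (F := fun n c1 c2 => u c2 \ox (u c1 \ox n))); last by lin.
  by apply: eq_tlift => n c; rewrite swap_rcoactE //; lin.
rewrite swap_rcoactE; last by lin.
by rewrite -[RHS](rcoact1 rhoP); apply: eq_tlift => n c; rewrite u_counit.
Qed.

End SwappedCoactions.

Section OppositeComodules.
Variables (k : fieldType) (C D : coalgType k).
Variables (u : {linear C -> D}) (v : {linear D -> C}).
Hypotheses (uK : cancel u v) (vK : cancel v u).
Hypotheses (uE : forall c, comul (u c) = tmap u u (tswap C C (comul c)))
  (u_counit : forall c, counit (u c) = counit c).

Lemma swap_lcoactK (M : lmodType k) (lam : M -> C \ox M) m :
  swap_rcoact v (swap_lcoact u lam) m = lam m.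
Proof.
rewrite /swap_rcoact /swap_lcoact tswap_tmap tswapK tmap_comp -[RHS]tmap_id.
by apply: eq_tmap => // c /=; rewrite uK.
Qed.

Lemma swap_rcoactK (M : lmodType k) (rho : M -> M \ox D) m :
  swap_lcoact u (swap_rcoact v rho) m = rho m.
Proof.
rewrite /swap_rcoact /swap_lcoact tswap_tmap tswapK tmap_comp -[RHS]tmap_id.
by apply: eq_tmap => // c /=; rewrite vK.
Qed.

Lemma swap_lcoact_mor (M N : lmodType k) (lamM : M -> C \ox M) (lamN : N -> C \ox N)
    (f : {linear M -> N}) :
  lcoact_mor lamM lamN f -> rcoact_mor (swap_lcoact u lamM) (swap_lcoact u lamN) f.
Proof.
move=> fP m; rewrite /swap_lcoact fP tswap_tmap !tmap_comp.
exact: eq_tmap.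
Qed.

Lemma swap_rcoact_mor (M N : lmodType k) (rhoM : M -> M \ox D) (rhoN : N -> N \ox D)
    (f : {linear M -> N}) :
  rcoact_mor rhoM rhoN f -> lcoact_mor (swap_rcoact v rhoM) (swap_rcoact v rhoN) f.
Proof.
move=> fP m; rewrite /swap_rcoact fP tswap_tmap !tmap_comp.
exact: eq_tmap.
Qed.

Definition swap_lcomod (V : lcomod C) : rcomod D :=
  Rcomod (swap_right_coaction uE u_counit (lcomodP V)).

Definition swap_rcomod (V : rcomod D) : lcomod C :=
  Lcomod (swap_left_coaction (anti_inverse_comul uK vK uE)
    (anti_inverse_counit vK u_counit) (rcomodP V)).

Definition lcomod_equivalence := @concrete_equivalence k
  (lcomod C) (@lcomod_car k C) (fun M N f => lcoact_mor (@lcoact k C M) (@lcoact k C N) f)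
  (fun M => lcoact_mor_id (@lcoact k C M)) (fun M N P g f => @lcoact_mor_cmp k C M N P _ _ _ g f)
  (rcomod D) (@rcomod_car k D) (fun M N f => rcoact_mor (@rcoact k D M) (@rcoact k D N) f)
  (fun M => rcoact_mor_id (@rcoact k D M)) (fun M N P g f => @rcoact_mor_cmp k D M N P _ _ _ g f)
  swap_lcomod swap_rcomod
  (fun M => (@idfun (lcomod_car M) : {linear _ -> _}))
  (fun M => (@idfun (lcomod_car M) : {linear _ -> _}))
  (fun M => (@idfun (rcomod_car M) : {linear _ -> _}))
  (fun M => (@idfun (rcomod_car M) : {linear _ -> _}))
  (fun M => @frefl _ _ idfun) (fun M => @frefl _ _ idfun)
  (fun M => @frefl _ _ idfun) (fun M => @frefl _ _ idfun)
  (fun M N f fP => swap_lcoact_mor fP) (fun M N f fP => swap_rcoact_mor fP)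
  (fun M => conj (fun m => etrans (swap_lcoactK _ m) (esym (tmap_id _)))
                 (fun m => etrans (esym (swap_lcoactK _ m)) (esym (tmap_id _))))
  (fun M => conj (fun m => etrans (swap_rcoactK _ m) (esym (tmap_id _)))
                 (fun m => etrans (esym (swap_rcoactK _ m)) (esym (tmap_id _)))).

End OppositeComodules.

(** * The co-opposite Hopf algebra *)

Section CoOpposite.
Variables (k : fieldType) (H : hopfAlgType k) (S' : H -> H).
Local Notation S := (@antipode k H).
Hypotheses (SK : cancel S S') (S'K : cancel S' S).

Let lS' := inverse_antipode_lin SK S'K.

Definition cop_comul (x : H) : H \ox H := tswap H H (comul x).

Lemma cop_comulE (W : lmodType k) (F : H -> H -> W) x : bilinear_map F ->
  tlift F (cop_comul x) = tlift (fun u v => F v u) (comul x).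
Proof. by move=> bF; rewrite /cop_comul tlift_tswap. Qed.

Lemma cop_comul_linear : linear cop_comul.
Proof. by change (lin cop_comul); rewrite /cop_comul; lin. Qed.

Lemma cop_comulA x : tassoc (tmap cop_comul idfun (cop_comul x)) = tmap idfun cop_comul (cop_comul x).
Proof.
have lc := cop_comul_linear; rewrite -/(lin _) in lc.
rewrite (tassoc_tlift _ lc) tmap_idl_tlift !cop_comulE; [|by lin..].
transitivity (tlift (fun u v => tlift (fun v1 v2 => v2 \ox (v1 \ox u)) (comul v)) (comul x)).
  by apply: eq_tlift => u v; rewrite cop_comulE //; lin.
rewrite -(comul_coassoc (F := fun u v1 v2 => v2 \ox (v1 \ox u))); last by lin.
by apply: eq_tlift => u v; rewrite cop_comulE //; lin.
Qed.

Lemma cop_counitl x : tlift (fun y z => counit y *: z) (cop_comul x) = x.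
Proof. by rewrite cop_comulE ?counitr //; lin. Qed.

Lemma cop_counitr x : tlift (fun y z => counit z *: y) (cop_comul x) = x.
Proof. by rewrite cop_comulE ?counitl //; lin. Qed.

Lemma cop_comulM x y : cop_comul (x * y) = tmap2 *%R *%R (cop_comul x) (cop_comul y).
Proof.
rewrite tmap2_tlift cop_comulE; last by lin.
rewrite -[LHS]tlift_tens cop_comulE; last by lin.
rewrite comulM_tlift; last by lin.
by apply: eq_tlift => u v; rewrite cop_comulE //; lin.
Qed.

Lemma cop_comul1 : cop_comul 1 = 1 \ox 1.
Proof. by rewrite /cop_comul comul1 tswapE. Qed.

Lemma cop_antipodel x : tlift (fun y z => S' y * z) (cop_comul x) = counit x *: 1.
Proof.
rewrite cop_comulE; last by lin.
exact: (tlift_inverse_antipodel SK S'K (f := fun h => h)).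
Qed.

Lemma cop_antipoder x : tlift (fun y z => y * S' z) (cop_comul x) = counit x *: 1.
Proof.
rewrite cop_comulE; last by lin.
exact: (tlift_inverse_antipoder SK S'K (f := fun h => h)).
Qed.

(** A copy of H whose type mentions the proofs, so that its co-opposite structure is not confused
    with the structure of H and the antipode [S'] can be attached to it. *)
Definition cop_type & cancel S S' & cancel S' S : Type := H.
Local Notation T := (cop_type SK S'K).

HB.instance Definition _ := GRing.Algebra.on T.
HB.instance Definition _ := Lmodule_isCoalgebra.Build k T cop_comul_linear (@counit_scalar k H)
  cop_comulA cop_counitl cop_counitr.
HB.instance Definition _ := isHopfAlgebra.Build k T cop_comulM cop_comul1 (@counitM k H)
  (@counit1 k H) lS' cop_antipodel cop_antipoder.

Definition cop : hopfAlgType k := T.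

Lemma cop_antipodeK : cancel (@antipode k cop) S. Proof. exact: S'K. Qed.
Lemma cop_antipodeVK : cancel S (@antipode k cop). Proof. exact: SK. Qed.

End CoOpposite.

Lemma tens_in_tswap (k : fieldType) (V W : lmodType k) (P : {pred V}) (Q : {pred W}) t :
  tens_in P Q t -> tens_in Q P (tswap V W t).
Proof.
move=> [s sPQ ->]; exists [seq (p.2, p.1) | p <- s].
  by rewrite all_map; apply: sub_all sPQ => p /=; rewrite andbC.
rewrite linear_sum big_map; apply: eq_bigr => p _.
exact: tswapE.
Qed.

Section CoOppositeFactor.
Variables (k : fieldType) (H : hopfAlgType k) (I : left_ideal_coideal H) (S' : H -> H).
Local Notation S := (@antipode k H).
Hypotheses (SK : cancel S S') (S'K : cancel S' S).
Local Notation Hc := (cop SK S'K).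

Lemma cop_lic_comul (x : H) : x \in lic_pred I -> exists s t,
  [/\ tens_in (lic_pred I) predT s, tens_in predT (lic_pred I) t & cop_comul x = s + t].
Proof.
move=> /lic_comul [s [t [sI tI E]]]; exists (tswap _ _ t), (tswap _ _ s).
split; [exact: tens_in_tswap | exact: tens_in_tswap |].
by rewrite /cop_comul E linearD addrC.
Qed.

Definition cop_lic : left_ideal_coideal Hc :=
  @LeftIdealCoideal k Hc (lic_pred I) (lic_submod I) (@lic_mul k H I) (@lic_counit k H I) cop_lic_comul.

Local Notation C := (factor I).
Local Notation D := (factor cop_lic).

(** The quotients of H and of its co-opposite by the same ideal are distinct types, so the
    identification has to be built; only its values on classes matter. *)
Lemma cop_factor_exists : exists2 u : {linear C -> D},
  forall h, u (factor_pi I h) = factor_pi cop_lic h & exists2 v : {linear D -> C},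
  forall h, v (factor_pi cop_lic h) = factor_pi I h & cancel u v /\ cancel v u.
Proof.
pose q : {linear H -> D} := (@factor_pi k Hc cop_lic : {linear Hc -> D}).
have [||u uE] := @lift_surjective k H C D (@factor_pi k H I) q.
- by elim/factor_ind=> h; exists h.
- move=> h; rewrite -(linear0 (@factor_pi k H I)) => /factor_piP; rewrite subr0 => hI.
  exact: (@factor_pi0 k Hc cop_lic).
have [||v vE] := @lift_surjective k H D C q (@factor_pi k H I).
- by elim/factor_ind=> h; exists h.
- move=> h; rewrite -(linear0 q) => /factor_piP; rewrite subr0 => hI.
  exact: (@factor_pi0 k H I).
exists u => //; exists v => //; split.
  by elim/factor_ind=> h; rewrite uE vE.
by elim/factor_ind=> h; rewrite vE uE.
Qed.

Definition cop_factor : {linear C -> D} := s2val (cid2 cop_factor_exists).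

Lemma cop_factorE h : cop_factor (factor_pi I h) = factor_pi cop_lic h.
Proof. exact: (s2valP (cid2 cop_factor_exists)). Qed.

Definition cop_factor_inv : {linear D -> C} := s2val (cid2 (s2valP' (cid2 cop_factor_exists))).

Lemma cop_factor_invE h : cop_factor_inv (factor_pi cop_lic h) = factor_pi I h.
Proof. exact: (s2valP (cid2 (s2valP' (cid2 cop_factor_exists)))). Qed.

Lemma cop_factorK : cancel cop_factor cop_factor_inv.
Proof. by case: (s2valP' (cid2 (s2valP' (cid2 cop_factor_exists)))). Qed.

Lemma cop_factor_invK : cancel cop_factor_inv cop_factor.
Proof. by case: (s2valP' (cid2 (s2valP' (cid2 cop_factor_exists)))). Qed.

Lemma cop_factor_comul c : comul (cop_factor c) = tmap cop_factor cop_factor (tswap C C (comul c)).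
Proof.
elim/factor_ind: c => h; rewrite cop_factorE.
apply: etrans (@factor_comulE k Hc cop_lic h) _.
rewrite [comul (_ : C)](@factor_comulE k H I h) [comul _]/(cop_comul h) /cop_comul.
rewrite tswap_tmap tmap_comp; apply: eq_tmap => x /=; exact: esym (cop_factorE x).
Qed.

Lemma cop_factor_counit c : counit (cop_factor c) = counit c.
Proof.
elim/factor_ind: c => h; rewrite cop_factorE.
by apply: etrans (@factor_counitE k Hc cop_lic h) _; rewrite [RHS]factor_counitE.
Qed.

Lemma cop_factor_act (h : H) c : cop_factor (factor_act h c) = factor_act (h : Hc) (cop_factor c).
Proof.
elim/factor_ind: c => x; rewrite cop_factorE factor_actE cop_factorE.
exact: esym (@factor_actE k Hc cop_lic h x).
Qed.

Lemma cop_factor_inv_act (h : H) c :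
  cop_factor_inv (factor_act (h : Hc) c) = factor_act h (cop_factor_inv c).
Proof. by apply: (can_inj cop_factorK); rewrite cop_factor_act !cop_factor_invK. Qed.

End CoOppositeFactor.

Lemma tens_in_tmap (k : fieldType) (V W V' W' : lmodType k) (f : {linear V -> V'}) (g : {linear W -> W'})
    (P : {pred V}) (Q : {pred W}) (P' : {pred V'}) (Q' : {pred W'}) t :
  (forall x, x \in P -> f x \in P') -> (forall y, y \in Q -> g y \in Q') ->
  tens_in P Q t -> tens_in P' Q' (tmap f g t).
Proof.
move=> fP gQ [s sPQ ->]; exists [seq (f p.1, g p.2) | p <- s].
  rewrite all_map; apply: sub_all sPQ => p /= /andP [p1 p2].
  by rewrite fP // gQ.
rewrite linear_sum big_map; apply: eq_bigr => p _.
exact: tmapE.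
Qed.

Section StableSubcoalgebraTransport.
Variables (k : fieldType) (H1 H2 : hopfAlgType k).
Variables (I1 : left_ideal_coideal H1) (I2 : left_ideal_coideal H2).
Local Notation C := (factor I1).
Local Notation D := (factor I2).
Variables (u : {linear C -> D}) (v : {linear D -> C}) (a : H2 -> H1).
Hypotheses (uK : cancel u v) (vK : cancel v u).
Hypothesis uE : forall c, comul (u c) = tmap u u (tswap C C (comul c)).
Hypothesis va : forall h d, v (factor_act h d) = factor_act (a h) (v d).

(** Being a subcoalgebra is symmetric in the two tensor factors, so an anti-isomorphism of
    coalgebras respects it. *)
Lemma proper_stable_transport (R : {pred C}) :
  proper_stable_subcoalg R -> proper_stable_subcoalg (fun d : D => v d \in R).
Proof.
move=> [Rsub Rco Ract [c cR]]; split.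
- split=> [|b x y xR yR]; first by rewrite unfold_in linear0; case: Rsub.
  by rewrite unfold_in linearP; case: Rsub => _; apply.
- move=> d dR; rewrite -[d]vK uE; apply: tens_in_tmap (tens_in_tswap (Rco _ dR)) => x xR;
  by rewrite unfold_in uK.
- by move=> h d dR; rewrite unfold_in va; apply: Ract.
- by exists (u c); rewrite unfold_in uK.
Qed.

Lemma swap_lcoact_in (M : lmodType k) (lam : M -> C \ox M) m (R : {pred C}) :
  tens_in R predT (lam m) -> tens_in predT (fun d : D => v d \in R) (swap_lcoact u lam m).
Proof.
by move=> /tens_in_tswap; apply: tens_in_tmap => // c cR; rewrite unfold_in uK.
Qed.

Lemma swap_rcoact_in (M : lmodType k) (rho : M -> M \ox C) m (R : {pred C}) :
  tens_in predT R (rho m) -> tens_in (fun d : D => v d \in R) predT (swap_rcoact u rho m).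
Proof.
by move=> /tens_in_tswap; apply: tens_in_tmap => // c cR; rewrite unfold_in uK.
Qed.

End StableSubcoalgebraTransport.

(** * Torsion, Hopf modules and coflatness under passage to the co-opposite *)

Section CoOppositeTransport.
Variables (k : fieldType) (H : hopfAlgType k) (I : left_ideal_coideal H) (S' : H -> H).
Local Notation S := (@antipode k H).
Hypotheses (SK : cancel S S') (S'K : cancel S' S).
Local Notation Hc := (cop SK S'K).
Local Notation Ic := (cop_lic I SK S'K).
Local Notation C := (factor I).
Local Notation D := (factor Ic).
Local Notation u := (cop_factor I SK S'K).
Local Notation v := (cop_factor_inv I SK S'K).

Let uK : cancel u v := @cop_factorK k H I S' SK S'K.
Let vK : cancel v u := @cop_factor_invK k H I S' SK S'K.
Let uE := @cop_factor_comul k H I S' SK S'K.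
Let u_counit := @cop_factor_counit k H I S' SK S'K.
Let vE := anti_inverse_comul uK vK uE.
Let v_counit := anti_inverse_counit vK u_counit.
Let va (h : Hc) d : v (factor_act h d) = factor_act (h : H) (v d) := @cop_factor_inv_act k H I S' SK S'K h d.
Let ua (h : H) c : u (factor_act h c) = factor_act (h : Hc) (u c) := @cop_factor_act k H I S' SK S'K h c.

Local Notation to_cop := (swap_lcomod uE u_counit).
Local Notation from_cop := (swap_rcomod uK vK uE u_counit).

Lemma lcomod_T_cop (V : lcomod_cat C) : lcomod_T V <-> rcomod_T (to_cop V).
Proof.
split=> VT m; have [R Rp mR] := VT m.
  exists (fun d : D => v d \in R); first exact: (@proper_stable_transport k H Hc I Ic u v (fun h => h) uK vK uE va _ Rp).
  exact: (@swap_lcoact_in k H Hc I Ic u v uK _ _ _ _ mR).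
exists (fun c : C => u c \in R); first exact: (@proper_stable_transport k Hc H Ic I v u (fun h => h) vK uK vE ua _ Rp).
rewrite -(swap_lcoactK uK (@lcoact k C V) m).
exact: (@swap_rcoact_in k Hc H Ic I v u vK _ _ _ _ mR).
Qed.

Lemma rcomod_T_cop (W : rcomod_cat D) : rcomod_T W <-> lcomod_T (from_cop W).
Proof.
split=> WT m; have [R Rp mR] := WT m.
  exists (fun c : C => u c \in R); first exact: (@proper_stable_transport k Hc H Ic I v u (fun h => h) vK uK vE ua _ Rp).
  exact: (@swap_rcoact_in k Hc H Ic I v u vK _ _ _ _ mR).
exists (fun d : D => v d \in R); first exact: (@proper_stable_transport k H Hc I Ic u v (fun h => h) uK vK uE va _ Rp).
rewrite -(swap_rcoactK vK (@rcoact k D W) m).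
exact: (@swap_lcoact_in k H Hc I Ic u v uK _ _ _ _ mR).
Qed.

Lemma cop_Hmod_lcompat (M : Hmod_lcomod I) (h : Hc) (m : Hl_car M) :
  swap_lcoact u (@Hl_coact k H I M) (@Hl_act k H I M h m) =
  tmap2 (@Hl_act k H I M : Hc -> _) (@factor_act k Hc Ic) (comul h) (swap_lcoact u (@Hl_coact k H I M) m).
Proof.
have ab : bilinear_map (@Hl_act k H I M) := lact_bilin (Hl_actP M).
have cb := factor_act_bilin I.
have db : bilinear_map (fun (h : H) (d : D) => factor_act (h : Hc) d) := factor_act_bilin Ic.
rewrite -[LHS]tlift_tens swap_lcoactE; last by lin.
rewrite Hl_compat tmap2_tlift tlift_tlift; last by lin.
rewrite [RHS]tmap2_tlift [RHS](@cop_comulE k H _ (fun u u' => tlift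
  (fun n d => @Hl_act k H I M u n \ox factor_act (u' : Hc) d) (swap_lcoact _ _ m)) h); last by lin.
apply: eq_tlift => h1 h2; rewrite tlift_tlift; last by lin.
rewrite swap_lcoactE; last by lin.
apply: eq_tlift => c n; rewrite tliftE; last by lin.
by rewrite ua.
Qed.

Lemma cop_Hmod_rcompat (M : Hmod_rcomod Ic) (h : H) (m : Hr_car M) :
  swap_rcoact v (@Hr_coact k Hc Ic M) (@Hr_act k Hc Ic M h m) =
  tmap2 (@factor_act k H I) (@Hr_act k Hc Ic M : H -> _) (comul h) (swap_rcoact v (@Hr_coact k Hc Ic M) m).
Proof.
have ab : bilinear_map (@Hr_act k Hc Ic M : H -> _ -> _) := lact_bilin (Hr_actP M).
have cb := factor_act_bilin I.
have db : bilinear_map (fun (h : H) (d : D) => factor_act (h : Hc) d) := factor_act_bilin Ic.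
rewrite -[LHS]tlift_tens swap_rcoactE; last by lin.
rewrite Hr_compat tmap2_tlift [LHS]tlift_tlift; last by lin.
rewrite [LHS](@cop_comulE k H _ (fun u u' => tlift (fun n d => v d \ox n) (tlift
  (fun n d => @Hr_act k Hc Ic M u n \ox factor_act (u' : Hc) d) (Hr_coact m))) h); last by lin.
rewrite tmap2_tlift; apply: eq_tlift => h1 h2; rewrite tlift_tlift; last by lin.
rewrite swap_rcoactE; last by lin.
apply: eq_tlift => n d; rewrite tliftE; last by lin.
by rewrite -va.
Qed.

Definition cop_Hmod_lcomod (M : Hmod_lcomod I) : Hmod_rcomod Ic :=
  @HmodRcomod k Hc Ic (Hl_car M) (@Hl_act k H I M) (swap_lcoact u (@Hl_coact k H I M))
    (Hl_actP M) (swap_right_coaction uE u_counit (Hl_coactP M)) (@cop_Hmod_lcompat M).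

Definition cop_Hmod_rcomod (M : Hmod_rcomod Ic) : Hmod_lcomod I :=
  @HmodLcomod k H I (Hr_car M) (@Hr_act k Hc Ic M) (swap_rcoact v (@Hr_coact k Hc Ic M))
    (Hr_actP M) (swap_left_coaction vE v_counit (Hr_coactP M)) (@cop_Hmod_rcompat M).

Lemma Hmod_lcomod_T_cop (M : Hmod_lcomod_cat I) : Hmod_lcomod_T M <-> @Hmod_rcomod_T k Hc Ic (cop_Hmod_lcomod M).
Proof. exact: lcomod_T_cop. Qed.

Lemma Hmod_rcomod_T_cop (M : Hmod_rcomod_cat Ic) : Hmod_rcomod_T M <-> @Hmod_lcomod_T k H I (cop_Hmod_rcomod M).
Proof. exact: rcomod_T_cop. Qed.

Lemma cop_Hmod_equivalence : exists (P : functor (Hmod_lcomod_cat I) (Hmod_rcomod_cat Ic))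
    (R : functor (Hmod_rcomod_cat Ic) (Hmod_lcomod_cat I)),
  [/\ forall M, P M = cop_Hmod_lcomod M, forall M, R M = cop_Hmod_rcomod M
    & inhabited (adjoint_equivalence P R)].
Proof.
have Fmor (M N : Hmod_lcomod I) (f : {linear Hl_car M -> Hl_car N}) :
    lact_mor (@Hl_act k H I M) (@Hl_act k H I N) f /\ lcoact_mor (@Hl_coact k H I M) (@Hl_coact k H I N) f ->
    lact_mor (@Hr_act k Hc Ic (cop_Hmod_lcomod M)) (@Hr_act k Hc Ic (cop_Hmod_lcomod N)) f /\
    rcoact_mor (@Hr_coact k Hc Ic (cop_Hmod_lcomod M)) (@Hr_coact k Hc Ic (cop_Hmod_lcomod N)) f.
  by move=> [fa fc]; split=> //; apply: swap_lcoact_mor.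
have Gmor (M N : Hmod_rcomod Ic) (f : {linear Hr_car M -> Hr_car N}) :
    lact_mor (@Hr_act k Hc Ic M) (@Hr_act k Hc Ic N) f /\ rcoact_mor (@Hr_coact k Hc Ic M) (@Hr_coact k Hc Ic N) f ->
    lact_mor (@Hl_act k H I (cop_Hmod_rcomod M)) (@Hl_act k H I (cop_Hmod_rcomod N)) f /\
    lcoact_mor (@Hl_coact k H I (cop_Hmod_rcomod M)) (@Hl_coact k H I (cop_Hmod_rcomod N)) f.
  by move=> [fa fc]; split=> //; apply: swap_rcoact_mor.
do 2 eexists; split; last first; first apply: inhabits.
  apply: (@concrete_equivalence k (Hmod_lcomod I) (@Hl_car k H I) _ _ _
    (Hmod_rcomod Ic) (@Hr_car k Hc Ic) _ _ _ cop_Hmod_lcomod cop_Hmod_rcomod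
    (fun M => (@idfun (Hl_car M) : {linear _ -> _})) (fun M => (@idfun (Hl_car M) : {linear _ -> _}))
    (fun M => (@idfun (Hr_car M) : {linear _ -> _})) (fun M => (@idfun (Hr_car M) : {linear _ -> _}))
    (fun M => @frefl _ _ idfun) (fun M => @frefl _ _ idfun)
    (fun M => @frefl _ _ idfun) (fun M => @frefl _ _ idfun) Fmor Gmor).
  - by move=> M; split; split=> // m; rewrite [RHS]tmap_id; [exact: swap_lcoactK | exact: esym (swap_lcoactK _ _ _)].
  - by move=> M; split; split=> // m; rewrite [RHS]tmap_id; [exact: swap_rcoactK | exact: esym (swap_rcoactK _ _ _)].
- by [].
- by [].
Qed.

(** Reversing the order of three tensor factors ([rev], injective) carries each side of one cotensor
    equation to the opposite side of the other. *)
Lemma cop_cotensorP (M : rcomod_cat D) (t : rcomod_car M \ox H) :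
  cotensor_pred (M := H_rcomod I) (N := from_cop M) (tswap (rcomod_car M) H t) <->
  @cotensor_elt k Hc Ic M t.
Proof.
have lr : lin (@rcoact k D M) := rcoact_linear (rcomodP M).
have lco : lin (@rcoact k C (H_rcomod I)) := rcoact_linear (rcomodP (H_rcomod I)).
pose rev (x : tensor (rcomod_car M) (tensor D H)) : tensor H (tensor C (rcomod_car M)) :=
  tlift (fun m => tlift (fun d h => h \ox (v d \ox m))) x.
have lrev : lin rev by rewrite /rev; lin.
pose rev' (x : tensor H (tensor C (rcomod_car M))) : tensor (rcomod_car M) (tensor D H) :=
  tlift (fun h => tlift (fun c m => m \ox (u c \ox h))) x.
have lrev' : lin rev' by rewrite /rev'; lin.
have revE m d h : rev (m \ox (d \ox h)) = h \ox (v d \ox m) by rewrite /rev !tliftE //; lin.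
have revK : cancel rev rev'.
  apply: tens_lin_ext; [lin|lin|] => m x.
  have l1 : lin (fun x => rev' (rev (m \ox x))) by lin.
  move: x; apply: (tens_lin_ext l1); [lin|] => d h.
  rewrite revE /rev' !tliftE; [|by lin..].
  by rewrite vK.
have E1 : tmap idfun (swap_rcoact v (@rcoact k D M)) (tswap (rcomod_car M) H t) =
    rev (tlift (fun m h => tlift (fun m0 d => m0 \ox (d \ox h)) (rcoact m)) t).
  have ls : lin (swap_rcoact v (@rcoact k D M)) by rewrite /swap_rcoact; lin.
  rewrite tmap_idl_tlift tlift_tswap; last by lin.
  rewrite (tlift_lin (g := rev)) //; apply: eq_tlift => m h.
  rewrite swap_rcoactE; last by lin.
  by rewrite (tlift_lin (g := rev)) //; apply: eq_tlift => m0 d; rewrite revE.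
have E2 : tassoc (tmap (@rcoact k C (H_rcomod I)) idfun (tswap (rcomod_car M) H t)) =
    rev (tlift (fun m h => tlift (fun h1 h2 => m \ox (factor_pi Ic h1 \ox h2)) (@comul k Hc h)) t).
  rewrite (tassoc_tlift _ lco) tlift_tswap; last by lin.
  rewrite (tlift_lin (g := rev)) //; apply: eq_tlift => m h.
  rewrite (tlift_lin (g := rev)) //.
  under [RHS]eq_tlift do rewrite revE cop_factor_invE.
  rewrite [RHS](@cop_comulE k H _ (fun x y => y \ox (factor_pi I x \ox m))); last by lin.
  by rewrite /= tlift_tmap //; lin.
split=> [/eqP tP|/cotensor_eltP tP].
  by apply/cotensor_eltP/(can_inj revK); rewrite -E1 -E2; apply/esym.
by apply/eqP; rewrite E2; apply: etrans (esym E1); rewrite tP.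
Qed.

Section CotensorSwap.
Variable M : rcomod_cat D.

Definition cop_cotensor (t : @cotensor k D M (H_lcomod Ic)) : @cotensor k C (H_rcomod I) (from_cop M) :=
  Cotensor ((cop_cotensorP _).2 (cotensorP t)).

Lemma cop_cotensor_inj : injective cop_cotensor.
Proof.
move=> t t' /(congr1 (@cotensor_val _ _ _ _)) E; apply: val_inj.
exact: (can_inj (@tswapK k (rcomod_car M) H)).
Qed.

Lemma cop_cotensor_onto t' : exists t, cop_cotensor t = t'.
Proof.
have tP : @cotensor_elt k Hc Ic M (tswap H (rcomod_car M) (cotensor_val t')).
  by apply/cop_cotensorP; rewrite tswapK; apply: cotensorP.
by exists (Cotensor tP); apply: val_inj; apply: tswapK.
Qed.

End CotensorSwap.

(** The sequence is transported to left C-comodules, where exactness is given, and the flip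
    identifies the two cotensor functors naturally. *)
Lemma cop_left_coflat : right_coflat (H_rcomod I) -> left_coflat (H_lcomod Ic).
Proof.
move=> coflat V W U f g [fgk fgc].
pose E := lcomod_equivalence uK vK uE u_counit.
(* Recovers the backward functor from the type of [E]. *)
pose back A B P (R : functor B A) (_ : @adjoint_equivalence A B P R) := R.
pose R : functor (rcomod_cat D) (lcomod_cat C) := back _ _ _ _ E.
have fgR : short_exact (fmap R f) (fmap R g).
  by split; [exact: (equivalence_kernel (adjoint_equivalence_sym E) fgk)
            |exact: (equivalence_cokernel (adjoint_equivalence_sym E) fgc)].
have /(short_exactP (vect_abelian k)) [finj gsurj fgE] := coflat _ _ _ _ _ fgR.
have swapE (X Y : rcomod_cat D) (h : hom X Y) t :
    fmap (cotensor_functor_r (H_rcomod I)) (fmap R h : @hom (lcomod_cat C) (from_cop X) (from_cop Y))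
      (cop_cotensor t) = cop_cotensor (fmap (cotensor_functor_l (H_lcomod Ic)) h t).
  apply: val_inj; apply: etrans (esym (@tswap_tmap k (rcomod_car X) H (rcomod_car Y) H h (@idfun H) _)).
  exact: eq_tmap.
apply/(short_exactP (vect_abelian k)); split.
- move=> t t' tt; apply/cop_cotensor_inj/finj.
  by rewrite !swapE tt.
- move=> y; have [x xE] := gsurj (cop_cotensor y); have [z zx] := cop_cotensor_onto x.
  by exists z; apply: cop_cotensor_inj; rewrite -xE -zx swapE.
- move=> x; split=> [gx0|[y yx]].
    have /fgE [y yE] : fmap (cotensor_functor_r (H_rcomod I)) (fmap R g) (cop_cotensor x) = 0.
      by rewrite swapE gx0; apply: val_inj; apply: linear0.
    have [z zy] := cop_cotensor_onto y.
    by exists z; apply: cop_cotensor_inj; rewrite -yE -zy swapE.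
  have E0 : cop_cotensor (fmap (cotensor_functor_l (H_lcomod Ic)) g x) = 0.
    by rewrite -swapE; apply/fgE; exists (cop_cotensor y); rewrite swapE yx.
  by apply: cop_cotensor_inj; rewrite E0; apply: val_inj; apply/esym/linear0.
Qed.

End CoOppositeTransport.

(** * Coinvariants of the co-opposite and the antipode *)

Section CoOppositeCoinvariants.
Variables (k : fieldType) (H : hopfAlgType k) (I : left_ideal_coideal H) (S' : H -> H).
Local Notation S := (@antipode k H).
Hypotheses (SK : cancel S S') (S'K : cancel S' S).
Local Notation Hc := (cop SK S'K).
Local Notation Ic := (cop_lic I SK S'K).
Local Notation A := (coinv I).
Local Notation B := (coinv Ic).

Let lS' := inverse_antipode_lin SK S'K.
Let lS : lin S := @antipode_linear k H.

(** Left coinvariants for the co-opposite are right coinvariants for H, and [S'] maps A into these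
    by [coinv_inverse_antipode]. *)
Lemma inverse_antipode_coinv (a : A) : @coinv_pred k Hc Ic (S' (coinv_val a)).
Proof.
apply/eqP; rewrite tlift_eq_tmap.
have lu : lin (cop_factor I SK S'K) by move=> b x y; apply: linearP.
rewrite [LHS](@cop_comulE k H _ (fun x y => factor_pi Ic x \ox y)); last by lin.
transitivity (tlift (fun x y => cop_factor I SK S'K (factor_pi I y) \ox x) (comul (S' (coinv_val a)))).
  by apply: eq_tlift => x y; rewrite cop_factorE.
rewrite (coinv_inverse_antipode SK S'K (F := fun x c => cop_factor I SK S'K c \ox x)); last by lin.
by rewrite cop_factorE.
Qed.

Lemma antipode_coinv (b : B) : @coinv_pred k H I (S (coinv_val b)).
Proof.
apply/eqP; rewrite tlift_eq_tmap.
have lv : lin (cop_factor_inv I SK S'K) by move=> c x y; apply: linearP.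
transitivity (tlift (fun x y => cop_factor_inv I SK S'K (factor_pi Ic y) \ox x)
    (@comul k Hc (S (coinv_val b)))).
  rewrite [RHS](@cop_comulE k H _ (fun x y => cop_factor_inv I SK S'K (factor_pi Ic y) \ox x)); last by lin.
  by apply: eq_tlift => x y; rewrite cop_factor_invE.
rewrite (@coinv_inverse_antipode k Hc Ic S S'K SK _
  (fun (x : H) d => cop_factor_inv I SK S'K d \ox x)); last by lin.
by rewrite cop_factor_invE.
Qed.

Lemma coinv_to_cop_linear : linear (fun a : A => Coinv (inverse_antipode_coinv a) : B).
Proof.
have lj : lin (@coinv_val k H I) by move=> c x y; apply: linearP.
by move=> c x y; apply: val_inj; apply: etrans (congr1 S' (lj c x y)) _; rewrite lS'.
Qed.

Lemma coinv_from_cop_linear : linear (fun b : B => Coinv (antipode_coinv b) : A).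
Proof.
have lj : lin (@coinv_val k Hc Ic) by move=> c x y; apply: linearP.
by move=> c x y; apply: val_inj; apply: etrans (congr1 S (lj c x y)) _; rewrite lS.
Qed.

Definition coinv_to_cop : {linear A -> B} := linmap coinv_to_cop_linear.
Definition coinv_from_cop : {linear B -> A} := linmap coinv_from_cop_linear.

Lemma coinv_to_copK : cancel coinv_to_cop coinv_from_cop.
Proof. by move=> a; apply: val_inj; apply: S'K. Qed.

Lemma coinv_from_copK : cancel coinv_from_cop coinv_to_cop.
Proof. by move=> b; apply: val_inj; apply: SK. Qed.

Lemma coinv_to_cop1 : coinv_to_cop 1 = 1.
Proof. by apply: val_inj; apply: (inverse_antipode1 SK). Qed.

Lemma coinv_to_copM a b : coinv_to_cop (a * b) = coinv_to_cop b * coinv_to_cop a.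
Proof. by apply: val_inj; apply: (inverse_antipodeM SK S'K). Qed.

Lemma cop_coinv_modules : cat_equivalent (rmod_cat B) (lmod_cat A).
Proof. exact: opposite_modules coinv_to_copK coinv_from_copK coinv_to_cop1 coinv_to_copM. Qed.

(** The reversal caused by [S'] is absorbed by the co-opposite comultiplication, so [S'] is a
    coalgebra map from H to its co-opposite. Hence right H-coactions can be pushed along it and stay
    on the right, while the A-action changes side. *)
Lemma inverse_antipode_coalg x : @comul k Hc (S' x) = tmap S' S' (comul x).
Proof.
rewrite -[LHS]tlift_tens [LHS](@cop_comulE k H _ (fun u v => u \ox v)); last by lin.
by rewrite (comul_inverse_antipode SK S'K (f := fun u v => v \ox u)); last by lin.
Qed.

Lemma antipode_coalg x : comul (S x) = tmap S S (@comul k Hc x).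
Proof.
rewrite -[LHS]tlift_tens comul_antipode; last by lin.
by rewrite tlift_eq_tmap [RHS](@cop_comulE k H _ (fun u v => S u \ox S v)); last by lin.
Qed.

Lemma coinv_coact_to_cop a :
  coinv_coact (coinv_to_cop a) = tmap coinv_to_cop (linmap lS') (coinv_coact a).
Proof.
apply/esym/coinv_coact_unique; rewrite [LHS]tmap_comp.
apply: etrans (esym (inverse_antipode_coalg (coinv_val a))).
rewrite -coinv_coactE [RHS](@tmap_comp _ _ _ _ _ _ _ _ _ (linmap lS') (linmap lS')).
exact: eq_tmap.
Qed.

Lemma coinv_coact_from_cop b :
  coinv_coact (coinv_from_cop b) = tmap coinv_from_cop (linmap lS) (coinv_coact b).
Proof.
apply/esym/coinv_coact_unique; rewrite [LHS]tmap_comp.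
apply: etrans (esym (antipode_coalg (coinv_val b))).
rewrite -coinv_coactE [RHS](@tmap_comp _ _ _ _ _ _ _ _ _ (linmap lS) (linmap lS)).
exact: eq_tmap.
Qed.

Section RelativeModules.

Let S_counit x : counit (S x) = @counit k Hc x := counit_antipode x.
Let S'_counit x : @counit k Hc (S' x) = counit x := counit_inverse_antipode S'K x.

Definition cop_rr_act (M : rmod_rcomod Ic) (a : A) (m : rr_car M) := rr_act m (coinv_to_cop a).
Definition cop_rr_coact (M : rmod_rcomod Ic) (m : rr_car M) : rr_car M \ox H :=
  tmap idfun (linmap lS) (rr_coact m).

Lemma cop_rr_compat (M : rmod_rcomod Ic) (a : A) (m : rr_car M) : exists2 t : A \ox H,
  tmap (@coinv_val k H I) idfun t = comul (a : H) &
  cop_rr_coact (cop_rr_act a m) = tmap2 (@cop_rr_act M) *%R t (cop_rr_coact m).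
Proof.
have ab : bilinear_map (@rr_act k Hc Ic M) := ract_bilin (rr_actP M).
exists (coinv_coact a); first exact: coinv_coactE.
rewrite tmap2_tlift /cop_rr_coact [LHS]tlift_eq_tmap /cop_rr_act.
rewrite [LHS](@rr_coact_act k Hc Ic M _ (fun n h => n \ox linmap lS h)); last by lin.
under [RHS]eq_tlift => a' h do [rewrite tlift_tmap; last by lin].
rewrite [RHS]tlift_exchange; apply: eq_tlift => m0 m1.
rewrite coinv_coact_to_cop tlift_tmap; last by lin.
apply: eq_tlift => a' h /=.
by apply: congr1; apply: etrans (@antipodeM k H m1 (S' h)) _; rewrite S'K.
Qed.

Definition cop_rr (M : rmod_rcomod Ic) : lmod_rcomod I :=
  @LmodRcomod k H I (rr_car M) (@cop_rr_act M) (@cop_rr_coact M)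
    (opposite_left_action coinv_to_cop1 coinv_to_copM (rr_actP M))
    (@push_coaction k Hc H (linmap lS) antipode_coalg S_counit (rr_car M) _ (rr_coactP M)) (@cop_rr_compat M).

Definition cop_lr_act (M : lmod_rcomod I) (m : lr_car M) (b : B) := lr_act (coinv_from_cop b) m.
Definition cop_lr_coact (M : lmod_rcomod I) (m : lr_car M) : lr_car M \ox Hc :=
  tmap idfun (linmap lS') (lr_coact m).

Lemma cop_lr_compat (M : lmod_rcomod I) (m : lr_car M) (b : B) : exists2 t : B \ox Hc,
  tmap (@coinv_val k Hc Ic) idfun t = comul (b : Hc) &
  cop_lr_coact (cop_lr_act m b) = tmap2 (@cop_lr_act M) *%R (cop_lr_coact m) t.
Proof.
have ab : bilinear_map (@lr_act k H I M) := lact_bilin (lr_actP M).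
exists (coinv_coact b); first exact: coinv_coactE.
rewrite tmap2_tlift /cop_lr_coact [LHS]tlift_eq_tmap /cop_lr_act.
have [t /coinv_coact_unique -> ->] := lr_compat (coinv_from_cop b) m.
rewrite tmap2_tlift [LHS]tlift_tlift; last by lin.
under [LHS]eq_tlift => a' h do [rewrite tlift_tlift; last by lin].
rewrite tlift_exchange [RHS]tlift_tmap; last by lin.
apply: eq_tlift => m0 m1.
rewrite coinv_coact_from_cop tlift_tmap; last by lin.
apply: eq_tlift => b' h; rewrite tliftE; last by lin.
by rewrite /= (inverse_antipodeM SK S'K) SK.
Qed.

Definition cop_lr (M : lmod_rcomod I) : rmod_rcomod Ic :=
  @RmodRcomod k Hc Ic (lr_car M) (@cop_lr_act M) (@cop_lr_coact M)
    (opposite_right_action coinv_to_copK coinv_from_copK coinv_to_cop1 coinv_to_copM (lr_actP M))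
    (@push_coaction k H Hc (linmap lS') inverse_antipode_coalg S'_counit (lr_car M) _ (lr_coactP M)) (@cop_lr_compat M).

Lemma cop_rr_coactK (M : rmod_rcomod Ic) m : cop_lr_coact (M := cop_rr M) m = rr_coact m.
Proof.
rewrite /cop_lr_coact [LHS](@tmap_comp _ _ _ _ _ _ _ idfun (linmap lS) idfun (linmap lS')) -[RHS]tmap_id.
by apply: eq_tmap => // h; apply: SK.
Qed.

Lemma cop_lr_coactK (M : lmod_rcomod I) m : cop_rr_coact (M := cop_lr M) m = lr_coact m.
Proof.
rewrite /cop_rr_coact [LHS](@tmap_comp _ _ _ _ _ _ _ idfun (linmap lS') idfun (linmap lS)) -[RHS]tmap_id.
by apply: eq_tmap => // h; apply: S'K.
Qed.

Lemma cop_rr_equivalent : cat_equivalent (rmod_rcomod_cat Ic) (lmod_rcomod_cat I).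
Proof.
have Fmor (M N : rmod_rcomod Ic) (f : {linear rr_car M -> rr_car N}) :
    ract_mor (@rr_act k Hc Ic M) (@rr_act k Hc Ic N) f /\ rcoact_mor (@rr_coact k Hc Ic M) (@rr_coact k Hc Ic N) f ->
    lact_mor (@lr_act k H I (cop_rr M)) (@lr_act k H I (cop_rr N)) f /\
    rcoact_mor (@lr_coact k H I (cop_rr M)) (@lr_coact k H I (cop_rr N)) f.
  move=> [fa fc]; split=> [a m|m]; first exact: fa.
  apply: etrans (congr1 (tmap idfun (linmap lS)) (fc m)) _.
  apply: etrans (@tmap_comp k _ _ _ _ _ _ f idfun idfun (linmap lS) (rr_coact m)) _.
  exact: esym (@tmap_comp k _ _ _ _ _ _ idfun (linmap lS) f idfun (rr_coact m)).
have Gmor (M N : lmod_rcomod I) (f : {linear lr_car M -> lr_car N}) :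
    lact_mor (@lr_act k H I M) (@lr_act k H I N) f /\ rcoact_mor (@lr_coact k H I M) (@lr_coact k H I N) f ->
    ract_mor (@rr_act k Hc Ic (cop_lr M)) (@rr_act k Hc Ic (cop_lr N)) f /\
    rcoact_mor (@rr_coact k Hc Ic (cop_lr M)) (@rr_coact k Hc Ic (cop_lr N)) f.
  move=> [fa fc]; split=> [m b|m]; first exact: fa.
  apply: etrans (congr1 (tmap idfun (linmap lS')) (fc m)) _.
  apply: etrans (@tmap_comp k _ _ _ _ _ _ f idfun idfun (linmap lS') (lr_coact m)) _.
  exact: esym (@tmap_comp k _ _ _ _ _ _ idfun (linmap lS') f idfun (lr_coact m)).
apply: adjoint_equivalence_equivalent.
apply: (@concrete_equivalence k (rmod_rcomod Ic) (@rr_car k Hc Ic) _ _ _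
  (lmod_rcomod I) (@lr_car k H I) _ _ _ cop_rr cop_lr
  (fun M => (@idfun (rr_car M) : {linear _ -> _})) (fun M => (@idfun (rr_car M) : {linear _ -> _}))
  (fun M => (@idfun (lr_car M) : {linear _ -> _})) (fun M => (@idfun (lr_car M) : {linear _ -> _}))
  (fun M => @frefl _ _ idfun) (fun M => @frefl _ _ idfun)
  (fun M => @frefl _ _ idfun) (fun M => @frefl _ _ idfun) Fmor Gmor).
- move=> M; split; split=> [m b|m].
  + by rewrite /= /cop_lr_act /= /cop_rr_act coinv_from_copK.
  + by rewrite [RHS]tmap_id; apply: cop_rr_coactK.
  + by rewrite /= /cop_lr_act /= /cop_rr_act coinv_from_copK.
  + by rewrite [RHS]tmap_id; apply/esym/cop_rr_coactK.
- move=> M; split; split=> [a m|m].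
  + by rewrite /= /cop_rr_act /= /cop_lr_act coinv_to_copK.
  + by rewrite [RHS]tmap_id; apply: cop_lr_coactK.
  + by rewrite /= /cop_rr_act /= /cop_lr_act coinv_to_copK.
  + by rewrite [RHS]tmap_id; apply/esym/cop_lr_coactK.
Qed.

End RelativeModules.

End CoOppositeCoinvariants.

Lemma left_coflat_equivalences (k : fieldType) (H : hopfAlgType k) (S' : H -> H)
    (SK : cancel (@antipode k H) S') (S'K : cancel S' (@antipode k H)) (I : left_ideal_coideal H) :
  left_coflat (H_lcomod I) ->
  (colocalizing (@rcomod_T k H I) /\ colocalizing (@Hmod_rcomod_T k H I)) /\
  (cat_equivalent (serre_quotient (@Hmod_rcomod_T k H I)) (rmod_cat (coinv I)) /\
   cat_equivalent (serre_quotient (@rcomod_T k H I)) (rmod_rcomod_cat I)).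
Proof.
move=> coflat.
have loc := rcomod_localization SK S'K coflat; have locH := Hmod_rcomod_localization SK S'K coflat.
split; first by split; [exact: localization_colocalizing loc | exact: localization_colocalizing locH].
by split; [exact: localization_equivalent locH | exact: localization_equivalent loc].
Qed.

Lemma right_coflat_equivalences (k : fieldType) (H : hopfAlgType k) (S' : H -> H)
    (SK : cancel (@antipode k H) S') (S'K : cancel S' (@antipode k H)) (I : left_ideal_coideal H) :
  right_coflat (H_rcomod I) ->
  (colocalizing (@lcomod_T k H I) /\ colocalizing (@Hmod_lcomod_T k H I)) /\
  (cat_equivalent (serre_quotient (@Hmod_lcomod_T k H I)) (lmod_cat (coinv I)) /\
   cat_equivalent (serre_quotient (@lcomod_T k H I)) (lmod_rcomod_cat I)).
Proof.
move=> /(@cop_left_coflat k H I S' SK S'K) coflat.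
(* The antipode of the co-opposite is [S'], with inverse [S]; the two cancellation hypotheses
   exchange roles. *)
have [[colT colHT] [eqHT eqT]] :=
  left_coflat_equivalences (@cop_antipodeK k H S' SK S'K) (@cop_antipodeVK k H S' SK S'K) coflat.
pose E := lcomod_equivalence (@cop_factorK k H I S' SK S'K) (@cop_factor_invK k H I S' SK S'K)
  (@cop_factor_comul k H I S' SK S'K) (@cop_factor_counit k H I S' SK S'K).
have [P [R [PE RE [EH]]]] := @cop_Hmod_equivalence k H I S' SK S'K.
have SP M : @Hmod_lcomod_T k H I M <-> @Hmod_rcomod_T k _ (cop_lic I SK S'K) (P M).
  by rewrite PE; apply: Hmod_lcomod_T_cop.
have SR M : @Hmod_rcomod_T k _ (cop_lic I SK S'K) M <-> @Hmod_lcomod_T k H I (R M).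
  by rewrite RE; apply: Hmod_rcomod_T_cop.
have TP := @lcomod_T_cop k H I S' SK S'K; have TR := @rcomod_T_cop k H I S' SK S'K.
split; split.
- exact: (colocalizing_transport E TP TR).
- exact: (colocalizing_transport EH SP SR).
- apply: cat_equivalent_trans (quotient_equivalence EH SP SR) _.
  exact: cat_equivalent_trans eqHT (cop_coinv_modules I SK S'K).
- apply: cat_equivalent_trans (quotient_equivalence E TP TR) _.
  exact: cat_equivalent_trans eqT (cop_rr_equivalent I SK S'K).
Qed.

Theorem theorem10p6 (k : fieldType) (H : hopfAlgType k)
    (bijective_antipode : bijective (@antipode k H)) (I : left_ideal_coideal H) :
  (left_coflat (H_lcomod I) ->
    (colocalizing (@rcomod_T k H I) /\ colocalizing (@Hmod_rcomod_T k H I)) /\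
    (cat_equivalent (serre_quotient (@Hmod_rcomod_T k H I)) (rmod_cat (coinv I)) /\
     cat_equivalent (serre_quotient (@rcomod_T k H I)) (rmod_rcomod_cat I))) /\
  (right_coflat (H_rcomod I) ->
    (colocalizing (@lcomod_T k H I) /\ colocalizing (@Hmod_lcomod_T k H I)) /\
    (cat_equivalent (serre_quotient (@Hmod_lcomod_T k H I)) (lmod_cat (coinv I)) /\
     cat_equivalent (serre_quotient (@lcomod_T k H I)) (lmod_rcomod_cat I))).
Proof.
have [S' SK S'K] := bijective_antipode; split.
  exact: (left_coflat_equivalences SK S'K).
exact: (right_coflat_equivalences SK S'K).
Qed.
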